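(* Let $d\ge3$ and let $f_{\mathrm{in}}$ be a normalized initial datum with finite entropy (see context). (i) Let $\gamma\in(-2,0]$. Then, given any $f\ge0$ with the same mass, second moment and entropy as $f_{\mathrm{in}}$, for any Lipschitz $\phi$ with compact support and any $\varepsilon\in(0,1)$, $$\int_{\mathbb{R}^d}\phi^2h_{f,\gamma}\,dv\le\varepsilon\int_{\mathbb{R}^d}(A_{f,\gamma}\nabla\phi,\nabla\phi)\,dv+C(f_{\mathrm{in}},d,\gamma)\,\varepsilon^{\frac{\gamma}{2+\gamma}}\int_{\mathbb{R}^d}\phi^2\langle v\rangle^\gamma\,dv.$$ (ii) Let $\gamma\in[-d,-2]$. Let $f\ge0$ (with the same mass, second moment and entropy as $f_{\mathrm{in}}$) be locally doubling: there is $C_D>1$ with $\int_{B_{2r}(v_0)}f\,dv\le C_D\int_{B_r(v_0)}f\,dv$ for all $v_0\in\mathbb{R}^d$, $r\in(0,1)$. Assume there exist $s>1$ and a modulus of continuity $\eta(\cdot)$ such that for any cube $Q$ with side length $r\in(0,1)$, $$|Q|^{\frac1d}\left(⨍_Qh_{f,\gamma}^s\,dv\right)^{\frac1{2s}}\left(⨍_Q(a^*_{f,\gamma})^{-s}\,dv\right)^{\frac1{2s}}\le\eta(r).$$ Then for any $\varepsilon\in(0,1)$ and any Lipschitz $\phi$ with compact support, $$\int_{\mathbb{R}^d}\phi^2h_{f,\gamma}\,dv\le\varepsilon\int_{\mathbb{R}^d}(A_{f,\gamma}\nabla\phi,\nabla\phi)\,dv+C(f_{\mathrm{in}},d,\gamma)\,\tilde\eta(\varepsilon)\int_{\mathbb{R}^d}\phi^2\,dv,$$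 where $\tilde\eta:(0,1)\to\mathbb{R}$ is a decreasing function with $\tilde\eta(0+)=\infty$ determined by $\eta$.
   Context: $\langle v\rangle=(1+|v|^2)^{1/2}$; $⨍_Q=\frac1{|Q|}\int_Q$; $\Pi(z)=\mathbb{I}-\frac{z\otimes z}{|z|^2}$ for $z\neq0$. For $f\ge0$ on $\mathbb{R}^d$, $$A_{f,\gamma}(v)=C(d,\gamma)\int_{\mathbb{R}^d}|v-w|^{2+\gamma}\Pi(v-w)f(w)\,dw,\quad a^*_{f,\gamma}(v)=\inf_{e\in\mathbb{S}^{d-1}}(A_{f,\gamma}(v)e,e),$$ where the constant $C(d,\gamma)$ is such that $a_{f,\gamma}:=\mathrm{tr}(A_{f,\gamma})=(-\Delta)^{-\frac{d+2+\gamma}2}f$, and $h_{f,\gamma}=-\Delta a_{f,\gamma}=(-\Delta)^{-\frac{d+\gamma}{2}}f$, which is $f$ if $\gamma=-d$ and $c(d,\gamma)\,f*|v|^\gamma$ if $\gamma>-d$. The datum satisfies $f_{\mathrm{in}}\ge0$, $\int f_{\mathrm{in}}\,dv=1$, $\int f_{\mathrm{in}}v\,dv=0$, $\int f_{\mathrm{in}}|v|^2dv=d$, and $\int f_{\mathrm{in}}\log f_{\mathrm{in}}\,dv<\infty$. A constant depending on $f_{\mathrm{in}}$ depends on it only through its mass, second moment and entropy. A modulus of continuity is a nondecreasing positive function $\eta$ with $\eta(0+)=0$.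
   Formalization: In (ii), η̃ is determined by η together with the exponent s (for fixed d), not by η alone; a bound uniform in s as s→1 is false, already for γ=−d. *)

(* Defs.v *)
From HB Require Import structures.
From mathcomp Require Import all_boot all_order all_algebra.
From mathcomp Require Import all_classical all_reals all_analysis.

Set Implicit Arguments.
Unset Strict Implicit.
Unset Printing Implicit Defensive.

Import Order.TTheory GRing.Theory Num.Theory numFieldNormedType.Exports.

Local Open Scope classical_set_scope.
Local Open Scope ring_scope.

(* The sigma-algebra on row vectors is generated by the coordinates. *)
Fact measure_rV_display : measure_display.
Proof. exact: default_measure_display. Qed.

Section measurable_rV.
Context (R : realType) (n : nat).

Let coor : 'I_n -> 'rV[R]_n -> measurableTypeR R := fun i v => v ord0 i.

Let rV_set0 : g_sigma_preimage coor set0.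
Proof. exact: sigma_algebra0. Qed.

Let rV_setC A : g_sigma_preimage coor A -> g_sigma_preimage coor (~` A).
Proof. exact: sigma_algebraC. Qed.

Let rV_bigcup (F : (set 'rV[R]_n)^nat) :
  (forall i, g_sigma_preimage coor (F i)) ->
  g_sigma_preimage coor (\bigcup_i F i).
Proof. exact: sigma_algebra_bigcup. Qed.

HB.instance Definition _ := @isMeasurable.Build measure_rV_display
  'rV[R]_n (g_sigma_preimage coor) rV_set0 rV_setC rV_bigcup.

Lemma measurable_coord (i : 'I_n) :
  measurable_fun [set: 'rV[R]_n] (fun v => v ord0 i : R).
Proof.
move=> _ Y mY; rewrite setTI; apply: sub_sigma_algebra => /=.
rewrite -bigcup_seq/=; exists i => /=; first by rewrite mem_index_enum.
by exists Y => //; rewrite setTI.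
Qed.

Lemma measurable_fun_rVP d (T : measurableType d) (f : T -> 'rV[R]_n) :
  measurable_fun [set: T] f <->
  forall i, measurable_fun [set: T] (fun x => f x ord0 i : R).
Proof.
split=> [mf i|mf]; first exact: (measurableT_comp (measurable_coord i) mf).
have E := @g_sigma_preimage_comp _ _ n 'rV[R]_n coor _ f.
move=> _ A mA; rewrite setTI.
suff : g_sigma_preimage (fun i => coor i \o f) `<=` measurable.
  by apply; rewrite E; exists A => //; rewrite setTI.
apply: smallest_sub; first exact: sigma_algebra_measurable.
by rewrite -bigcup_seq; apply: bigcup_sub => i _ B [C mC <-]; exact: mf.
Qed.

End measurable_rV.

Lemma lift0_rshift n (i : 'I_n) : lift ord0 i = rshift 1 i.
Proof. exact: val_inj. Qed.

Section lebesgue_measure_rV.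
Context (R : realType).

Definition rV_cons n (p : measurableTypeR R * 'rV[R]_n) : 'rV[R]_n.+1 :=
  row_mx (const_mx p.1 : 'rV[R]_1) p.2.

Definition rV_uncons n (v : 'rV[R]_n.+1) : measurableTypeR R * 'rV[R]_n :=
  (v ord0 ord0, \row_i v ord0 (lift ord0 i)).

Lemma rV_consK n : cancel (@rV_cons n) (@rV_uncons n).
Proof.
case=> x v; rewrite /rV_uncons /rV_cons /=; congr pair.
  rewrite mxE; case: splitP => //= j; first by rewrite mxE.
by apply/rowP => i; rewrite mxE lift0_rshift (@row_mxEr _ 1 1 n).
Qed.

Lemma rV_unconsK n : cancel (@rV_uncons n) (@rV_cons n).
Proof.
move=> v; apply/rowP => i; rewrite mxE; case: splitP => j ij; rewrite mxE /=.
  by congr (v _ _); apply: val_inj; rewrite /= ij ord1.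
by congr (v _ _); apply: val_inj.
Qed.

Lemma measurable_rV_cons n : measurable_fun setT (@rV_cons n).
Proof.
apply/measurable_fun_rVP => i.
case: (split_ordP (i : 'I_(1 + n))) => j ->.
  rewrite (_ : (fun _ => _) = fst); first exact: measurable_fst.
  by apply/funext => -[x v]; rewrite (@row_mxEl _ 1 1 n) mxE.
rewrite (_ : (fun _ => _) = (fun v : 'rV[R]_n => v ord0 j : measurableTypeR R) \o snd).
  by apply: measurableT_comp; [exact: measurable_coord|exact: measurable_snd].
by apply/funext => -[x v]; rewrite (@row_mxEr _ 1 1 n).
Qed.

Lemma measurable_rV_uncons n : measurable_fun setT (@rV_uncons n).
Proof.
apply/measurable_fun_pairP; split; first exact: measurable_coord.
apply/measurable_fun_rVP => i.
rewrite (_ : (fun _ => _) =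
  fun v : 'rV[R]_n.+1 => v ord0 (lift ord0 i) : measurableTypeR R).
  exact: measurable_coord.
by apply/funext => v; rewrite /= mxE.
Qed.

Section cons.
Local Open Scope ereal_scope.
Context n (mu : {sigma_finite_measure set 'rV[R]_n -> \bar R}).

Definition lebesgue_cons : set 'rV[R]_n.+1 -> \bar R :=
  pushforward (lebesgue_measure \x mu) (@rV_cons n).

Let mcons (A : set 'rV[R]_n.+1) :
  measurable A -> measurable (@rV_cons n @^-1` A).
Proof. by move=> mA; rewrite -[X in measurable X]setTI; exact: measurable_rV_cons. Qed.

Let lebesgue_cons0 : lebesgue_cons set0 = 0.
Proof. by rewrite /lebesgue_cons /pushforward preimage_set0 measure0. Qed.

Let lebesgue_cons_ge0 A : 0 <= lebesgue_cons A.
Proof. exact: (measure_ge0 (lebesgue_measure \x mu)). Qed.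

Let lebesgue_cons_sigma_additive : semi_sigma_additive lebesgue_cons.
Proof.
move=> F mF tF mUF; rewrite /lebesgue_cons /pushforward preimage_bigcup.
apply: measure_semi_sigma_additive => [k||].
- exact: mcons.
- apply/trivIsetP => /= i j _ _ ij; rewrite -preimage_setI.
  by move/trivIsetP : tF => /(_ _ _ _ _ ij) ->//; rewrite preimage_set0.
- by rewrite -preimage_bigcup; exact: mcons.
Qed.

HB.instance Definition _ := isMeasure.Build _ _ _ lebesgue_cons
  lebesgue_cons0 lebesgue_cons_ge0 lebesgue_cons_sigma_additive.

Let lebesgue_cons_sigma_finite : sigma_finite setT lebesgue_cons.
Proof.
have /sigma_finiteP[F [FT ndF Foo]] := sigma_finiteT (@lebesgue_measure R).
have /sigma_finiteP[G [GT ndG Goo]] := sigma_finiteT mu.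
exists (fun k => @rV_uncons n @^-1` (F k `*` G k)) => [|k].
  rewrite -preimage_bigcup -(preimage_setT (@rV_uncons n)); congr preimage.
  rewrite -setXTT FT GT predeqE => -[x y]; split.
    move=> [/= [k _ Fkx] [l _ Gly]]; exists (maxn k l) => //; split.
    - by move: x Fkx; exact/subsetPset/ndF/leq_maxl.
    - by move: y Gly; exact/subsetPset/ndG/leq_maxr.
  by move=> [k _ []/= ? ?]; split; exists k.
have [mF Fk] := Foo k; have [mG Gk] := Goo k; split.
  rewrite -[X in measurable X]setTI; apply: measurable_rV_uncons => //.
  exact: measurableX.
rewrite /lebesgue_cons /pushforward -comp_preimage (_ : _ \o _ = id).
  by rewrite preimage_id product_measure1E// lte_mul_pinfty// ge0_fin_numE.
by apply/funext => p; exact: rV_consK.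
Qed.

HB.instance Definition _ := Measure_isSigmaFinite.Build _ _ _ lebesgue_cons
  lebesgue_cons_sigma_finite.

End cons.

Fixpoint lebesgue_rV n : {sigma_finite_measure set 'rV[R]_n -> \bar R} :=
  if n is n'.+1 return {sigma_finite_measure set 'rV[R]_n -> \bar R}
  then lebesgue_cons (lebesgue_rV n') else \d_(0 : 'rV[R]_0).

Lemma lebesgue_rV_box n (a b : 'I_n -> R) : (forall i, a i <= b i)%R ->
  lebesgue_rV n [set v | forall i, a i <= v ord0 i <= b i]%R =
  (\prod_(i < n) (b i - a i))%:E.
Proof.
elim: n a b => [|n ih] a b ab.
  by rewrite big_ord0 /= diracE mem_set// => -[].
rewrite big_ord_recl EFinM /= /lebesgue_cons /pushforward.
rewrite (_ : _ @^-1` _ = `[a ord0, b ord0]%classic `*`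
    [set v : 'rV[R]_n | forall i,
      a (lift ord0 i) <= v ord0 i <= b (lift ord0 i)]%R); last first.
  apply/seteqP; split => [[x v] /= H|[x v] /= [H1 H2] i].
    split=> [|i].
      by have := H ord0; rewrite /rV_cons mxE; case: splitP => // j _; rewrite mxE in_itv.
    by have := H (lift ord0 i); rewrite lift0_rshift (@row_mxEr _ 1 1 n).
  rewrite mxE; case: splitP => j ij; rewrite ?mxE.
    by rewrite (_ : i = ord0)//; apply: val_inj; rewrite /= ij ord1.
  by rewrite (_ : i = lift ord0 j)//; apply: val_inj.
rewrite product_measure1E//; last first.
  rewrite (_ : [set _ | _] = \bigcap_(i in [set: 'I_n])
    ((fun v : 'rV[R]_n => v ord0 i) @^-1` `[a (lift ord0 i), b (lift ord0 i)])%classic).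
    apply: fin_bigcap_measurable => [|i _]; first exact: finite_finset.
    rewrite -[X in measurable X]setTI.
    exact: measurable_coord.
  by apply/seteqP; split => [v /= H i _ |v /= H i]; [rewrite /= in_itv; exact: H|
    have := H i Logic.I; rewrite /= in_itv].
rewrite ih//; congr mule.
rewrite [LHS](_ : _ = lebesgue_measure `[a ord0, b ord0]%classic)//.
rewrite lebesgue_measure_itv /= lte_fin; case: ltP => // ba.
by rewrite (_ : a ord0 = b ord0) ?subrr//; apply/eqP; rewrite eq_le ba ab.
Qed.

End lebesgue_measure_rV.

Section landau.
Context {R : realType} {d : nat}.
Implicit Types (v w z e : 'rV[R]_d) (f phi : 'rV[R]_d -> R) (gamma r : R).

(* The library norm on row vectors is the sup norm. *)
Definition edot v w : R := \sum_(i < d) v ord0 i * w ord0 i.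
Definition enorm v : R := Num.sqrt (edot v v).
Definition eball v r : set 'rV[R]_d := [set w | enorm (w - v) < r].
Definition bracket v : R := Num.sqrt (1 + enorm v ^+ 2).

Definition cube v r : set 'rV[R]_d :=
  [set w | forall i, v ord0 i <= w ord0 i <= v ord0 i + r].

Definition average (Q : set 'rV[R]_d) (g : 'rV[R]_d -> \bar R) : \bar R :=
  ((lebesgue_rV R d Q)^-1 * \int[lebesgue_rV R d]_(v in Q) g v)%E.

Definition grad phi v : 'rV[R]_d := \row_i 'D_(delta_mx ord0 i) phi v.

Definition qform (A : 'M[R]_d) e : R := (e *m A *m e^T) ord0 ord0.

(* The value at the origin is irrelevant: it only enters through integrals. *)
Definition Pi z : 'M[R]_d := 1%:M - (enorm z ^+ 2)^-1 *: (z^T *m z).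

(* k stands for C(d, gamma). The entries are finite for almost every v when f
   has finite mass and second moment; elsewhere the real-valued integral takes
   a junk value, on a null set. *)
Definition diffusion (k gamma : R) f v : 'M[R]_d :=
  \matrix_(i, j) (k * \int[lebesgue_rV R d]_w
    (enorm (v - w) `^ (2 + gamma) * Pi (v - w) i j * f w)).

Definition astar (k gamma : R) f v : R :=
  inf [set qform (diffusion k gamma f v) e | e in [set e | enorm e = 1]].

(* k stands for c(d, gamma). *)
Definition reaction (k gamma : R) f v : \bar R :=
  if gamma == - d%:R then (f v)%:E
  else (k%:E * \int[lebesgue_rV R d]_w (enorm (v - w) `^ gamma * f w)%:E)%E.

Definition density f := measurable_fun [set: 'rV[R]_d] f /\ forall v, 0 <= f v.

Definition mass f : \bar R := (\int[lebesgue_rV R d]_v (f v)%:E)%E.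

Definition second_moment f : \bar R :=
  (\int[lebesgue_rV R d]_v (f v * enorm v ^+ 2)%:E)%E.

Definition entropy f : \bar R :=
  (\int[lebesgue_rV R d]_v (f v * ln (f v))%:E)%E.

Definition normalized_datum f :=
  [/\ density f,
      mass f = 1%E,
      forall i, (\int[lebesgue_rV R d]_v (f v * v ord0 i)%:E = 0)%E,
      second_moment f = d%:R%:E &
      (entropy f < +oo)%E].

Definition same_moments f g :=
  [/\ mass f = mass g, second_moment f = second_moment g &
      entropy f = entropy g].

Definition test_function phi :=
  lipschitz phi /\ compact (closure [set v | phi v != 0]).

Definition locally_doubling f (CD : R) :=
  forall v r, 0 < r < 1 ->
  (\int[lebesgue_rV R d]_(w in eball v (2 * r)) (f w)%:E <=
   CD%:E * \int[lebesgue_rV R d]_(w in eball v r) (f w)%:E)%E.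

(* (a* )^(-s) is written as (1 / a* )^s in the extended reals, so that it is
   +oo where a* vanishes. *)
Definition local_A2_smallness (kA kh gamma s : R) (eta : R -> R) f :=
  forall v r, 0 < r < 1 ->
  let Q := cube v r in
  ((lebesgue_rV R d Q) `^ d%:R^-1
   * (average Q (fun w => reaction kh gamma f w `^ s)) `^ (2 * s)^-1
   * (average Q (fun w => ((astar kA gamma f w)%:E^-1) `^ s)) `^ (2 * s)^-1
   <= (eta r)%:E)%E.

Definition int_reaction (kh gamma : R) f phi : \bar R :=
  (\int[lebesgue_rV R d]_v ((phi v ^+ 2)%:E * reaction kh gamma f v))%E.

Definition int_diffusion (kA gamma : R) f phi : \bar R :=
  (\int[lebesgue_rV R d]_v (qform (diffusion kA gamma f v) (grad phi v))%:E)%E.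

End landau.

Section normalisation.
Context {R : realType}.

Definition Gamma (x : R) : R :=
  \int[lebesgue_measure]_(t in `]0, +oo[) (t `^ (x - 1) * expR (- t)).

(* For 0 < alpha < d, (-Laplacian)^(-alpha / 2) is the convolution with
   riesz_constant d alpha * |v|^(alpha - d). *)
Definition riesz_constant (d : nat) (alpha : R) : R :=
  Gamma ((d%:R - alpha) / 2) /
  (pi `^ (d%:R / 2) * 2 `^ alpha * Gamma (alpha / 2)).

Definition riesz_potential (d : nat) (alpha : R) (f : 'rV[R]_d -> R)
    (v : 'rV[R]_d) : \bar R :=
  ((riesz_constant d alpha)%:E *
   \int[lebesgue_rV R d]_w (enorm (v - w) `^ (alpha - d%:R) * f w)%:E)%E.

(* tr A = (-Laplacian)^(-(d + 2 + gamma) / 2) f determines C(d, gamma) when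
   gamma < -2. When gamma >= -2 the kernel of this operator is not a positive
   multiple of |v|^(2 + gamma), and C(d, gamma) is any positive constant. *)
Definition diffusion_constant (C : nat -> R -> R) :=
  forall (d : nat) (gamma : R), (3 <= d)%N -> - d%:R <= gamma <= 0 ->
  0 < C d gamma /\
  (gamma < - 2 -> forall f : 'rV[R]_d -> R, density f ->
    (mass f < +oo)%E ->
    {ae lebesgue_rV R d, forall v,
      (\tr (diffusion (C d gamma) gamma f v))%:E =
      riesz_potential (d%:R + 2 + gamma) f v}).

(* As above, (-Laplacian)^(-(d + gamma) / 2) f determines c(d, gamma) when
   -d < gamma < 0, whereas its kernel is not a power for gamma = 0. *)
Definition reaction_constant (c : nat -> R -> R) :=
  forall (d : nat) (gamma : R), (3 <= d)%N -> - d%:R < gamma <= 0 ->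
  0 < c d gamma /\ (gamma < 0 -> c d gamma = riesz_constant d (d%:R + gamma)).

Definition modulus (eta : R -> R) :=
  [/\ forall r, 0 < r -> 0 < eta r,
      forall r t, 0 < r -> r <= t -> eta r <= eta t &
      eta r @[r --> 0^'+] --> 0].

End normalisation.

(* Main.v *)
(* Both estimates follow from one weighted Poincare inequality on dyadic cubes:
   if [l (avg h^s)^(1/2s) (avg a^-s)^(1/2s) <= eta] on every subcube of a cube
   [Q], then [int_Q |phi - phi_Q|^2 h <= C eta^2 int_Q a |grad phi|^2]. It is
   proved by telescoping the averages of [phi] along the dyadic tree (each jump
   is controlled by the L^1 norm of the gradient on the parent cube), which
   leaves a bilinear sum over the tree that is summed with Doob's maximal
   inequality. Applying it with [h] the reaction coefficient on cubes of a side
   [r] such that [eta(r)^2] is of the order of [eps], and covering the space by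
   such cubes, gives the gradient term; the averages of [h] on these cubes are
   bounded by integrating the Riesz kernel, which gives the zeroth order term.

   For [gamma <= -2] the weight is [a*]. For [-2 < gamma < 0] the finite entropy
   and second moment prevent [f] from concentrating on a slab, so that
   [A >= a0 <v>^gamma], and the smallness hypothesis holds with [s = -2/gamma]
   and [eta(r) = C r^(1 + gamma/2)], because [h^s <= C J] and
   [<v>^2 (f * |v|^-2) <= 2 (<w>^2 f) * |v|^-2 + 2], where
   [J = f * |v|^-2 + <v>^-2]. *)
Require Import Defs.
From HB Require Import structures.
From mathcomp Require Import all_boot all_order all_algebra.
From mathcomp Require Import all_classical all_reals all_analysis.
From mathcomp Require Import measurable_realfun ring lra.
Set Implicit Arguments.
Unset Strict Implicit.
Unset Printing Implicit Defensive.
Import Order.TTheory GRing.Theory Num.Theory numFieldNormedType.Exports.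
Local Open Scope classical_set_scope.
Local Open Scope ring_scope.

(** * Bilinear sums over trees *)

(** The smallness hypothesis gives the same [eta] at every scale of the tree, so the terms side
    times average of [|grad phi|] times average of [k] do not visibly decay along a branch. Only the
    side decays. As long as the average of [k] stays within a factor 2 of its value at the last
    stopping node, the sides sum as a geometric series; each further doubling starts a new series,
    charged through the hypothesis to running maxima of two martingales. Doob's inequality needs an
    exponent above 1, and this exponent is [2 - s^-1], whence [s > 1].

    The weight is [k = |phi - phi_Q| * h], so the quantity to be bounded reappears on the right. It
    is absorbed there, which is legitimate because it is finite: [phi] is Lipschitz and [h^s] is
    integrable on the cube.

    For [-2 < gamma < 0] the exponent [s = -2/gamma] is dictated by homogeneity: it turns
    [|v|^gamma] into [|v|^-2], which is locally integrable for [d >= 3], and [<v>^gamma] to the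
    power [-s] into [<v>^2], exactly the growth that the second moment of [f] compensates. The
    brackets then cancel in the product of the two averages, and the smallness is uniform in the
    position of the cube. *)

Section tree.
Context {R : realType} {T : Type} {I : finType}.
Variables (child : T -> I -> T) (P : T -> Prop).
Hypothesis I0 : (0 < #|I|)%N.
Hypothesis Pchild : forall t i, P t -> P (child t i).
Implicit Types (F G X D u : T -> R) (t : T) (N : nat).

Definition child_avg F t : R := #|I|%:R^-1 * \sum_i F (child t i).

Fixpoint avgN N F t : R :=
  if N is N'.+1 then child_avg (avgN N' F) t else F t.

(** Generations are averaged, not summed: for [F t = c t * cavg k t] this is the average over the
    root cube of [k] times the sum of [c] along the branch of the point. *)
Fixpoint treesum N F t : R :=
  if N is N'.+1 then F t + child_avg (treesum N' F) t else 0.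

(* The average over the descendants of generation [N] of the [q]-th power of
   the running maximum of [m] and of the values of [X] strictly below [t]. *)
Fixpoint maxN (q : R) N X (m : R) t : R :=
  if N is N'.+1
  then child_avg (fun t' => maxN q N' X (Num.max m (X t')) t') t
  else m `^ q.

(** Restricted to [P] because cube averages are used only where the function is known to be
    integrable, that is inside the starting cube. *)
Definition martingale X := forall t, P t -> child_avg X t = X t.

Lemma ler_child_avg F G t :
  (forall i, F (child t i) <= G (child t i)) -> child_avg F t <= child_avg G t.
Proof. by move=> FG; rewrite ler_wpM2l ?invr_ge0 ?ler0n// ler_sum. Qed.

Lemma child_avg_cst (c : R) t : child_avg (fun=> c) t = c.
Proof.
by rewrite /child_avg sumr_const -[c *+ _]mulr_natl mulKf// pnatr_eq0 -lt0n.
Qed.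

Lemma child_avgD F G t :
  child_avg (fun t' => F t' + G t') t = child_avg F t + child_avg G t.
Proof. by rewrite /child_avg big_split/= mulrDr. Qed.

Lemma child_avgZ (a : R) F t :
  child_avg (fun t' => a * F t') t = a * child_avg F t.
Proof. by rewrite /child_avg -mulr_sumr mulrCA. Qed.

Lemma avgNZ N (a : R) F t : avgN N (fun t' => a * F t') t = a * avgN N F t.
Proof.
elim: N t => //= N ih t; rewrite -child_avgZ.
by rewrite /child_avg; congr (_ * _); apply: eq_bigr => i _.
Qed.

Lemma ler_avgN N F G t : P t -> (forall t, P t -> F t <= G t) ->
  avgN N F t <= avgN N G t.
Proof.
elim: N t => [|N ih] t Pt FG /=; first exact: FG.
by apply: ler_child_avg => i; apply: ih => //; exact: Pchild.
Qed.

Lemma avgN_martingale N X t : martingale X -> P t -> avgN N X t = X t.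
Proof.
move=> mX; elim: N t => //= N ih t Pt; rewrite -[RHS]mX//.
by rewrite /child_avg; congr (_ * _); apply: eq_bigr => i _; rewrite ih//; exact: Pchild.
Qed.

End tree.

Section powR_young.
Context {R : realType}.
Implicit Types (q m x : R).

(** The convex function [x^q] lies above its tangent at [m]. *)
Lemma young_powR q m x : 1 < q -> 0 <= m -> 0 <= x ->
  q * (m `^ (q - 1) * x) <= x `^ q + (q - 1) * m `^ q.
Proof.
move=> q1 m0 x0.
have q0 : 0 < q by lra.
have p0 : 0 < q / (q - 1) by rewrite divr_gt0//; lra.
have := @conjugate_powR R x (m `^ (q - 1)) q (q / (q - 1)) x0 (powR_ge0 _ _) q0 p0.
have -> : q^-1 + (q / (q - 1))^-1 = 1 by field; apply/andP; split; apply/eqP; lra.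
move=> /(_ erefl); rewrite -powRrM.
have -> : (q - 1) * (q / (q - 1)) = q by field; apply/eqP; lra.
move=> H; rewrite mulrC [m `^ _ * _]mulrC.
have := ler_wpM2r (ltW q0) H; congr (_ <= _); field.
by apply/andP; split; apply/eqP; lra.
Qed.

End powR_young.

(** * Doob's maximal inequality on trees *)

Section doob.
Context {R : realType} {T : Type} {I : finType}.
Variables (child : T -> I -> T) (P : T -> Prop).
Hypothesis I0 : (0 < #|I|)%N.
Hypothesis Pchild : forall t i, P t -> P (child t i).
Variable q : R.
Hypothesis q1 : 1 < q.
Variable X : T -> R.
Hypothesis X0 : forall t, P t -> 0 <= X t.
Hypothesis mX : martingale child P X.

Definition doob_cst : R := 2 * (2 `^ (q - 1) / (q - 1)).

Lemma doob_cst_ge0 : 0 <= doob_cst.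
Proof. by rewrite /doob_cst mulr_ge0// divr_ge0 ?powR_ge0// subr_ge0 ltW. Qed.

(* Burkholder's function: linear in [x] for fixed [m], and decreasing along
   the jumps of the running maximum by Young's inequality. *)
Let U (x m : R) : R := m `^ q - q / (q - 1) * (m `^ (q - 1) * x).

(** Young's inequality at [2 * x] bounds the mixed term of [2 * U x m] by [m^q], half of the leading
    term, plus [doob_cst * x^q]; this is the origin of [doob_cst]. *)
Let U_lower x m : 0 <= x -> 0 <= m -> m `^ q <= doob_cst * x `^ q + 2 * U x m.
Proof.
move=> x0 m0; have q1' := q1.
have /(young_powR q1 m0) : 0 <= 2 * x by rewrite mulr_ge0.
rewrite powRM// -(mulr_powRB1 (_ : 0 <= 2) (lt_trans ltr01 q1))// => H.
rewrite /doob_cst /U.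
have q0 : 0 < q - 1 by lra.
have Q0 : 0 <= (q - 1)^-1 by rewrite invr_ge0 ltW.
have := ler_wpM2l Q0 H.
set a := m `^ (q - 1) * x; set b := m `^ q; set z := x `^ q; set w := 2 `^ (q - 1).
have e1 : (q - 1)^-1 * (2 * w * z + (q - 1) * b) = 2 * (w / (q - 1)) * z + b.
  by field; apply/eqP; lra.
have e2 : (q - 1)^-1 * (q * (m `^ (q - 1) * (2 * x))) = 2 * (q / (q - 1) * a) by rewrite /a; field; apply/eqP; lra.
by rewrite e1 e2; lra.
Qed.

Let U_jump x m : 0 <= x -> 0 <= m ->
  U x (Num.max m x) <= m `^ q - q / (q - 1) * (m `^ (q - 1) * x).
Proof.
move=> x0 m0; have q1' := q1; case: (leP m x) => // mx; rewrite /U.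
have e : x `^ (q - 1) * x = x `^ q.
  by rewrite mulrC mulr_powRB1//; lra.
rewrite e.
have q0 : 0 < q - 1 by lra.
have Q0 : 0 <= (q - 1)^-1 by rewrite invr_ge0 ltW.
have := ler_wpM2l Q0 (young_powR q1 m0 x0).
set a := m `^ (q - 1) * x; set b := m `^ q; set z := x `^ q.
have -> : (q - 1)^-1 * (q * a) = q / (q - 1) * a by ring.
have -> : (q - 1)^-1 * (z + (q - 1) * b) = z / (q - 1) + b by field; apply/eqP; lra.
have -> : q / (q - 1) * z = z + z / (q - 1) by field; apply/eqP; lra.
lra.
Qed.

Let doob_aux N t m : P t -> 0 <= m -> X t <= m ->
  maxN child q N X m t <= doob_cst * avgN child N (fun t => X t `^ q) t + 2 * U (X t) m.
Proof.
elim: N t m => [|N ih] t m Pt m0 Xm /=; first exact: U_lower (X0 Pt) m0.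
pose c : R := m `^ q.
pose k : R := - (q / (q - 1) * m `^ (q - 1)).
rewrite (_ : U (X t) m = child_avg child (fun t' => c + k * X t') t); last first.
  by rewrite child_avgD child_avgZ mX// child_avg_cst// /U /c /k; ring.
rewrite -!child_avgZ -child_avgD; apply: ler_child_avg => i.
have Pi := Pchild i Pt.
apply: (le_trans (ih _ _ Pi _ _)); rewrite ?le_max ?m0 ?lexx ?orbT//.
rewrite lerD2l ler_wpM2l//; apply: (le_trans (U_jump (X0 Pi) m0)).
by rewrite /c /k; lra.
Qed.

Lemma doob N t : P t ->
  maxN child q N X (X t) t <= doob_cst * avgN child N (fun t => X t `^ q) t.
Proof.
move=> Pt; have q1' := q1; apply: (le_trans (doob_aux _ Pt (X0 Pt) (lexx _))).
(* At the root the running maximum is [X t] itself, where [U] equals [(1 - q / (q - 1)) * X t ^ q]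
   and is nonpositive. *)
rewrite gerDl pmulr_rle0//.
have := U_jump (X0 Pt) (X0 Pt); rewrite maxxx => H; rewrite /U.

have e : X t `^ (q - 1) * X t = X t `^ q.
  by rewrite mulrC mulr_powRB1 ?X0//; lra.
rewrite e subr_le0 ler_peMl ?powR_ge0// ler_pdivlMr; lra.
Qed.

End doob.

Section bilinear.
Context {R : realType} {T : Type} {I : finType}.
Variables (child : T -> I -> T) (P : T -> Prop).
Hypothesis I0 : (0 < #|I|)%N.
Hypothesis Pchild : forall t i, P t -> P (child t i).
Variables (q eta : R) (l D u x y : T -> R).
Hypothesis q1 : 1 < q.
Hypothesis eta0 : 0 <= eta.
Hypothesis l0 : forall t, P t -> 0 <= l t.
Hypothesis lhalf : forall t i, P t -> l (child t i) = l t / 2.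
Hypothesis D0 : forall t, P t -> 0 <= D t.
Hypothesis u0 : forall t, P t -> 0 <= u t.
Hypothesis x0 : forall t, P t -> 0 <= x t.
Hypothesis y0 : forall t, P t -> 0 <= y t.
Hypothesis mD : martingale child P D.
Hypothesis mu : martingale child P u.
Hypothesis mx : martingale child P x.
Hypothesis my : martingale child P y.
Hypothesis lDu : forall t, P t -> l t * D t * u t <= eta * (x t `^ q + y t `^ q).

(* [al] is the average of [u] at the last stopping ancestor of [t]. While
   [u <= 2 al] the scales contribute a geometric series; restarting at a node
   with [2 al < u] is paid for by the martingale [u / al]. *)
Let bilinear_aux N t al X Y : P t -> 0 < al -> 0 <= X -> 0 <= Y ->
  u t <= 2 * al -> x t <= X -> y t <= Y ->
  treesum child N (fun t => l t * D t * u t) t <=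
  4 * al * (l t * D t) + eta * (4 * (u t / al) * (X `^ q + Y `^ q) +
    8 * ((maxN child q N x X t + maxN child q N y Y t) - (X `^ q + Y `^ q))).
Proof.
have q1' := q1; elim: N t al X Y => [|N ih] t al X Y Pt al0 X0 Y0 ual xX yY /=.
  rewrite subrr mulr0 addr0 addr_ge0//; first by rewrite !mulr_ge0 ?l0 ?D0// ltW.
  by rewrite !mulr_ge0 ?addr_ge0 ?powR_ge0 ?u0 ?invr_ge0// ltW.
pose S : R := X `^ q + Y `^ q.
have S0 : 0 <= S by rewrite addr_ge0 ?powR_ge0.
pose Mx t' := maxN child q N x (Num.max X (x t')) t'.
pose My t' := maxN child q N y (Num.max Y (y t')) t'.
rewrite -/Mx -/My -/S.
(* [B] is affine in [D] and [u] with coefficients frozen at the parent, so the martingale property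
   evaluates its average over the children. *)
pose B t' := 2 * al * l t * D t' + (eta * 4 * S / al * u t' +
     (eta * 8 * (Mx t' + My t') + eta * 8 * - S)).
have step i : treesum child N (fun t => l t * D t * u t) (child t i) <=
    B (child t i).
  rewrite /B.
  have Pi := Pchild i Pt.
  set X' := Num.max X (x (child t i)); set Y' := Num.max Y (y (child t i)).
  have XX' : X `^ q <= X' `^ q.
    by rewrite ge0_ler_powR ?nnegrE ?le_max ?X0 ?lexx//; lra.
  have YY' : Y `^ q <= Y' `^ q.
    by rewrite ge0_ler_powR ?nnegrE ?le_max ?Y0 ?lexx//; lra.
  have X'0 : 0 <= X' by rewrite le_max X0.
  have Y'0 : 0 <= Y' by rewrite le_max Y0.
  have xX' : x (child t i) <= X' by rewrite le_max lexx orbT.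
  have yY' : y (child t i) <= Y' by rewrite le_max lexx orbT.
  pose S' : R := X' `^ q + Y' `^ q.
  have SS' : S <= S' by rewrite lerD.
  have li := lhalf i Pt.
  have ui := u0 Pi; have Di := D0 Pi; have lt0 := l0 Pt.
  have alV : 0 < al^-1 by rewrite invr_gt0.
  have [uial|alui] := leP (u (child t i)) (2 * al).
    (* No restart: the first term halves with the side, and since [u / al <= 2] the growth from [S]
       to [S'] in the second term is paid for by the third. *)
    apply: (le_trans (ih _ al X' Y' Pi al0 X'0 Y'0 uial xX' yY')).
    rewrite -/S' -/(Mx _) -/(My _) li.
    have : u (child t i) / al <= 2 by rewrite ler_pdivrMr.
    have : 0 <= u (child t i) / al by rewrite divr_ge0// ltW.
    set v := u _ / al => v0 v2.
    have -> : eta * 4 * S / al * u (child t i) = eta * (4 * v * S) by rewrite /v; ring.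
    have -> : 4 * al * (l t / 2 * D (child t i)) = 2 * al * l t * D (child t i) by field.
    rewrite lerD2l; set M := Mx _ + My _.
    have -> : eta * (4 * v * S) + (eta * 8 * M + eta * 8 * - S) =
      eta * (4 * v * S + 8 * (M - S)) by ring.
    rewrite ler_wpM2l//.
    have : v * (S' - S) <= 2 * (S' - S) by rewrite ler_wpM2r// subr_ge0.
    by lra.
  (* Restart with [al] the value of [u] at the child. By [lDu] the first term is at most
     [4 * eta * S']; with the [4 * S'] of the second term it cancels [-8 * S']. The remaining
     [-8 * S] on the right is covered because [u / al > 2]. *)
  have ui0 : 0 < u (child t i) by lra.
  have := ih _ (u (child t i)) X' Y' Pi ui0 X'0 Y'0 _ xX' yY'.
  move=> /(_ ltac:(lra)) H; apply: (le_trans H).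
  rewrite -/S' -/(Mx _) -/(My _) divff ?gt_eqF//.
  have h1 : 4 * u (child t i) * (l (child t i) * D (child t i)) <= eta * (4 * S').
    have := lDu Pi.
    have : x (child t i) `^ q <= X' `^ q by rewrite ge0_ler_powR ?nnegrE ?x0//; lra.
    have : y (child t i) `^ q <= Y' `^ q by rewrite ge0_ler_powR ?nnegrE ?y0//; lra.
    move=> hy hx h.
    have : eta * (x (child t i) `^ q + y (child t i) `^ q) <= eta * S'.
      by rewrite ler_wpM2l// lerD.
    by lra.
  have h2 : 0 <= 2 * al * l t * D (child t i) by rewrite !mulr_ge0// ltW.
  have h3 : 2 <= u (child t i) / al by rewrite ler_pdivlMr// ltW.
  have h4 : eta * (8 * S) <= eta * 4 * S / al * u (child t i).
    have -> : eta * 4 * S / al * u (child t i) = eta * (4 * S * (u (child t i) / al)) by ring.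
    rewrite ler_wpM2l//.
    have : S * 2 <= S * (u (child t i) / al) by rewrite ler_wpM2l.
    by lra.
  by lra.
have H := ler_child_avg step.
rewrite /B !child_avgD !child_avgZ !child_avgD mD// mu// child_avg_cst// in H.
(* The node itself costs [2 * al * (l t * D t)] and the children contribute as much again on
   average, which closes the factor 4. *)
have h1 : l t * D t * u t <= 2 * al * (l t * D t).
  by rewrite mulrC ler_wpM2r// mulr_ge0 ?l0 ?D0.
apply: le_trans (lerD h1 H) _.
have -> : eta * (4 * (u t / al) * S + 8 *
  (child_avg child Mx t + child_avg child My t - S)) =
  eta * 4 * S / al * u t + (eta * 8 * (child_avg child Mx t + child_avg child My t) +
   eta * 8 * - S) by ring.
by rewrite addrA lerD2r; lra.
Qed.

(** The root serves as the first stopping node, [al = u t]. There [lDu] turns the first term into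
    [4 * eta * S], all multiples of [S] cancel, and Doob's inequality bounds the two maximal
    terms. *)
Lemma treesum_bilinear N t : P t ->
  treesum child N (fun t => l t * D t * u t) t <=
  8 * doob_cst q * eta * (avgN child N (fun t => x t `^ q) t +
                          avgN child N (fun t => y t `^ q) t).
Proof.
move=> Pt.
have dx := doob I0 Pchild q1 x0 mx N Pt.
have dy := doob I0 Pchild q1 y0 my N Pt.
suff H : treesum child N (fun t => l t * D t * u t) t <=
    eta * (8 * (maxN child q N x (x t) t + maxN child q N y (y t) t)).
  apply: (le_trans H); have := ler_wpM2l eta0 (lerD dx dy).
  by lra.
have S0 : 0 <= x t `^ q + y t `^ q by rewrite addr_ge0 ?powR_ge0.
have [ut|] := ltP 0 (u t).
  have := @bilinear_aux N t (u t) (x t) (y t) Pt ut (x0 Pt) (y0 Pt) _ (lexx _) (lexx _).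
  move=> /(_ ltac:(lra)) H; apply: (le_trans H).
  rewrite divff ?gt_eqF//; have := lDu Pt.
  by lra.
move=> ut; have {}ut : u t = 0 by apply/eqP; rewrite eq_le ut u0.
apply/ler_addgt0Pr => e e0.
have lD0 : 0 <= l t * D t by rewrite mulr_ge0 ?l0 ?D0.
(* Since [u t = 0] is not an admissible stopping value, a small positive one is used, whose first
   term costs at most [e]. *)
pose al := e / (4 * (l t * D t + 1)).
have al0 : 0 < al by rewrite divr_gt0// mulr_gt0//; lra.
have := @bilinear_aux N t al (x t) (y t) Pt al0 (x0 Pt) (y0 Pt) _ (lexx _) (lexx _).
rewrite ut => /(_ ltac:(lra)) H; apply: (le_trans H).
have : 4 * al * (l t * D t) <= e.
  rewrite /al (_ : 4 * _ * _ = e * (l t * D t / (l t * D t + 1))); last by field; apply/eqP; lra.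
  rewrite -{2}[e]mulr1 ler_wpM2l ?(ltW e0)// ler_pdivrMr; lra.
have := mulr_ge0 eta0 S0.
by rewrite mul0r mulr0 mul0r; lra.
Qed.

End bilinear.

(** * Lebesgue integration of row vectors *)

Section rV_measurability.
Context {R : realType}.
Local Notation rV n := 'rV[R]_n.

Lemma measurable_sqrt : measurable_fun [set: R] (@Num.sqrt R).
Proof. by apply: continuous_measurable_fun => x; exact: sqrt_continuous. Qed.

Lemma measurable_coord_comp d (T : measurableType d) n (f : T -> rV n) i :
  measurable_fun setT f -> measurable_fun setT (fun x => f x ord0 i : R).
Proof. by move=> mf; exact: (measurableT_comp (measurable_coord i) mf). Qed.

Lemma measurable_rVD d (T : measurableType d) n (f g : T -> rV n) :
  measurable_fun setT f -> measurable_fun setT g ->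
  measurable_fun setT (fun x => f x + g x).
Proof.
move=> mf mg; apply/measurable_fun_rVP => i.
under eq_fun do rewrite mxE.
by apply: measurable_funD; exact: measurable_coord_comp.
Qed.

Lemma measurable_rVZ d (T : measurableType d) n (k : T -> R) (f : T -> rV n) :
  measurable_fun setT k -> measurable_fun setT f ->
  measurable_fun setT (fun x => k x *: f x).
Proof.
move=> mk mf; apply/measurable_fun_rVP => i.
under eq_fun do rewrite mxE.
by apply: measurable_funM => //; exact: measurable_coord_comp.
Qed.

Lemma measurable_rVB d (T : measurableType d) n (f g : T -> rV n) :
  measurable_fun setT f -> measurable_fun setT g ->
  measurable_fun setT (fun x => f x - g x).
Proof.
move=> mf mg; apply/measurable_fun_rVP => i.
under eq_fun do rewrite !mxE.
by apply: measurable_funB; exact: measurable_coord_comp.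
Qed.

Lemma measurable_edot d (T : measurableType d) n (f g : T -> rV n) :
  measurable_fun setT f -> measurable_fun setT g ->
  measurable_fun setT (fun x => edot (f x) (g x)).
Proof.
move=> mf mg; apply: measurable_sum => i.
by apply: measurable_funM; exact: measurable_coord_comp.
Qed.

Lemma measurable_enorm d (T : measurableType d) n (f : T -> rV n) :
  measurable_fun setT f -> measurable_fun setT (fun x => enorm (f x)).
Proof.
by move=> mf; apply: (measurableT_comp measurable_sqrt); exact: measurable_edot.
Qed.

End rV_measurability.

Section rV_integral.
Context {R : realType}.
Local Open Scope ereal_scope.
Local Notation mu n := (lebesgue_rV R n).

Lemma lebesgue_measure_shift (a : R) (A : set (measurableTypeR R)) :
  measurable A ->
  lebesgue_measure ((fun x => x + a)%R @^-1` A) = lebesgue_measure A :> \bar R.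
Proof.
move=> mA.
have mf : measurable_fun setT (fun x : measurableTypeR R => (x + a)%R : measurableTypeR R).
  exact: measurable_funD.
pose mixin := isMeasurableFun.Build _ _ _ _ _ mf.
pose f : {mfun measurableTypeR R >-> measurableTypeR R} := HB.pack (fun x : measurableTypeR R => (x + a)%R : measurableTypeR R) mixin.
apply/esym; rewrite -[RHS]/(pushforward lebesgue_measure f A).
apply: lebesgue_measure_unique => // _ [[b c]] _ <- /=.
rewrite /pushforward (_ : f @^-1` _ = `]b - a, c - a]%classic)%R.
  rewrite !lebesgue_measure_itv/= !lte_fin ltrD2r; case: ifPn => // _.
  by congr EFin; ring.
by apply/seteqP; split=> x /=; rewrite !in_itv/= ltrBlDr lerBrDr.
Qed.

Lemma ge0_integral_shift1 (a : R) (f : measurableTypeR R -> \bar R) :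
  measurable_fun setT f -> (forall x, 0 <= f x) ->
  \int[lebesgue_measure]_x f (x + a)%R = \int[lebesgue_measure]_x f x.
Proof.
move=> mf f0.
have mg : measurable_fun setT (fun x : measurableTypeR R => (x + a)%R : measurableTypeR R).
  exact: measurable_funD.
have := @ge0_integral_pushforward _ _ _ _ _ _ mg lebesgue_measure setT f measurableT mf.
move=> /(_ (fun y _ => f0 y)); rewrite preimage_setT => <-.
by apply: eq_measure_integral => A mA _; rewrite -[RHS](lebesgue_measure_shift a).
Qed.

Lemma rV_cons_ord0 n (p : measurableTypeR R * 'rV[R]_n) :
  rV_cons p ord0 ord0 = p.1.
Proof. by rewrite mxE; case: splitP => // j _; rewrite mxE. Qed.

Lemma rV_cons_lift n (p : measurableTypeR R * 'rV[R]_n) i :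
  rV_cons p ord0 (lift ord0 i) = p.2 ord0 i.
Proof. by rewrite lift0_rshift (@row_mxEr _ 1 1 n). Qed.

(** The measure in dimension [n.+1] is by construction the image of a product measure under
    [rV_cons], so this is Tonelli's theorem; it drives the inductions on the dimension. *)
Lemma ge0_integral_rV_cons n (f : 'rV[R]_n.+1 -> \bar R) :
  measurable_fun setT f -> (forall v, 0 <= f v) ->
  \int[mu n.+1]_v f v =
  \int[lebesgue_measure]_x \int[mu n]_v f (rV_cons (x, v)).
Proof.
move=> mf f0.
have /= := @ge0_integral_pushforward _ _ _ _ _ _ (@measurable_rV_cons R n)
  (lebesgue_measure \x mu n) setT f measurableT mf (fun y _ => f0 y).
rewrite preimage_setT fubini_tonelli1//=.
exact: measurableT_comp mf (@measurable_rV_cons R n).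
Qed.

Lemma integral_rV0 (f : 'rV[R]_0 -> \bar R) : measurable_fun setT f ->
  \int[mu 0]_v f v = f 0%R.
Proof. by move=> mf; rewrite integral_dirac// diracT mul1e. Qed.

(* Keeps unification from unfolding the product structure of the measure. *)
#[local] Opaque lebesgue_rV.

Lemma ge0_integral_rV_shift n (a : 'rV[R]_n) (f : 'rV[R]_n -> \bar R) :
  measurable_fun setT f -> (forall v, 0 <= f v) ->
  \int[mu n]_v f (v + a)%R = \int[mu n]_v f v.
Proof.
elim: n a f => [|n ih] a f mf f0.
  by apply: eq_integral => v _; congr f; apply/rowP => -[].
have ma m (b : 'rV[R]_m) : measurable_fun setT (fun v : 'rV[R]_m => v + b)%R.
  exact: measurable_rVD.
rewrite (ge0_integral_rV_cons (measurableT_comp mf (ma _ a)) (fun v => f0 _)).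
rewrite [RHS](ge0_integral_rV_cons mf f0).
have mfc : measurable_fun setT (f \o @rV_cons R n).
  exact: measurableT_comp mf (@measurable_rV_cons R n).
rewrite -[RHS](ge0_integral_shift1 (a ord0 ord0)); last 2 first.
exact: (measurable_fun_fubini_tonelli_F (m2 := mu n) _ mfc (fun=> f0 _)).
  by move=> x; apply: integral_ge0.
apply: eq_integral => x _.
rewrite -[RHS](ih (\row_i a ord0 (lift ord0 i))%R)//; last first.
  exact: (measurableT_comp mfc (pair1_measurable _)).
apply: eq_integral => v _; congr f; apply/rowP => i.
rewrite mxE; case: (unliftP ord0 i) => [j|] ->.
  by rewrite !rV_cons_lift !mxE.
by rewrite !rV_cons_ord0.
Qed.

(** Gives both the volume of half-open cubes and the value of the Gaussian integral. *)
Lemma ge0_integral_rV_prod n (g : 'I_n -> R -> R) (c : 'I_n -> R) :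
  (forall i, measurable_fun setT (g i)) -> (forall i x, (0 <= g i x)%R) ->
  (forall i, \int[lebesgue_measure]_x (g i x)%:E = (c i)%:E) ->
  \int[mu n]_v (\prod_(i < n) g i (v ord0 i))%:E = (\prod_(i < n) c i)%:E.
Proof.
have mp m (h : 'I_m -> R -> R) : (forall i, measurable_fun setT (h i)) ->
    measurable_fun setT (fun v : 'rV[R]_m => (\prod_(i < m) h i (v ord0 i))%:E).
  move=> mh; apply/measurable_EFinP; apply: measurable_prod => i _.
  exact: (measurableT_comp (mh i) (measurable_coord i)).
elim: n g c => [|n ih] g c mg g0 gc.
  by rewrite (integral_rV0 (mp _ g mg)) !big_ord0.
rewrite ge0_integral_rV_cons//; [|exact: (mp _ g mg)|by move=> v; rewrite lee_fin prodr_ge0].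
transitivity (\int[lebesgue_measure]_x
    ((g ord0 x)%:E * (\prod_(i < n) c (lift ord0 i))%:E)).
  apply: eq_integral => x _.
  rewrite -(ih (fun i => g (lift ord0 i)) (fun i => c (lift ord0 i)))//.
  rewrite -ge0_integralZl//; last 3 first.
    exact: (mp n (fun i => g (lift ord0 i)) (fun i => mg _)).
    by move=> v _; rewrite lee_fin prodr_ge0.
    by rewrite lee_fin.
  apply: eq_integral => v _; rewrite big_ord_recl /= EFinM rV_cons_ord0.
  by under eq_bigr => i _ do rewrite rV_cons_lift.
rewrite ge0_integralZr//; last 3 first.
  have /measurable_EFinP := mg ord0; exact.
  by move=> x _; rewrite lee_fin.
  rewrite lee_fin prodr_ge0// => i _.
  by rewrite -lee_fin -gc integral_ge0// => x _; rewrite lee_fin.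
by rewrite gc -EFinM big_ord_recl.
Qed.

End rV_integral.

Section rV_norm.
Context {R : realType}.

Lemma rV_norm_le n (x : 'rV[R]_n) (e : R) : 0 <= e ->
  (forall i, `|x ord0 i| <= e) -> `|x| <= e.
Proof.
move=> e0 xe; rewrite (_ : `|x| = mx_norm x)//.
have [->//|/mx_norm_neq0[[i j] /= ->]] := eqVneq (mx_norm x) 0.
by rewrite (ord1 i).
Qed.

Lemma rV_rat_dense n (x : 'rV[R]_n) (e : R) : 0 < e ->
  exists q : 'rV[rat]_n, forall i, `|x ord0 i - ratr (q ord0 i)| < e.
Proof.
move=> e0.
have H i : exists q : rat, `|x ord0 i - ratr q| < e.
  have /rat_in_itvoo[q] : x ord0 i - e < x ord0 i + e by lra.
  rewrite in_itv/= => /andP[q1 q2]; exists q.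
  by rewrite ltr_norml; apply/andP; split; lra.
have [q qP] := choice H.
by exists (\row_i q i) => i; rewrite mxE.
Qed.

Lemma lipschitzP (V W : normedModType R) (phi : V -> W) : lipschitz phi ->
  exists2 L : R, 0 < L & forall x y, `|phi x - phi y| <= L * `|x - y|.
Proof.
(* [lipschitz] asserts the bound for every constant above [M]; the maximum with 1 makes the chosen
   one positive. *)
move=> [M [_ MP]]; exists (Num.max (M + 1) 1).
  by rewrite lt_max ltr01 orbT.
move=> x y; apply: (le_trans (MP (M + 1) _ (x, y) _)) => //=; first by rewrite ltrDl.
by rewrite ler_wpM2r// le_max lexx.
Qed.

(** The sigma-algebra is generated by the coordinates, so measurability is obtained by writing [phi]
    as the infimum of countably many measurable cones [F q], with rational apex [q] and slope [L] in
    the l^1 distance. *)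
Lemma measurable_lipschitz_rV n (phi : 'rV[R]_n -> R) (L : R) : 0 < L ->
  (forall x y, `|phi x - phi y| <= L * `|x - y|) ->
  measurable_fun setT phi.
Proof.
move=> L0 phiL.
pose e (q : 'rV[rat]_n) : 'rV[R]_n := map_mx ratr q.
pose F q (v : 'rV[R]_n) := phi (e q) + L * \sum_(i < n) `|v ord0 i - e q ord0 i|.
have mF q : measurable_fun setT (F q).
  apply: measurable_funD => //; apply: measurable_funM => //.
  apply: measurable_sum => i; apply: (measurableT_comp (@normr_measurable R setT)).
  by apply: measurable_funB => //; exact: measurable_coord.
apply: (measurability _ (RGenInftyO.measurableE R)) => _ [_ [t ->] <-].
rewrite setTI (_ : _ @^-1` _ = \bigcup_q (F q @^-1` `]-oo, t[)).
  apply: countable_bigcupT_measurable => [|q]; first exact: countableP.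
  by rewrite -[X in measurable X]setTI; apply: mF => //; exact: measurable_itv.
apply/seteqP; split => [v|v [q _]] /=; rewrite !in_itv/=.
  (* With coordinates closer than [d], the value at the apex exceeds [phi v] by at most [L * d] and
     the l^1 term is at most [n * L * d]; dividing by [n + 2] keeps the total strictly below [t]. *)
  move=> vt; pose d := (t - phi v) / (L * (n.+1%:R + 1)).
  have n0 : 0 <= n%:R :> R by rewrite ler0n.
  have d0 : 0 < d.
    by rewrite divr_gt0 ?subr_gt0// mulr_gt0// -natr1; lra.
  have [q qP] := rV_rat_dense v d0; exists q => //=.
  rewrite in_itv/= /F.
  have vq i : `|v ord0 i - e q ord0 i| <= d by rewrite mxE ltW.
  have h1 : phi (e q) <= phi v + L * d.
    rewrite -lerBlDl; apply: (le_trans (ler_norm _)).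
    rewrite distrC; apply: (le_trans (phiL _ _)); rewrite ler_wpM2l ?(ltW L0)//.
    by apply: rV_norm_le => [|i]; [exact: ltW|rewrite !mxE ltW].
  have h2 : \sum_(i < n) `|v ord0 i - e q ord0 i| <= n%:R * d.
    apply: (le_trans (ler_sum _ (fun i _ => vq i))).
    by rewrite sumr_const card_ord mulr_natl.
  have h3 : d * (L * (n.+1%:R + 1)) = t - phi v.
    by rewrite divfK// gt_eqF// mulr_gt0// -natr1; lra.
  rewrite -natr1 in h3; have := ler_wpM2l (ltW L0) h2.
  have := mulr_gt0 d0 L0; nra.
move=> h; apply: le_lt_trans h; rewrite -lerBlDl.
apply: (le_trans (ler_norm _)); apply: (le_trans (phiL _ _)).
rewrite ler_wpM2l ?(ltW L0)//; apply: rV_norm_le => [|i].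
  by rewrite sumr_ge0.
by rewrite !mxE (bigD1 i)//= !mxE lerDl sumr_ge0.
Qed.

End rV_norm.

(** * Half-open cubes and their dyadic halves *)

Section hcube.
Context {R : realType} {d : nat}.
Implicit Types (v w : 'rV[R]_d) (r : R).
Local Notation mu := (lebesgue_rV R d).

(** Half-open, unlike [cube], so that the [2^d] halves are disjoint and cover the cube exactly; this
    makes cube averages martingales. *)
Definition hcube v r : set 'rV[R]_d :=
  [set w | forall i, v ord0 i <= w ord0 i < v ord0 i + r].

(* The corner of one of the 2^d cubes obtained by halving the edges. *)
Definition subcorner v r (b : {ffun 'I_d -> bool}) : 'rV[R]_d :=
  v + (r / 2) *: \row_i (b i)%:R.

Let hcube_indic v r w :
  \1_(hcube v r) w =
  \prod_(i < d) \1_(`[v ord0 i, v ord0 i + r[%classic) (w ord0 i) :> R.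
Proof.
have [H|H] := pselect (hcube v r w).
  rewrite indicE mem_set//= big1// => i _; rewrite indicE mem_set//=.
  by rewrite in_itv/=; exact: H.
rewrite indicE memNset//=.
have /existsNP[i Hi] : ~ forall i, v ord0 i <= w ord0 i < v ord0 i + r by [].
by rewrite (bigD1 i)//= indicE memNset ?mul0r//= in_itv/=.
Qed.

Lemma measurable_hcube v r : measurable (hcube v r).
Proof.
apply/(measurable_indicP R); rewrite (_ : \1__ = fun w =>
  \prod_(i < d) \1_(`[v ord0 i, v ord0 i + r[%classic) (w ord0 i) :> R); last first.
  by apply/funext => w; exact: hcube_indic.
apply: measurable_prod => i _.
apply: (measurableT_comp (measurable_indic (measurable_itv _)) (measurable_coord i)).
Qed.

Lemma lebesgue_rV_hcube v r : 0 <= r -> mu (hcube v r) = (r ^+ d)%:E.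
Proof.
move=> r0; have mc := measurable_hcube v r.
transitivity (\int[mu]_w (\1_(hcube v r) w)%:E)%E.
  by rewrite integral_indic ?setIT.
transitivity (\int[mu]_w (\prod_(i < d)
    \1_(`[v ord0 i, v ord0 i + r[%classic) (w ord0 i))%:E)%E.
  by apply: eq_integral => w _; rewrite hcube_indic.
rewrite (ge0_integral_rV_prod
   (g := fun i x => \1_(`[v ord0 i, v ord0 i + r[%classic) x) (c := fun=> r)).
- by rewrite prodr_const card_ord.
- by move=> i; exact: measurable_indic.
- by move=> i x; rewrite indicE.
- move=> i; rewrite integral_indic//= setIT.
  have := lebesgue_measure_itv `[v ord0 i, v ord0 i + r[ => /=.
  move=> ->; rewrite lte_fin ltrDl; case: ltP => [_|r0'].
    by rewrite EFinD addrAC subee// add0e.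
  by congr EFin; apply/eqP; rewrite eq_le r0 r0'.
Qed.

Lemma hcube_subset_cube v r : hcube v r `<=` cube v r.
Proof. by move=> w H i; have /andP[-> /ltW ->] := H i. Qed.

Lemma lebesgue_rV_cube v r : 0 <= r -> mu (cube v r) = (r ^+ d)%:E.
Proof.
move=> r0; have := @lebesgue_rV_box R d (fun i => v ord0 i) (fun i => v ord0 i + r).
move=> ->; last by move=> i; rewrite lerDl.
under eq_bigr do rewrite addrAC subrr add0r.
by rewrite prodr_const card_ord.
Qed.

Lemma subcorner_itv v r b i : 0 <= r ->
  v ord0 i <= subcorner v r b ord0 i <= v ord0 i + r / 2.
Proof. by move=> r0; rewrite !mxE; case: (b i) => /=; apply/andP; split; lra. Qed.

Lemma subhcube v r b : 0 <= r ->
  hcube (subcorner v r b) (r / 2) `<=` hcube v r.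
Proof.
move=> r0 w H i; have /andP[h1 h2] := H i.
by have /andP[h3 h4] := subcorner_itv v b i r0; apply/andP; split; lra.
Qed.

Lemma hcube_bigcup v r : 0 <= r ->
  hcube v r = \big[setU/set0]_(b : {ffun 'I_d -> bool}) hcube (subcorner v r b) (r / 2).
Proof.
move=> r0; apply/seteqP; split => [w H|w].
  pose b : {ffun 'I_d -> bool} := [ffun i => v ord0 i + r / 2 <= w ord0 i].
  rewrite -bigcup_seq /=; exists b => /=; first by rewrite mem_index_enum.
  move=> i; have /andP[? ?] := H i; rewrite !mxE ffunE.
  by case: (leP (v ord0 i + r / 2) (w ord0 i)) => ? /=; apply/andP; split; lra.
rewrite -bigcup_seq /= => -[b _ H] i.
have := H i; rewrite !mxE; case: (b i) => /= /andP[? ?]; apply/andP; split; lra.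
Qed.

Lemma trivIset_subhcube v r :
  trivIset setT (fun b => hcube (subcorner v r b) (r / 2)).
Proof.
apply/trivIsetP => b c _ _ bc; apply/seteqP; split => // w [H1 H2].
move/eqP: bc; apply; apply/ffunP => i.
have := H1 i; have := H2 i; rewrite !mxE.
by case: (b i); case: (c i) => //=; rewrite ?mulr1 ?mulr0 ?addr0 => /andP[? ?] /andP[? ?]; exfalso; lra.
Qed.

Lemma ge0_integral_hcube v r (f : 'rV[R]_d -> \bar R) :
  0 <= r -> measurable_fun (hcube v r) f -> (forall x, hcube v r x -> 0 <= f x)%E ->
  (\int[mu]_(x in hcube v r) f x =
  \sum_(b : {ffun 'I_d -> bool}) \int[mu]_(x in hcube (subcorner v r b) (r / 2)) f x)%E.
Proof.
move=> r0 mf f0; rewrite {1}hcube_bigcup// ge0_integral_bigsetU//=.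
- by move=> b; exact: measurable_hcube.
- exact: index_enum_uniq.
- exact: sub_trivIset (@trivIset_subhcube v r).
- by rewrite -hcube_bigcup.
- by rewrite -hcube_bigcup.
Qed.

End hcube.

(** * Lipschitz functions of one variable *)

Section measurable_lim.
Context d (T : measurableType d) {R : realType}.
Variable q : R -> T -> R.
Hypothesis mq : forall h, h != 0 -> measurable_fun setT (q h).
Hypothesis cq : forall x h, h != 0 -> {for h, continuous (fun h => q h x)}.

Let small (n : nat) (h : R) : bool := (h != 0) && (`|h| < n.+1%:R^-1).

Let C (k n : nat) (p : rat * rat) : set T :=
  if small n (ratr p.1) && small n (ratr p.2)
  then [set x | `|q (ratr p.1) x - q (ratr p.2) x| <= k.+1%:R^-1] else setT.

(** Cauchy's criterion as [h] tends to 0, tested on pairs of rational increments only, hence a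
    countable combination of measurable sets. *)
Let G : set T := \bigcap_k \bigcup_n \bigcap_p C k n p.

Let mC k n p : measurable (C k n p).
Proof.
rewrite /C; case: ifPn => // /andP[/andP[h1 _] /andP[h2 _]].
rewrite -[X in measurable X]setTI.
apply: (measurable_fun_ler _ (measurable_cst _)) => //=.
apply: (measurableT_comp (@normr_measurable R setT)).
by apply: measurable_funB; exact: mq.
Qed.

Let mG : measurable G.
Proof.
apply: bigcapT_measurable => k; apply: bigcupT_measurable => n.
rewrite -[X in measurable X]setCK setC_bigcap; apply: measurableC.
by apply: countable_bigcupT_measurable => [|p]; [exact: countableP|exact/measurableC/mC].
Qed.

Let GP x : G x <-> cvg (q h x @[h --> 0^']).
Proof.
split=> [Gx|/cvg_ex[l ql]].
  apply/cauchy_cvgP; apply/cauchy_exP => e e0.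
  have [k ke] : exists k : nat, k.+1%:R^-1 < e / 2.
    exists (Num.truncn (e / 2)^-1); rewrite invf_plt ?posrE ?divr_gt0//.
    exact: truncnS_gt.
  have [n _ Cx] := Gx k I.
  have n0 : (0:R) < n.+1%:R^-1 by rewrite invr_gt0.
  have [p0 p0n] : exists p0 : rat, small n (ratr p0).
    have /rat_in_itvoo[p] := n0; rewrite in_itv/= => /andP[p1 p2].
    by exists p; rewrite /small gt_eqF//= gtr0_norm.
  exists (q (ratr p0) x).
  rewrite /nbhs/=; exists n.+1%:R^-1 => //= h /=; rewrite sub0r normrN => hn h0.
  have sh : small n h by rewrite /small h0.
  rewrite /ball/=.
  (* Continuity of the quotient in [h] away from 0 replaces a real increment by a rational one. *)
  have [p pn qp] : exists2 p : rat, small n (ratr p) & `|q h x - q (ratr p) x| < e / 2.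
    have := @cq x h h0; move/cvgrPdist_lt => /(_ (e / 2)); rewrite divr_gt0// => /(_ isT).
    have sn : \forall y \near h, small n y.
      exists (Num.min `|h| (n.+1%:R^-1 - `|h|)) => /=.
        by rewrite lt_min normr_gt0 h0 subr_gt0.
      move=> y /=; rewrite lt_min => /andP[h1 h2]; apply/andP; split.
        by apply: contraTneq h1 => ->; rewrite subr0 ltxx.
      have := ler_distD h y 0; rewrite !subr0 distrC => h3.
      by apply: le_lt_trans h3 _; rewrite -ltrBrDr.
    move=> H; have {H} := filterI sn H => -[r /= r0 Hr].
    have /rat_in_itvoo[p] : h - r < h + r by rewrite ltrBlDr -addrA ltrDl addr_gt0.
    rewrite in_itv/= => /andP[p1 p2]; exists p;
      by have [] := Hr (ratr p); rewrite //= ltr_distlC p1 p2.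
  have := Cx (p0, p) I; rewrite /C/= p0n pn/= => H.
  rewrite (splitr e); apply: le_lt_trans (ler_distD (q (ratr p) x) _ _) _.
  by rewrite ltrD// ?(le_lt_trans H)// distrC.
move=> k _; have k0 : (0:R) < k.+1%:R^-1 / 2 by rewrite divr_gt0.
move/cvgrPdist_lt : ql => /(_ _ k0)[r /= r0 Hr].
exists (Num.truncn r^-1) => // -[p1 p2] _; rewrite /C/=.
case: ifPn => //= /andP[/andP[p10 p1r] /andP[p20 p2r]].
have rn : (Num.truncn r^-1).+1%:R^-1 < r.
  by rewrite invf_plt ?posrE//; exact: truncnS_gt.
have := Hr (ratr p1); rewrite /= sub0r normrN => /(_ (lt_trans p1r rn) p10) h1.
have := Hr (ratr p2); rewrite /= sub0r normrN => /(_ (lt_trans p2r rn) p20) h2.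
rewrite (splitr k.+1%:R^-1); apply: le_trans (ler_distD l _ _) _.
by rewrite lerD// ltW// distrC.
Unshelve. all: by end_near. Qed.

(** [lim] takes a default value where the limit does not exist, so the set [G] of convergence must
    be measurable first; on it the limit can be taken along [h = 1 / (n + 1)]. *)
Lemma measurable_lim_dnbhs : measurable_fun setT (fun x => lim (q h x @[h --> 0^'])).
Proof.
rewrite (_ : (fun x => _) =
  fun x => if x \in G then lim (q h x @[h --> 0^']) else point); last first.
  apply/funext => x; case: ifPn => // /negP xG; apply: getPN => l ql.
  by apply: xG; rewrite inE; apply/GP/cvg_ex; exists l.
apply: measurable_fun_if => //.
- by apply: (measurable_fun_bool true); rewrite setTI preimage_mem_true.
- rewrite setTI preimage_mem_true.
  apply: (measurable_fun_cvg (h := fun n x => q n.+1%:R^-1 x)).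
    by move=> n; apply: measurable_funTS; apply: mq; rewrite invr_eq0.
  move=> x Gx.
  have /GP/cvg_ex[l ql] := Gx.
  have -> : lim (q h x @[h --> 0^']) = l by apply: cvg_lim.
  move/cvgr_dnbhsP : ql; apply; split => [n|]; first by rewrite invr_eq0.
  exact: cvg_harmonic.
Qed.

End measurable_lim.

Section lipschitz1.
Context {R : realType}.
Local Notation leb := (@lebesgue_measure R).

Lemma lipschitz_continuous (V W : normedModType R) (F : V -> W) (L : R) : 0 < L ->
  (forall x y, `|F x - F y| <= L * `|x - y|) -> continuous F.
Proof.
move=> L0 FL x; apply/cvgrPdist_lt => e e0.
have eL : 0 < e / L by rewrite divr_gt0.
have /cvgrPdist_lt/(_ _ eL) : id @ x --> x by exact: cvg_id.
apply: filterS => y /= xy; apply: (le_lt_trans (FL _ _)).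
by rewrite mulrC -ltr_pdivlMr.
Qed.

(** Both [G] and [K * x - G x] are nondecreasing, and by uniqueness their Stieltjes measures add up
    to [K] times Lebesgue measure, so the first is dominated by it. *)
Let nondecreasing_dominated (G : R -> R) (K : R) : 0 < K ->
  {homo G : x y / x <= y} -> (forall x y, x <= y -> G y - G x <= K * (y - x)) ->
  continuous G ->
  exists nu : {measure set (measurableTypeR R) -> \bar R},
    (forall a b, a <= b -> nu `]a, b]%classic = (G b - G a)%:E) /\
    (forall A, measurable A -> (nu A <= K%:E * leb A)%E).
Proof.
move=> K0 Gnd GK cG.
pose H x := K * x - G x.
have Hnd : {homo H : x y / x <= y}.
  by move=> x y xy; have := GK _ _ xy; rewrite /H; lra.
have cK : continuous (fun x : R => K * x).
  by move=> x; apply: cvgM; [exact: cvg_cst|exact: cvg_id].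
have cH : continuous H by move=> x; apply: cvgB; [exact: cK|exact: cG].
have Knd : {homo (fun x : R => K * x) : x y / x <= y}.
  by move=> x y xy; rewrite ler_wpM2l// ltW.
pose Gm := isCumulative.Build R _ R G Gnd (right_continuousW cG).
pose Hm := isCumulative.Build R _ R H Hnd (right_continuousW cH).
pose Km := isCumulative.Build R _ R (fun x : R => K * x) Knd (right_continuousW cK).
pose Gc : cumulative R R := HB.pack G Gm.
pose Hc : cumulative R R := HB.pack H Hm.
pose Kc : cumulative R R := HB.pack (fun x : R => K * x) Km.
have itvE (f : cumulative R R) (a b : R) : a <= b ->
    lebesgue_stieltjes_measure f `]a, b]%classic = (f b - f a)%:E.
  move=> ab; rewrite /lebesgue_stieltjes_measure/= /measure_extension/=.
  rewrite measurable_mu_extE/=; last exact: is_ocitv.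
  by rewrite wlength_itv_bnd.
exists (lebesgue_stieltjes_measure Gc); split => [a b ab|A mA]; first exact: itvE.
have K0' : 0 <= K by exact: ltW.
have <- : lebesgue_stieltjes_measure Kc A = (K%:E * leb A)%E.
  rewrite (@lebesgue_stieltjes_measure_unique _ Kc (mscale (NngNum K0') leb))//.
  move=> _ [[a b] _ <-] /=.
  have [ba|ab] := leP b a.
    by rewrite set_itv_ge ?bnd_simp -?leNgt// !measure0.
  rewrite itvE ?ltW//= /mscale/= lebesgue_measure_itv/= lte_fin ab.
  by rewrite -EFinD -EFinM mulrBr.
rewrite (@lebesgue_stieltjes_measure_unique _ Kc
  (measure_add (lebesgue_stieltjes_measure Gc) (lebesgue_stieltjes_measure Hc)))//.
  rewrite [leRHS](_ : _ = (lebesgue_stieltjes_measure Gc A +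
    lebesgue_stieltjes_measure Hc A)%E); last exact: measure_addE.
  by rewrite leeDl.
move=> _ [[a b] _ <-] /=.
have [ba|ab] := leP b a.
  by rewrite set_itv_ge ?bnd_simp -?leNgt// !measure0.
rewrite [RHS](_ : _ = (lebesgue_stieltjes_measure Gc `]a, b]%classic +
  lebesgue_stieltjes_measure Hc `]a, b]%classic)%E); last exact: measure_addE.
rewrite !itvE ?ltW//= -EFinD; congr EFin; rewrite /H; lra.
Qed.

Let integrable_cst_oc (k a b : R) : leb.-integrable `]a, b] (EFin \o cst k).
Proof.
have mab : measurable (`]a, b]%classic : set (measurableTypeR R)) by exact: measurable_itv.
apply/integrableP; split; first by apply/measurable_EFinP; exact: measurable_cst.
rewrite (_ : (fun x => _) = cst `|k|%:E)// integral_cst// lte_mul_pinfty// ?lee_fin//.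
by rewrite [X in (X < _)%E](lebesgue_measure_itv `]a, b])/=; case: ifP => _; rewrite -?EFinD ltry.
Qed.

Variables (F : R -> R) (L : R).
Hypothesis L0 : 0 < L.
Hypothesis FL : forall x y, `|F x - F y| <= L * `|x - y|.

(** [F x + L * x] is nondecreasing with a Stieltjes measure dominated by Lebesgue measure. Its
    Radon-Nikodym density [r] gives the integral formula, and differentiating the integral
    identifies [r - L] with the derivative of [F] almost everywhere. The bounded interval makes the
    measure finite and [r] integrable. *)
Let density_on (n : nat) : exists r : R -> R,
  [/\ measurable_fun setT r, leb.-integrable setT (EFin \o r),
  forall a b, - n.+1%:R <= a -> a <= b -> b <= n.+1%:R ->
    F b - F a = \int[leb]_(x in `]a, b]) (r x - L) &
  {ae leb, forall x, - n.+1%:R < x < n.+1%:R ->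
    derivable F x 1 /\ 'D_1 F x = r x - L}].
Proof.
have L0' := L0.
pose G x := F x + L * x.
have FL' x y : x <= y -> `|F x - F y| <= L * (y - x).
  move=> xy; have yx : 0 <= y - x by rewrite subr_ge0.
  by have := FL x y; rewrite (distrC x y) (ger0_norm yx).
have Gnd : {homo G : x y / x <= y}.
  move=> x y xy; have := FL' _ _ xy; rewrite ler_norml => /andP[h1 h2].
  by rewrite /G; lra.
have GK x y : x <= y -> G y - G x <= 2 * L * (y - x).
  move=> xy; have := FL' _ _ xy; rewrite ler_norml => /andP[h1 h2].
  by rewrite /G; lra.
have cF : continuous F := lipschitz_continuous L0 FL.
have cG : continuous G.
  by move=> x; apply: cvgD; [exact: cF|apply: cvgM; [exact: cvg_cst|exact: cvg_id]].
have L20 : 0 < 2 * L by rewrite mulr_gt0.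
have [nu [nuE nu_leb]] := nondecreasing_dominated L20 Gnd GK cG.
pose n1 : R := n.+1%:R.
pose E : set (measurableTypeR R) := `]- n1, n1]%classic.
have mE : measurable E by exact: measurable_itv.
have n10 : - n1 <= n1 by rewrite ge0_cp.
have nuE0 : (nu E < +oo)%E by rewrite nuE// ltry.
pose nuR : {finite_measure set (measurableTypeR R) -> \bar R} := mfrestr mE nuE0.
have domi : nuR `<< leb.
  apply/null_content_dominatesP => S mS S0.
  apply/eqP; rewrite eq_le measure_ge0 andbT.
  have /le_trans : (nuR S <= (2 * L)%:E * leb (S `&` E))%E.
    by apply: nu_leb; exact: measurableI.
  apply; rewrite (_ : leb (S `&` E) = 0%E) ?mule0//.
  by apply: (subset_measure0 _ mS) => //; exact: measurableI.
have [rho [rho0 rhofin irho rhoE]] := radon_nikodym_sigma_finite domi.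
pose r x := fine (rho x).
have rhor : rho = EFin \o r by apply/funext => x /=; rewrite fineK.
rewrite rhor in irho rhoE.
have mr : measurable_fun setT r by apply/measurable_EFinP; case/integrableP: irho.
have Gab a b : - n1 <= a -> a <= b -> b <= n1 ->
    G b - G a = \int[leb]_(x in `]a, b]) r x.
  move=> na ab bn; rewrite /Rintegral -rhoE; last exact: measurable_itv.
  rewrite /nuR /= /mfrestr /mrestr setIidl; first by rewrite nuE.
  by rewrite /E => x /=; rewrite !in_itv/= => /andP[h1 h2]; rewrite (le_lt_trans na h1) (le_trans h2 bn).
have irS a b : leb.-integrable `]a, b] (EFin \o r).
  by apply: (integrableS measurableT) => //; exact: measurable_itv.
have icst := @integrable_cst_oc L.
exists r; split => //.
- move=> a b na ab bn; have := Gab _ _ na ab bn.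
  rewrite (RintegralB _ (irS a b) (icst a b)); last exact: measurable_itv.
  rewrite Rintegral_cst; last exact: measurable_itv.
  rewrite [X in fine X](lebesgue_measure_itv `]a, b])/= lte_fin => <-.
  rewrite /G; case: (ltP a b) => [_|ba] /=; first by ring.
  by have -> : a = b by [apply/eqP; rewrite eq_le ab]; ring.
- have locr : locally_integrable [set: R] r.
    have -> : r = r \_ setT by rewrite patch_setT.
    exact: integrable_locally.
  have := @FTC1 R r (BRight (- n1)) (fun y => irS (- n1) y) locr.
  apply: filterS; first exact: (ae_filter_ringOfSetsType leb).
  move=> x H /andP[x1 x2].
  have [dFr Fr'] := H x1.
  pose Fr y := \int[leb]_(t in `](- n1), y]) r t.
  have {}Fr' : is_derive x 1 Fr (r x) by apply: (DeriveDef dFr); rewrite -derive1E.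
  have HF : is_derive x 1 F (r x - L).
    have FH : {near x, (fun y => Fr y + (G (- n1) - L * y)) =1 F}.
      have : x \in `]- n1, n1[ by rewrite in_itv/= x1 x2.
      move/near_in_itvoo; apply: filterS => y; rewrite in_itv/= => /andP[y1 y2].
      rewrite /Fr -Gab ?lexx ?ltW// /G; lra.
    apply: (near_eq_is_derive FH).
    have -> : r x - L = r x + (0 - L *: 1) by rewrite sub0r [L *: 1]mulr1.
    exact: is_deriveD.
  by split; [exact: ex_derive|exact: derive_val].
Qed.

Lemma measurable_derive_lipschitz1 : measurable_fun setT (fun x => 'D_1 F x).
Proof.
have cF : continuous F := lipschitz_continuous L0 FL.
have mF : measurable_fun setT F by exact: continuous_measurable_fun.
pose q (h x : R) : R := h^-1 * (F (h * 1 + x) - F x).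
suff : measurable_fun setT (fun x => lim (q h x @[h --> 0^'])) by [].
apply: measurable_lim_dnbhs => [h h0|x h h0].
  apply: measurable_funM => //; apply: measurable_funB => //.
  by apply: (measurableT_comp mF); exact: measurable_funD.
apply: cvgM; first exact: cvgV.
apply: cvgB; last exact: cvg_cst.
have H : y * 1 + x @[y --> h] --> h * 1 + x.
  apply: cvgD; last exact: cvg_cst.
  by apply: cvgM; [exact: cvg_id|exact: cvg_cst].
exact: (cvg_comp _ _ H (cF _)).
Qed.

Lemma lipschitz1_le_integral a b : a <= b ->
  (`|F b - F a|%:E <= \int[leb]_(x in `[a, b]) `|'D_1 F x|%:E)%E.
Proof.
move=> ab.
pose n := Num.truncn (`|a| + `|b|).
have nab : `|a| + `|b| < n.+1%:R by exact: truncnS_gt.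
have [r [mr ir rE rD]] := density_on n.
have a0 := normr_ge0 a; have b0 := normr_ge0 b.
have /andP[na1 na2] : - n.+1%:R < a < n.+1%:R by rewrite -ltr_norml; lra.
have /andP[nb1 nb2] : - n.+1%:R < b < n.+1%:R by rewrite -ltr_norml; lra.
have mab : measurable (`]a, b]%classic : set (measurableTypeR R)) by exact: measurable_itv.
have mcab : measurable (`[a, b]%classic : set (measurableTypeR R)) by exact: measurable_itv.
have mrL : measurable_fun `]a, b] (fun x : measurableTypeR R => (r x - L)%:E).
  apply/measurable_EFinP; apply: measurable_funB => //.
  exact: measurable_funTS.
have mD : measurable_fun setT (fun x : measurableTypeR R => `|'D_1 F x|%:E).
  apply/measurable_EFinP; apply: (measurableT_comp (@normr_measurable R setT)).
  exact: measurable_derive_lipschitz1.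
have rLfin : (\int[leb]_(x in `]a, b]) (r x - L)%:E)%E \is a fin_num.
  have ir' := integrableS measurableT mab (@subsetT _ _) ir.
  by rewrite (integralB_EFin mab ir' (integrable_cst_oc L a b)) fin_numB; apply/andP; split; apply: integrable_fin_num => //; exact: integrable_cst_oc.
have -> : (`|F b - F a|%:E = `|\int[leb]_(x in `]a, b]) (r x - L)%:E|)%E.
  by rewrite -(fineK rLfin)/= (rE a b (ltW na1) ab (ltW nb2)).
apply: (le_trans (le_abse_integral _ mab mrL)).
apply: (@le_trans _ _ (\int[leb]_(x in `]a, b]) `|'D_1 F x|%:E)%E).
  rewrite le_eqVlt; apply/orP; left; apply/eqP; apply: ae_eq_integral => //.
  - exact: measurableT_comp.
  - exact: measurable_funTS.
  apply: filterS rD; first exact: (ae_filter_ringOfSetsType leb).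
  move=> x + xab => -[|_ ->//].
  by move: xab; rewrite /= in_itv/= => /andP[? ?]; apply/andP; split; lra.
apply: ge0_subset_integral => //; first exact: measurable_funTS.
by move=> x /=; rewrite !in_itv/= => /andP[/ltW -> ->].
Qed.
End lipschitz1.

(** * Gradients and increments on cubes *)

Section hcube_shift.
Context {R : realType} {d : nat}.
Local Notation mu := (lebesgue_rV R d).
Implicit Types (v w a : 'rV[R]_d) (r : R).

Lemma integral_rV_shift a (f : 'rV[R]_d -> \bar R) : measurable_fun setT f ->
  (\int[mu]_v f (v + a)%R = \int[mu]_v f v)%E.
Proof.
move=> mf; rewrite integralE [RHS]integralE; congr (_ - _)%E.
  rewrite -[RHS](ge0_integral_rV_shift a) => [|//|v]; last exact: funepos_ge0.
    by apply: eq_integral => v _; rewrite !funeposE.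
  exact: measurable_funepos.
rewrite -[RHS](ge0_integral_rV_shift a) => [|//|v]; last exact: funeneg_ge0.
  by apply: eq_integral => v _; rewrite !funenegE.
exact: measurable_funeneg.
Qed.

Lemma hcubeD v a r w : hcube (v + a) r (w + a) <-> hcube v r w.
Proof.
by split=> H i; have := H i; rewrite !mxE [_ + a _ _ + r]addrAC lerD2r ltrD2r.
Qed.

Lemma integral_hcube_shift v a r (f : 'rV[R]_d -> \bar R) : measurable_fun setT f ->
  (\int[mu]_(x in hcube (v + a)%R r) f x = \int[mu]_(x in hcube v r) f (x + a)%R)%E.
Proof.
move=> mf; rewrite integral_mkcond [RHS]integral_mkcond.
rewrite -(integral_rV_shift a); last first.
  apply/(measurable_restrictT _ _).1; first exact: measurable_hcube.
  exact: measurable_funTS.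
apply: eq_integral => w _; rewrite !patchE.
case: ifPn; case: ifPn => //; rewrite ?inE ?notin_setE.
- by move=> h1 /hcubeD.
- by move=> h1 h2; exfalso; apply: h2; apply/hcubeD.
Qed.

End hcube_shift.

Section gradient.
Context {R : realType} {d : nat}.
Local Notation mu := (lebesgue_rV R d).
Implicit Types (v w a e : 'rV[R]_d) (r t : R).
Variables (phi : 'rV[R]_d -> R) (L : R).
Hypothesis L0 : 0 < L.
Hypothesis phiL : forall x y, `|phi x - phi y| <= L * `|x - y|.

Let mphi : measurable_fun setT phi.
Proof. exact: measurable_lipschitz_rV phiL. Qed.

Let cphi : continuous phi.
Proof. exact: lipschitz_continuous phiL. Qed.

Lemma measurable_derive_lipschitz e : measurable_fun setT ('D_e phi).
Proof.
pose q (h : R) v : R := h^-1 * (phi (h *: e + v) - phi v).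
suff : measurable_fun setT (fun x => lim (q h x @[h --> 0^'])) by [].
apply: measurable_lim_dnbhs => [h h0|x h h0].
  apply: measurable_funM => //; apply: measurable_funB => //.
  by apply: (measurableT_comp mphi); exact: measurable_rVD.
apply: cvgM; first exact: cvgV.
apply: cvgB; last exact: cvg_cst.
have H : y *: e + x @[y --> h] --> h *: e + x.
  apply: cvgD; last exact: cvg_cst.
  by apply: cvgZ; [exact: cvg_id|exact: cvg_cst].
exact: (cvg_comp _ _ H (@cphi _)).
Qed.

Lemma norm_derive_lipschitz e v : `|'D_e phi v| <= L * `|e|.
Proof.
have [H|H] := pselect (derivable phi v e); last first.
  (* Where the limit of difference quotients does not exist, the derivative takes the default value
     0. *)
  have -> : 'D_e phi v = 0.
    by apply: getPN => l ql; apply: H; apply/cvg_ex; exists l.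
  by rewrite normr0 mulr_ge0// ltW.
have -> : `|'D_e phi v| = lim ((fun h => `|h^-1 *: ((phi \o shift v) (h *: e) - phi v)|) @ 0^').
  by apply/esym/cvg_lim => //; apply: cvg_norm; exact: H.
apply: limr_le; first by apply: is_cvg_norm; exact: H.
near=> h.
have h0 : h != 0 by near: h; exact: nbhs_dnbhs_neq.
rewrite normrM normfV ler_pdivrMl ?normr_gt0//.
apply: (le_trans (phiL _ _)); rewrite /= addrK normrZ.
by rewrite mulrCA.
Unshelve. all: by end_near. Qed.

Lemma derive_line v e t :
  'D_1 (fun t => phi (v + t *: e)) t = 'D_e phi (v + t *: e).
Proof.
rewrite /derive; congr (lim (_ @ 0^')); apply/funext => h /=.
by rewrite [h *: 1]mulr1 scalerDl addrCA.
Qed.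

Lemma increment_le_integral v e t : 0 <= t -> `|e| <= 1 ->
  (`|phi (v + t *: e) - phi v|%:E <=
   \int[lebesgue_measure]_(s in `[0%R, t]) `|'D_e phi (v + s *: e)%R|%:E)%E.
Proof.
move=> t0 e1.
have FL x y : `|phi (v + x *: e) - phi (v + y *: e)| <= L * `|x - y|.
  apply: (le_trans (phiL _ _)); rewrite ler_wpM2l ?(ltW L0)//.
  by rewrite opprD addrACA subrr add0r -scalerBl normrZ ler_piMr.
have := @lipschitz1_le_integral R (fun t => phi (v + t *: e)) L L0 FL 0 t t0.
rewrite scale0r addr0 => /le_trans; apply.
by under eq_integral => s _ do rewrite derive_line.
Qed.

(** The increment is bounded by an integral along the segment. After exchanging the integrals, the
    slice at time [s] is an integral over the translate of [hcube w l] by [s *: e], which stays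
    inside [hcube v r]; integrating over [s] gives the factor [t]. *)
Lemma integral_increment_hcube v r w l e t : 0 <= t -> `|e| <= 1 ->
  (forall x, hcube w l x -> forall u, 0 <= u <= t -> hcube v r (x + u *: e)) ->
  (\int[mu]_(x in hcube w l) `|phi (x + t *: e) - phi x|%:E <=
   t%:E * \int[mu]_(x in hcube v r) `|'D_e phi x|%:E)%E.
Proof.
move=> t0 e1 sub.
pose D x : \bar R := `|'D_e phi x|%:E.
have mD : measurable_fun setT D.
  apply/measurable_EFinP; apply: (measurableT_comp (@normr_measurable R setT)).
  exact: measurable_derive_lipschitz.
have mDx x : measurable_fun setT (fun s : measurableTypeR R => D (x + s *: e)).
  apply: (measurableT_comp mD).
  by apply: measurable_rVD => //; exact: measurable_rVZ.
have mT : measurable (`[0, t]%classic : set (measurableTypeR R)) by exact: measurable_itv.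
have mws := measurable_hcube w l.
pose J (p : 'rV[R]_d * measurableTypeR R) : \bar R :=
  ((\1_(hcube w l) p.1)%:E * (\1_(`[0%R, t]%classic) p.2)%:E * D (p.1 + p.2 *: e)%R)%E.
have mJ : measurable_fun setT J.
  apply: emeasurable_funM; first apply: emeasurable_funM.
  - apply/measurable_EFinP.
    by apply: (measurableT_comp (measurable_indic mws)); exact: measurable_fst.
  - apply/measurable_EFinP.
    by apply: (measurableT_comp (measurable_indic mT)); exact: measurable_snd.
  - apply: (measurableT_comp mD).
    by apply: measurable_rVD; [exact: measurable_fst|apply: measurable_rVZ;
      [exact: measurable_snd|exact: measurable_cst]].
have J0 p : (0 <= J p)%E by rewrite !mule_ge0 ?lee_fin.
apply: (@le_trans _ _ (\int[mu]_x \int[lebesgue_measure]_s J (x, s))%E).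
  rewrite integral_mkcond; apply: ge0_le_integral => //.
  - by move=> x _; rewrite patchE; case: ifP => // _; rewrite lee_fin.
  - apply/(measurable_restrictT _ _).1 => //; apply: measurable_funTS.
    apply/measurable_EFinP; apply: (measurableT_comp (@normr_measurable R setT)).
    apply: measurable_funB => //; apply: (measurableT_comp mphi).
    exact: measurable_rVD.
  - exact: (measurable_fun_fubini_tonelli_F (m2 := lebesgue_measure) _ mJ J0).
  - move=> x _; rewrite patchE; case: ifPn => [|xw]; last exact: integral_ge0.
    rewrite inE => xw; apply: (le_trans (increment_le_integral x t0 e1)).
    rewrite integral_mkcond le_eqVlt; apply/orP; left; apply/eqP.
    apply: eq_integral => y _; rewrite /J/= patchE !indicE (mem_set xw).
    by case: (y \in _); rewrite !mul1e ?mul0e.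
rewrite (fubini_tonelli (m1 := mu) (m2 := lebesgue_measure) _ mJ J0).
pose K : \bar R := (\int[mu]_(x in hcube v r) D x)%E.
have K0 : (0 <= K)%E by apply: integral_ge0 => x _; rewrite lee_fin.
apply: (@le_trans _ _ (\int[lebesgue_measure]_s ((\1_(`[0%R, t]%classic) s)%:E * K)))%E.
  apply: ge0_le_integral => //.
  - by move=> y _; exact: integral_ge0.
  - exact: (measurable_fun_fubini_tonelli_G (m1 := mu) _ mJ J0).
  - apply: emeasurable_funM => //; apply/measurable_EFinP.
    exact: measurable_indic.
  - move=> y _; rewrite /J/= indicE; case: (boolP (y \in _)) => [|_]; last first.
      by rewrite mul0e integral0_eq// => x _; rewrite mule0 mul0e.
    rewrite inE/= in_itv/= mul1e => yt.
    apply: (@le_trans _ _ (\int[mu]_(x in hcube w l) D (x + y *: e)%R)%E).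
      rewrite [leRHS]integral_mkcond le_eqVlt; apply/orP; left; apply/eqP.
      apply: eq_integral => x _; rewrite /= patchE indicE.
      by case: (x \in _); rewrite mule1 ?mul1e ?mul0e.
    rewrite -(integral_hcube_shift w (y *: e) l mD).
    apply: ge0_subset_integral; [exact: measurable_hcube|exact: measurable_hcube| | |].
    + exact: measurable_funTS.
    + by move=> x _; rewrite lee_fin.
    + move=> x xw; rewrite -(subrK (y *: e) x); apply: sub => //.
      by apply/(hcubeD _ (y *: e)); rewrite subrK.
rewrite ge0_integralZr//; last first.
  by apply/measurable_EFinP; exact: measurable_indic.
rewrite integral_indic// setIT [X in (X * _)%E](lebesgue_measure_itv `[0, t])/= lte_fin.
rewrite sube0; case: ltP => // t0'.
by rewrite mul0e mule_ge0// lee_fin.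
Qed.

(** The increment is decomposed along the axes because the estimates are in terms of partial
    derivatives, and ['D_e phi] is known to be a combination of these only where [phi] is
    differentiable. *)
Lemma coord_increment_sum v e : phi (v + e) - phi v =
  \sum_(k < d) (phi (v + \sum_(i < d | (i <= k)%N) e ord0 i *: delta_mx ord0 i) -
    phi (v + \sum_(i < d | (i < k)%N) e ord0 i *: delta_mx ord0 i)).
Proof.
pose F k := phi (v + \sum_(i < d | (i < k)%N) e ord0 i *: delta_mx ord0 i).
rewrite (eq_bigr (fun k : 'I_d => F k.+1 - F k))//.
rewrite -(big_mkord xpredT (fun k => F k.+1 - F k)) telescope_sumr// /F.
rewrite [X in _ - phi (v + X)]big_pred0// addr0.
by under eq_bigl do rewrite ltn_ord; rewrite -row_sum_delta.
Qed.

End gradient.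

(** * Averages over half-open cubes *)

Section cube_average.
Context {R : realType} {d : nat}.
Local Notation mu := (lebesgue_rV R d).
Local Notation node := ('rV[R]_d * R)%type.
Implicit Types (t : node) (F G : 'rV[R]_d -> R).

Definition hc t : set 'rV[R]_d := hcube t.1 t.2.

Definition hchild t (b : {ffun 'I_d -> bool}) : node :=
  (subcorner t.1 t.2 b, t.2 / 2).

Definition cavg F t : R := (\int[mu]_(x in hc t) F x) / t.2 ^+ d.

Definition cint t F := mu.-integrable (hc t) (EFin \o F).

(** Plays the role of [P] for trees: it is stable under [hchild], and functions integrable on [t0]
    are integrable on every such [t]. *)
Definition subnode t0 t := 0 < t.2 /\ hc t `<=` hc t0.

Lemma measurable_hc t : measurable (hc t).
Proof. exact: measurable_hcube. Qed.
#[local] Hint Resolve measurable_hc : core.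

Lemma mu_hc t : 0 < t.2 -> mu (hc t) = (t.2 ^+ d)%:E.
Proof. by move=> t0; rewrite lebesgue_rV_hcube// ltW. Qed.

Lemma card_hchild_gt0 : (0 < #|{: {ffun 'I_d -> bool}}|)%N.
Proof. by apply/card_gt0P; exists [ffun=> true]. Qed.

Lemma subnode_refl t : 0 < t.2 -> subnode t t.
Proof. by move=> t0; split. Qed.

Lemma subnode_child t0 t b : subnode t0 t -> subnode t0 (hchild t b).
Proof.
move=> [t1 t2]; split; first by rewrite divr_gt0.
by apply: subset_trans t2; apply: subhcube; exact: ltW.
Qed.

Lemma cint_sub t0 t F : subnode t0 t -> cint t0 F -> cint t F.
Proof. by move=> [_ ts]; apply: integrableS. Qed.

Lemma le_cint t F G : measurable_fun setT F ->
  (forall x, hc t x -> `|F x| <= G x) -> cint t G -> cint t F.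
Proof.
move=> mF FG; apply: le_integrable => //.
  by apply/measurable_EFinP; exact: measurable_funTS.
by move=> x tx /=; rewrite lee_fin (le_trans (FG _ tx))// ler_norm.
Qed.

Lemma cint_cst t (k : R) : 0 < t.2 -> cint t (fun=> k).
Proof.
move=> t0; apply: measurable_bounded_integrable => //.
  by rewrite [X in (X < _)%E](mu_hc t0) ltry.
exists `|k|; split; first exact: num_real.
by move=> M kM x _ /=; exact: ltW.
Qed.

Lemma cintD t F G : cint t F -> cint t G -> cint t (fun x => F x + G x).
Proof.
move=> iF iG; rewrite /cint (_ : _ \o _ = (EFin \o F) \+ (EFin \o G))%E//.
exact: integrableD.
Qed.

Lemma cintZ t (k : R) F : cint t F -> cint t (fun x => k * F x).
Proof.
move=> iF; rewrite /cint (_ : _ \o _ = fun x => k%:E * (EFin \o F) x)%E//.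
exact: integrableZl.
Qed.

Lemma cint_ltey t F : measurable_fun setT F -> (forall x, 0 <= F x) ->
  (\int[mu]_(x in hc t) (F x)%:E < +oo)%E -> cint t F.
Proof.
move=> mF F0 Foo; apply/integrableP; split.
  by apply/measurable_EFinP; exact: measurable_funTS.
by under eq_integral do rewrite /= ger0_norm//.
Qed.

Lemma cint_Rintegral t F : cint t F ->
  (\int[mu]_(x in hc t) (F x)%:E = (\int[mu]_(x in hc t) F x)%R%:E)%E.
Proof. by move=> iF; rewrite /Rintegral fineK//; exact: integrable_fin_num. Qed.

Lemma cavgE t F : 0 < t.2 -> cint t F ->
  (\int[mu]_(x in hc t) (F x)%:E = (t.2 ^+ d * cavg F t)%:E)%E.
Proof.
move=> t0 iF; rewrite /cavg mulrC divfK ?gt_eqF ?exprn_gt0//.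
exact: cint_Rintegral.
Qed.

Lemma cavg_ge0 t F : 0 < t.2 -> (forall x, hc t x -> 0 <= F x) -> 0 <= cavg F t.
Proof.
move=> t0 F0; rewrite divr_ge0 ?exprn_ge0 ?(ltW t0)//.
exact: Rintegral_ge0.
Qed.

Lemma le_cavg t F G : 0 < t.2 -> cint t F -> cint t G ->
  (forall x, hc t x -> F x <= G x) -> cavg F t <= cavg G t.
Proof.
move=> t0 iF iG FG; rewrite ler_wpM2r ?invr_ge0 ?exprn_ge0 ?(ltW t0)//.
exact: le_Rintegral.
Qed.

Lemma cavgD t F G : cint t F -> cint t G ->
  cavg (fun x => F x + G x) t = cavg F t + cavg G t.
Proof. by move=> iF iG; rewrite /cavg RintegralD// mulrDl. Qed.

Lemma cavgZ t (k : R) F : cint t F -> cavg (fun x => k * F x) t = k * cavg F t.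
Proof. by move=> iF; rewrite /cavg RintegralZl// mulrA. Qed.

Lemma cavg_cst t (k : R) : 0 < t.2 -> cavg (fun=> k) t = k.
Proof.
by move=> t0; rewrite /cavg Rintegral_cst// [X in fine X](mu_hc t0)/= mulfK// gt_eqF// exprn_gt0.
Qed.

Lemma cavg_martingale t0 F : cint t0 F -> measurable_fun setT F ->
  martingale hchild (subnode t0) (cavg F).
Proof.
move=> iF mF [v r] [/= r0 rs].
have iFr : cint (v, r) F by exact: cint_sub iF.
rewrite /child_avg /cavg /=.
have -> : \int[mu]_(x in hc (v, r)) F x =
    \sum_(b : {ffun 'I_d -> bool}) \int[mu]_(x in hc (hchild (v, r) b)) F x.
  rewrite /Rintegral /hc/= (hcube_bigcup _ (ltW r0)) integral_bigsetU_EFin.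
  - rewrite (eq_bigr (fun b => (fine
        (\int[mu]_(x in hcube (subcorner v r b) (r / 2)) (F x)%:E))%:E)).
      by rewrite sumEFin.
    move=> b _; rewrite fineK//.
    have ib : cint (hchild (v, r) b) F by apply: cint_sub iF; exact: subnode_child.
    exact: (integrable_fin_num (measurable_hcube _ _) ib).
  - by move=> b; exact: measurable_hcube.
  - exact: index_enum_uniq.
  - exact: sub_trivIset (@trivIset_subhcube _ _ v r).
  - by apply/measurable_EFinP; exact: measurable_funTS.
rewrite -mulr_suml card_ffun card_bool card_ord natrX.
have r2 : r ^+ d != 0 by rewrite expf_neq0// gt_eqF.
rewrite expr_div_n; field.
by rewrite r2 expf_neq0// pnatr_eq0.
Qed.

(** Young's inequality at [x / A] and [y / B] is affine in [x] and [y], hence can be averaged; the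
    parameters [A] and [B] are then the averages of [F] and [G]. *)
Lemma hoelder_cavg t F G (th : R) : 0 < t.2 -> 0 < th < 1 ->
  (forall x, 0 <= F x) -> (forall x, 0 <= G x) ->
  measurable_fun setT F -> measurable_fun setT G -> cint t F -> cint t G ->
  cavg (fun x => F x `^ th * G x `^ (1 - th)) t <=
  cavg F t `^ th * cavg G t `^ (1 - th).
Proof.
move=> t0 /andP[th0 th1] F0 G0 mF mG iF iG.
pose H x := F x `^ th * G x `^ (1 - th).
have th1' : 0 < 1 - th by lra.
have young (A B x y : R) : 0 < A -> 0 < B -> 0 <= x -> 0 <= y ->
    x `^ th * y `^ (1 - th) <=
    A `^ th * B `^ (1 - th) * (th / A * x + (1 - th) / B * y).
  move=> A0 B0 x0 y0.
  have p0 : 0 < th^-1 by rewrite invr_gt0.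
  have p1 : 0 < (1 - th)^-1 by rewrite invr_gt0.
  have xA : 0 <= x / A by rewrite divr_ge0// ltW.
  have yB : 0 <= y / B by rewrite divr_ge0// ltW.
  have := @conjugate_powR R ((x / A) `^ th) ((y / B) `^ (1 - th)) th^-1 (1 - th)^-1
    (powR_ge0 _ _) (powR_ge0 _ _) p0 p1.
  rewrite !invrK (addrC th) subrK => /(_ erefl).
  rewrite -!powRrM !mulfV ?gt_eqF// !powRr1// => h.
  have -> : x `^ th = (x / A) `^ th * A `^ th.
    by rewrite -powRM ?(ltW A0)// divfK ?lt0r_neq0.
  have -> : y `^ (1 - th) = (y / B) `^ (1 - th) * B `^ (1 - th).
    by rewrite -powRM ?(ltW B0)// divfK ?lt0r_neq0.
  have AB0 : 0 <= A `^ th * B `^ (1 - th) by rewrite mulr_ge0 ?powR_ge0.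
  have := ler_wpM2l AB0 h; congr (_ <= _); ring.
have mH : measurable_fun setT H.
  apply: measurable_funM; exact: (measurableT_comp (measurable_powR _)).
have H0 x : 0 <= H x by rewrite mulr_ge0 ?powR_ge0.
have iFG (A B : R) : cint t (fun x => th / A * F x + (1 - th) / B * G x).
  by apply: cintD; exact: cintZ.
have iH : cint t H.
  apply: (le_cint mH _ (iFG 1 1)) => x _; rewrite ger0_norm//.
  by have := young 1 1 (F x) (G x) ltr01 ltr01 (F0 x) (G0 x); rewrite !powR1 !mul1r.
have bound (A B : R) : 0 < A -> 0 < B -> cavg H t <=
    A `^ th * B `^ (1 - th) * (th / A * cavg F t + (1 - th) / B * cavg G t).
  move=> A0 B0; rewrite -(cavgZ _ iF) -(cavgZ _ iG) -cavgD; try exact: cintZ.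
  rewrite -cavgZ//; apply: le_cavg => // [|x _]; first exact: cintZ.
  exact: young.
have cF0 : 0 <= cavg F t by exact: cavg_ge0.
have cG0 : 0 <= cavg G t by exact: cavg_ge0.
(* If one average vanishes it cannot serve as a parameter; its parameter is taken arbitrarily small
   and the other one equal to 1, which bounds the left side by any [e > 0]. *)
have [cF|cF] := ltP 0 (cavg F t); last first.
  have {}cF : cavg F t = 0 by apply/eqP; rewrite eq_le cF.
  rewrite cF powR0 ?gt_eqF// mul0r; apply/ler_addgt0Pr => e e0.
  have d0 : 0 < e / (cavg G t + 1) by rewrite divr_gt0//; lra.
  have := bound ((e / (cavg G t + 1)) `^ th^-1) 1 (powR_gt0 _ d0) ltr01.
  rewrite cF powR1 mulr0 add0r -powRrM mulVf ?gt_eqF// powRr1 ?(ltW d0)//.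
  move/le_trans; apply; rewrite mulr1 add0r divr1 mulrAC ler_pdivrMr; last lra.
  by rewrite ler_wpM2l ?(ltW e0)//; nra.
have [cG|cG] := ltP 0 (cavg G t); last first.
  have {}cG : cavg G t = 0 by apply/eqP; rewrite eq_le cG.
  rewrite cG powR0 ?gt_eqF// mulr0; apply/ler_addgt0Pr => e e0.
  have d0 : 0 < e / (cavg F t + 1) by rewrite divr_gt0//; lra.
  have := bound 1 ((e / (cavg F t + 1)) `^ (1 - th)^-1) ltr01 (powR_gt0 _ d0).
  rewrite cG powR1 mulr0 addr0 -powRrM mulVf ?gt_eqF// powRr1 ?(ltW d0)//.
  move/le_trans; apply; rewrite mul1r add0r divr1 mulrAC ler_pdivrMr; last lra.
  by rewrite ler_wpM2l ?(ltW e0)//; nra.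
have := bound _ _ cF cG; rewrite !divfK ?gt_eqF//.
by rewrite (addrC th) subrK mulr1.
Qed.

Lemma jensen_cavg t F (th : R) : 0 < t.2 -> 0 < th < 1 ->
  (forall x, 0 <= F x) -> measurable_fun setT F -> cint t F ->
  cavg (fun x => F x `^ th) t <= cavg F t `^ th.
Proof.
move=> t0 th01 F0 mF iF.
have := hoelder_cavg t0 th01 F0 (fun=> ler01) mF (measurable_cst _) iF (cint_cst 1 t0).
rewrite cavg_cst// powR1 mulr1; congr (_ <= _).
by congr (cavg _ t); apply/funext => x; rewrite mulr1.
Qed.

Lemma sqr_cavg_le t F : 0 < t.2 -> cint t F -> cint t (fun x => F x ^+ 2) ->
  cavg F t ^+ 2 <= cavg (fun x => F x ^+ 2) t.
Proof.
move=> t0 iF iF2; set m := cavg F t.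
have : 0 <= cavg (fun x => F x ^+ 2 + (- 2 * m * F x + m ^+ 2)) t.
  by apply: cavg_ge0 => // x _; have := sqr_ge0 (F x - m); rewrite sqrrB; lra.
rewrite cavgD//; last by apply: cintD; [exact: cintZ|exact: cint_cst].
rewrite cavgD; [|exact: cintZ|exact: cint_cst].
by rewrite cavgZ// cavg_cst// -/m; lra.
Qed.

End cube_average.
#[global] Hint Resolve measurable_hc : core.

Section poincare.
Context {R : realType} {d : nat}.
Local Notation mu := (lebesgue_rV R d).
Local Notation node := ('rV[R]_d * R)%type.
Implicit Types (v w x e : 'rV[R]_d) (r : R) (t : node).
Variables (phi : 'rV[R]_d -> R) (L : R).
Hypothesis L0 : 0 < L.
Hypothesis phiL : forall x y, `|phi x - phi y| <= L * `|x - y|.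

(** The l^1 norm of the gradient is what increments along the axes produce; [sqr_gradsum_le] returns
    to the Euclidean norm at the price of a factor [d]. *)
Definition gradsum x : R := \sum_(i < d) `|'D_(delta_mx ord0 i) phi x|.

Let mphi : measurable_fun setT phi.
Proof. exact: measurable_lipschitz_rV phiL. Qed.

Let mD i : measurable_fun setT (fun x => `|'D_(delta_mx ord0 i) phi x|).
Proof.
apply: (measurableT_comp (@normr_measurable R setT)).
exact: measurable_derive_lipschitz phiL _.
Qed.

Lemma measurable_gradsum : measurable_fun setT gradsum.
Proof. by apply: measurable_sum => i; exact: mD. Qed.

Lemma gradsum_ge0 x : 0 <= gradsum x.
Proof. by apply: sumr_ge0 => i _. Qed.

Let norm_delta (i : 'I_d) : `|delta_mx ord0 i : 'rV[R]_d| <= 1.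
Proof.
apply: rV_norm_le => // j; rewrite mxE; case: (_ && _);
  by rewrite ?normr1 ?normr0.
Qed.

Lemma gradsum_le x : gradsum x <= d%:R * L.
Proof.
apply: (@le_trans _ _ (\sum_(i < d) L)).
  apply: ler_sum => i _; apply: (le_trans (norm_derive_lipschitz L0 phiL _ _)).
  by rewrite ler_piMr ?(ltW L0).
by rewrite sumr_const card_ord mulr_natl.
Qed.

Lemma cint_gradsum t : 0 < t.2 -> cint t gradsum.
Proof.
move=> t0; apply: (le_cint measurable_gradsum _ (cint_cst (d%:R * L) t0)) => x _.
by rewrite ger0_norm ?gradsum_ge0// gradsum_le.
Qed.

Lemma hc_norm_lt t x y : 0 < t.2 -> hc t x -> hc t y -> `|x - y| <= t.2.
Proof.
move=> t0 tx ty; apply: rV_norm_le => [|i]; first exact: ltW.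
have /andP[x1 x2] := tx i; have /andP[y1 y2] := ty i.
by rewrite !mxE ler_norml; apply/andP; split; lra.
Qed.

Let partial e (k : nat) : 'rV[R]_d := \sum_(i < d | (i < k)%N) e ord0 i *: delta_mx ord0 i.

Let partialE e k j : partial e k ord0 j = if (j < k)%N then e ord0 j else 0.
Proof.
rewrite /partial summxE; case: ifPn => jk.
  rewrite (bigD1 j)//= !mxE !eqxx mulr1 big1 ?addr0// => i /andP[_ ij].
  by rewrite !mxE eq_sym (negbTE ij) andbF mulr0.
rewrite big1// => i ik; rewrite !mxE eqxx/=; case: eqP => [ji|_]; last by rewrite mulr0.
by move: jk; rewrite ji ik.
Qed.

(** The translation that carries the corner half to the half [b] is performed one axis at a time.
    Every intermediate translate stays in [hcube v r], since each coordinate moves by at most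
    [r / 2]. *)
Lemma integral_increment_subcube v r b : 0 < r ->
  (\int[mu]_(x in hcube v (r / 2))
     `|phi (x + (r / 2) *: \row_i (b i : bool)%:R)%R - phi x|%:E <=
   (r / 2)%:E * \int[mu]_(x in hcube v r) (gradsum x)%:E)%E.
Proof.
move=> r0; set e := (r / 2) *: _.
have eb i : e ord0 i = r / 2 * (b i)%:R by rewrite !mxE.
have r20 : 0 < r / 2 by rewrite divr_gt0.
have mshift a : measurable_fun setT (fun x => phi (x + a)).
  by apply: (measurableT_comp mphi); exact: measurable_rVD.
pose T (k : 'I_d) x := `|phi (x + partial e k + e ord0 k *: delta_mx ord0 k) - phi (x + partial e k)|.
have mT k : measurable_fun setT (T k).
  apply: (measurableT_comp (@normr_measurable R setT)); apply: measurable_funB => //.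
  rewrite (_ : (fun x => _) =
    fun x => phi (x + (partial e k + e ord0 k *: delta_mx ord0 k)))//.
  by apply/funext => x; rewrite addrA.
apply: (@le_trans _ _ (\int[mu]_(x in hcube v (r / 2)) \sum_(k < d) (T k x)%:E)%E).
  apply: ge0_le_integral => //.
  - exact: measurable_hcube.
  - apply: measurable_funTS; apply/measurable_EFinP.
    apply: (measurableT_comp (@normr_measurable R setT)).
    exact: measurable_funB.
  - apply: measurable_funTS; apply: emeasurable_sum => k.
    by apply/measurable_EFinP.
  move=> x _; rewrite sumEFin lee_fin coord_increment_sum.
  apply: (le_trans (ler_norm_sum _ _ _)); apply: ler_sum => k _.
  rewrite /T -addrA (_ : \sum_(i < d | (i <= k)%N) _ =
    partial e k + e ord0 k *: delta_mx ord0 k)//.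
  rewrite (bigD1 k)//= addrC; congr (_ + _); apply: eq_bigl => i.
  by rewrite ltn_neqAle andbC.
rewrite ge0_integral_sum; [|exact: measurable_hcube
  |by move=> k; apply: measurable_funTS; apply/measurable_EFinP; exact: mT
  |by move=> k x _; rewrite lee_fin normr_ge0].
rewrite (_ : (\int[mu]_(x in hcube v r) _)%E = (\sum_(k < d)
    \int[mu]_(x in hcube v r) `|'D_(delta_mx ord0 k) phi x|%:E)%E); last first.
  under eq_integral do rewrite -sumEFin.
  by rewrite ge0_integral_sum; [|exact: measurable_hcube
  |by move=> k; apply: measurable_funTS; apply/measurable_EFinP; exact: mD
  |by move=> k x _; rewrite lee_fin].
rewrite ge0_sume_distrr; last by move=> k _; apply: integral_ge0 => x _; rewrite lee_fin.
apply: lee_sum => k _.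
have ek0 : 0 <= e ord0 k by rewrite eb mulr_ge0 ?ler0n// ltW.
have ekr : e ord0 k <= r / 2 by rewrite eb; case: (b k) => /=; lra.
apply: (@le_trans _ _ ((e ord0 k)%:E *
    \int[mu]_(x in hcube v r) `|'D_(delta_mx ord0 k) phi x|%:E)%E); last first.
  by rewrite lee_wpmul2r ?lee_fin//; apply: integral_ge0 => x _; rewrite lee_fin.
have := @integral_increment_hcube R d phi L L0 phiL v r (v + partial e k) (r / 2)
  (delta_mx ord0 k) (e ord0 k) ek0 (norm_delta k).
rewrite integral_hcube_shift; last first.
  apply/measurable_EFinP; apply: (measurableT_comp (@normr_measurable R setT)).
  exact: measurable_funB.
apply=> x xw u /andP[u0 ue] i; have := xw i; rewrite !mxE partialE eqxx/= eb.
have [->|ik] := eqVneq i k; first by rewrite ltnn mulr1n => /andP[? ?]; apply/andP; split; lra.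
rewrite mulr0 addr0.
by case: ifP => _; case: (b i) => /= /andP[? ?]; apply/andP; split; lra.
Qed.

Let subcornerE v r b : subcorner v r b = v + (r / 2) *: \row_i (b i)%:R.
Proof. by []. Qed.

(** The half that shares the corner of its parent; all the others are its translates and are
    compared with it. *)
Let b0 : {ffun 'I_d -> bool} := [ffun=> false].

Let subcorner0 v r : subcorner v r b0 = v.
Proof. by apply/rowP => i; rewrite !mxE ffunE mulr0 addr0. Qed.

Lemma cint_lipschitz t : 0 < t.2 -> cint t phi.
Proof.
move=> t0.
apply: (le_cint mphi _ (cint_cst (`|phi t.1| + L * t.2) t0)) => x tx.
have t1 : hc t t.1 by move=> i; rewrite lexx ltrDl.
rewrite -[phi x](subrK (phi t.1)) addrC; apply: (le_trans (ler_normD _ _)).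
rewrite lerD2l; apply: (le_trans (phiL _ _)).
by rewrite ler_wpM2l ?(ltW L0)//; exact: hc_norm_lt tx t1.
Qed.

Lemma cavg_child0 t b : 0 < t.2 ->
  `|cavg phi (hchild t b) - cavg phi (hchild t b0)| <=
  2 ^+ d / 2 * t.2 * cavg gradsum t.
Proof.
case: t => v r /= r0.
have r20 : 0 < r / 2 by rewrite divr_gt0.
pose e : 'rV[R]_d := (r / 2) *: \row_i (b i)%:R.
have rd : 0 < r ^+ d by rewrite exprn_gt0.
have r2d : 0 < (r / 2) ^+ d by rewrite exprn_gt0.
have mpe : measurable_fun setT (fun x => phi (x + e)).
  by apply: (measurableT_comp mphi); exact: measurable_rVD.
have ip : cint (v, r / 2) phi by exact: cint_lipschitz.
have mT : measurable_fun setT (fun x => `|phi (x + e) - phi x|).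
  apply: (measurableT_comp (@normr_measurable R setT)).
  exact: measurable_funB.
have iT : cint (v, r / 2) (fun x => `|phi (x + e) - phi x|).
  apply: (le_cint mT _ (cint_cst (L * `|e|) _)) => // x _.
  by rewrite normr_id; apply: (le_trans (phiL _ _)); rewrite addrAC subrr add0r.
have mB : measurable_fun setT (fun x => phi (x + e) - phi x) by exact: measurable_funB.
have iB : cint (v, r / 2) (fun x => phi (x + e) - phi x).
  by apply: (le_cint mB _ iT).
have ipe : cint (v, r / 2) (fun x => phi (x + e)).
  rewrite (_ : (fun x => _) = fun x => phi (x + e) - phi x + phi x).
    exact: cintD.
  by apply/funext => x; rewrite subrK.
have -> : cavg phi (hchild (v, r) b) = cavg (fun x => phi (x + e)) (v, r / 2).
  rewrite /cavg /Rintegral /hc/= subcornerE integral_hcube_shift//.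
  exact/measurable_EFinP.
have -> : cavg phi (hchild (v, r) b0) = cavg phi (v, r / 2).
  by rewrite /cavg /hc/= subcorner0.
have -> : cavg (fun x => phi (x + e)) (v, r / 2) - cavg phi (v, r / 2) =
    cavg (fun x => phi (x + e) - phi x) (v, r / 2).
  by rewrite /cavg -mulrBl (RintegralB (measurable_hc _) ipe ip).
(* The factor [2 ^+ d] comes from normalising by the volume of the half instead of that of the
   parent. *)
have -> : 2 ^+ d / 2 * r * cavg gradsum (v, r) =
    (r / 2 * \int[mu]_(x in hc (v, r)) gradsum x) / (r / 2) ^+ d.
  rewrite /cavg /= expr_div_n; field.
  by rewrite (gt_eqF rd) andbT expf_neq0// pnatr_eq0.
rewrite /cavg normrM normfV (ger0_norm (ltW r2d)) ler_pM2r ?invr_gt0//.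
apply: (le_trans (le_normr_Rintegral (measurable_hc _) iB)).
have := integral_increment_subcube v b r0.
move=> H; rewrite -lee_fin [leRHS]EFinM -(cint_Rintegral iT).
by rewrite -(cint_Rintegral (@cint_gradsum (v, r) r0)).
Qed.

(** The average over the parent is the mean of the averages over the halves, so both terms are
    compared with the half [b0] and the bound of [cavg_child0] is used twice. *)
Lemma cavg_child_step t b : 0 < t.2 ->
  `|cavg phi (hchild t b) - cavg phi t| <= 2 ^+ d * t.2 * cavg gradsum t.
Proof.
move=> t0.
have mt := cavg_martingale (cint_lipschitz t0) mphi (subnode_refl t0).
pose A := cavg phi (hchild t b0).
have h c := cavg_child0 c t0.
set K := 2 ^+ d / 2 * t.2 * cavg gradsum t in h.
have hA : `|cavg phi t - A| <= K.
  rewrite -mt -[A](child_avg_cst hchild card_hchild_gt0 A t).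
  rewrite /child_avg -mulrBr -sumrB normrM normfV (ger0_norm (ler0n _ _)).
  apply: (@le_trans _ _ (#|{: {ffun 'I_d -> bool}}|%:R^-1 *
    \sum_(c : {ffun 'I_d -> bool}) K)).
    rewrite ler_wpM2l ?invr_ge0 ?ler0n//.
    by apply: (le_trans (ler_norm_sum _ _ _)); apply: ler_sum => c _; exact: h.
  by have /= := child_avg_cst hchild card_hchild_gt0 K t; rewrite /child_avg => ->.
apply: (le_trans (ler_distD A _ _)); rewrite (distrC A).
apply: (le_trans (lerD (h b) hA)).
by rewrite (_ : K + K = 2 ^+ d * t.2 * cavg gradsum t)// /K; field.
Qed.

End poincare.

(** * Weighted Poincare inequality *)

Lemma mulr_le_weighted_sqr {R : realFieldType} (lam A B : R) : 0 < lam ->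
  0 <= A -> 0 <= B -> A * B <= lam * A ^+ 2 + lam^-1 * B ^+ 2.
Proof.
move=> lam0 A0 B0; have lamV : 0 < lam^-1 by rewrite invr_gt0.
have : 0 <= lam^-1 * (lam * A - B) ^+ 2 by rewrite mulr_ge0 ?sqr_ge0// ltW.
have -> : lam^-1 * (lam * A - B) ^+ 2 = lam * A ^+ 2 + lam^-1 * B ^+ 2 - 2 * (A * B).
  by field; rewrite gt_eqF.
have := mulr_ge0 A0 B0; lra.
Qed.

(** The weight [2 * c] is the one for which [z] has coefficient 1/2 on the right. *)
Lemma absorb_half {R : realFieldType} (c z w : R) : 0 < c ->
  z <= c * (2 * c * w + (2 * c)^-1 * z) -> z <= (2 * c) ^+ 2 * w.
Proof.
move=> c0.
have -> : c * (2 * c * w + (2 * c)^-1 * z) = 2 * c ^+ 2 * w + z / 2.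
  by field; rewrite gt_eqF.
by lra.
Qed.

Lemma weighted_bump {R : realFieldType} (l G K eta A B X Y lam : R) :
  0 <= l -> 0 <= G -> 0 <= K -> 0 <= A -> 0 <= B -> 0 <= eta -> 0 < lam ->
  G <= A * X -> K <= B * Y -> l * Y * X <= eta ->
  l * G * K <= eta * (lam * A ^+ 2 + lam^-1 * B ^+ 2).
Proof.
move=> l0 G0 K0 A0 B0 eta0 lam0 hg hk hA.
have AB0 : 0 <= A * B by exact: mulr_ge0.
apply: (@le_trans _ _ (l * (A * X) * (B * Y))).
  exact: (ler_pM (mulr_ge0 l0 G0) K0 (ler_wpM2l l0 hg) hk).
rewrite [leLHS](_ : _ = (l * Y * X) * (A * B)); last by ring.
have : A * B <= lam * A ^+ 2 + lam^-1 * B ^+ 2 by exact: mulr_le_weighted_sqr.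
move=> le; apply: (le_trans (ler_wpM2r AB0 hA)).
exact: ler_wpM2l.
Qed.

Section weighted_poincare.
Context {R : realType} {d : nat}.
Local Notation mu := (lebesgue_rV R d).
Local Notation node := ('rV[R]_d * R)%type.
Implicit Types (v w x e : 'rV[R]_d) (r : R) (t : node).
Variables (phi : 'rV[R]_d -> R) (L : R).
Hypothesis L0 : 0 < L.
Hypothesis phiL : forall x y, `|phi x - phi y| <= L * `|x - y|.
Local Notation g := (gradsum phi).

Let mphi : measurable_fun setT phi.
Proof. exact: measurable_lipschitz_rV phiL. Qed.

Variable t0 : node.
Hypothesis t00 : 0 < t0.2.
Local Notation P := (subnode t0).

Let cintP t F : P t -> cint t0 F -> cint t F.
Proof. exact: cint_sub. Qed.

Let ig : cint t0 g.
Proof. exact: (cint_gradsum L0 phiL t00). Qed.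

Let iphi : cint t0 phi.
Proof. exact: (cint_lipschitz L0 phiL t00). Qed.

Let mg : measurable_fun setT g.
Proof. exact: (measurable_gradsum L0 phiL). Qed.

Section oscillation.
Variable k : 'rV[R]_d -> R.
Hypothesis mk : measurable_fun setT k.
Hypothesis k0 : forall x, 0 <= k x.
Hypothesis ik : cint t0 k.

Let osc t x := `|phi x - cavg phi t| * k x.

Let mosc t : measurable_fun setT (osc t).
Proof.
apply: measurable_funM => //; apply: (measurableT_comp (@normr_measurable R setT)).
exact: measurable_funB.
Qed.

Lemma lipschitz_cavg t x : 0 < t.2 -> hc t x -> `|phi x - cavg phi t| <= L * t.2.
Proof.
move=> t20 tx.
have it : cint t phi by exact: (cint_lipschitz L0 phiL t20).
have bd y : hc t y -> `|phi x - phi y| <= L * t.2.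
  move=> ty; apply: (le_trans (phiL _ _)); rewrite ler_wpM2l ?(ltW L0)//.
  exact: hc_norm_lt tx ty.
rewrite distrC ler_distl; apply/andP; split.
  rewrite -(cavg_cst (phi x - L * t.2) t20); apply: le_cavg => //; first exact: cint_cst.
  by move=> y /bd; rewrite ler_distl => /andP[? ?]; lra.
rewrite -(cavg_cst (phi x + L * t.2) t20); apply: le_cavg => //; first exact: cint_cst.
by move=> y /bd; rewrite ler_distl => /andP[? ?]; lra.
Qed.

Let iosc t : P t -> cint t (osc t).
Proof.
move=> Pt; have it := cintP Pt ik; have [t20 _] := Pt.
apply: (le_cint (mosc t) _ (cintZ (L * t.2) it)) => x tx.
rewrite ger0_norm ?mulr_ge0// ler_wpM2r//.
exact: lipschitz_cavg.
Qed.

(** Replacing the average of [phi] on the parent by that on a child costs one term of the tree sum.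
    The sum stops at generation [N], where the oscillation of [phi] is at most [L] times the side;
    this is the last term. *)
Lemma oscillation_treesum N t : P t ->
  cavg (osc t) t <=
  2 ^+ d * treesum hchild N (fun t => t.2 * cavg g t * cavg k t) t +
  L * t.2 / 2 ^+ N * cavg k t.
Proof.
elim: N t => [|N ih] t Pt; have it := cintP Pt ik; have [t20 _] := Pt.
  rewrite /= mulr0 add0r expr0 divr1 -cavgZ//.
  apply: le_cavg => // [| |x tx]; [exact: iosc|exact: cintZ|].
  by rewrite ler_wpM2r//; exact: lipschitz_cavg.
have mosct := cavg_martingale (iosc Pt) (mosc t) (subnode_refl t20).
have mkt := cavg_martingale it mk (subnode_refl t20).
set F := fun t => t.2 * cavg g t * cavg k t.
pose G t' := 2 ^+ d * treesum hchild N F t' +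
  (L * t.2 / 2 ^+ N.+1 + 2 ^+ d * t.2 * cavg g t) * cavg k t'.
have step b : cavg (osc t) (hchild t b) <= G (hchild t b).
  set c := hchild t b.
  have Pc : P c by exact: subnode_child.
  have ic := cintP Pc ik; have [c20 _] := Pc.
  pose K := `|cavg phi c - cavg phi t|.
  apply: (@le_trans _ _ (cavg (fun x => osc c x + K * k x) c)).
    apply: le_cavg => //.
    - have ts : subnode t c by exact: subnode_child (subnode_refl t20).
      exact: cint_sub ts (iosc Pt).
    - by apply: cintD; [exact: iosc|exact: cintZ].
    - by move=> x _; rewrite /osc -mulrDl ler_wpM2r// ler_distD.
  rewrite cavgD; [|exact: iosc|exact: cintZ].
  rewrite cavgZ//; apply: (le_trans (lerD (ih c Pc) (lexx _))).
  rewrite -/F /G -addrA lerD2l mulrDl exprS /=.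
  have ck0 : 0 <= cavg k c by exact: cavg_ge0.
  have -> : L * (t.2 / 2) / 2 ^+ N = L * t.2 / (2 * 2 ^+ N).
    by field; rewrite expf_neq0.
  rewrite lerD2l ler_wpM2r//; exact: (cavg_child_step L0 phiL).
have := ler_child_avg step; rewrite mosct /G child_avgD !child_avgZ mkt /=.
move/le_trans; apply; rewrite -/F /F.
by rewrite le_eqVlt; apply/orP; left; apply/eqP; ring.
Qed.

End oscillation.

Variables (h a : 'rV[R]_d -> R) (s eta : R).
Hypothesis s1 : 1 < s.
Hypothesis eta0 : 0 < eta.
Hypothesis mh : measurable_fun setT h.
Hypothesis ma : measurable_fun setT a.
Hypothesis h0 : forall x, 0 <= h x.
Hypothesis a0 : forall x, 0 <= a x.
Hypothesis apos : mu (hc t0 `&` [set x | a x = 0]) = 0.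
Hypothesis ihs : cint t0 (fun x => h x `^ s).
Hypothesis ias : cint t0 (fun x => (a x)^-1 `^ s).
Hypothesis iga : cint t0 (fun x => g x ^+ 2 * a x).
Hypothesis A2 : forall t, P t ->
  t.2 * cavg (fun x => h x `^ s) t `^ (2 * s)^-1 *
        cavg (fun x => (a x)^-1 `^ s) t `^ (2 * s)^-1 <= eta.

(** Hoelder's inequality with exponents [th] and [1 - th = (2 * s)^-1] splits [g] into [(g^2 a)^tau]
    and [a^-s], and [k] into [Z^tau] and [h^s]. The relation [tau * th = 1/2] restores the square
    roots, [q = 2 * th] is the power to which the averages of the first factors appear, and
    [tau * q = 1] lets Jensen's inequality return to the averages of [g^2 a] and [Z]. *)
Let th : R := 1 - (2 * s)^-1.
Let tau : R := s / (2 * s - 1).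
Let q : R := 2 - s^-1.

Definition weighted_poincare_cst : R := 2 ^+ d * (8 * doob_cst q).

Let s0 : 0 < s. Proof. by rewrite (lt_trans _ s1). Qed.

Let th01 : 0 < th < 1.
Proof.
have s1' := s1; have : 0 < (2 * s)^-1 by rewrite invr_gt0 mulr_gt0.
have : (2 * s)^-1 < 1 by rewrite invf_plt ?posrE ?mulr_gt0// invr1; lra.
by rewrite /th => ? ?; apply/andP; split; lra.
Qed.

Let tau01 : 0 < tau < 1.
Proof.
have s1' := s1; rewrite /tau divr_gt0//; try lra.
by rewrite ltr_pdivrMr ?mul1r; lra.
Qed.

Let q1 : 1 < q.
Proof.
have s1' := s1; have : s^-1 < 1 by rewrite invf_plt ?posrE// ?invr1//; lra.
by rewrite /q; lra.
Qed.

Let tauq : tau * q = 1.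
Proof. by have s1' := s1; rewrite /tau /q; field; apply/andP; split; apply/eqP; lra. Qed.

Let tauth : tau * th = 2^-1.
Proof. by have s1' := s1; rewrite /tau /th; field; apply/andP; split; apply/eqP; lra. Qed.

Let thE : (2 * s)^-1 = 1 - th.
Proof. by rewrite /th; lra. Qed.

Let th2 : th + th = q.
Proof. by have s1' := s1; rewrite /q /th; field; apply/eqP; lra. Qed.

Let C1 : R := weighted_poincare_cst.

Lemma weighted_poincare_cst_gt0 : 0 < weighted_poincare_cst.
Proof.
have q10 : 0 < q - 1 by rewrite subr_gt0.
have D0 : 0 < 2 `^ (q - 1) / (q - 1) by rewrite divr_gt0// powR_gt0.
by rewrite /weighted_poincare_cst /doob_cst mulr_gt0 ?exprn_gt0// mulr_gt0// mulr_gt0.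
Qed.

Let le_powR1 (y p : R) : 0 <= y -> 1 <= p -> y <= 1 + y `^ p.
Proof.
move=> y0 p1; have := powR_ge0 y p; have [|y1] := leP y 1; first lra.
have : y `^ 1 <= y `^ p by rewrite ler_powR// ltW.
by rewrite powRr1//; lra.
Qed.

Let powR_le1 (y p : R) : 0 <= y -> 0 <= p <= 1 -> y `^ p <= 1 + y.
Proof.
move=> y0 /andP[p0 p1]; have [y1|y1] := leP y 1.
  have : y `^ p <= 1 `^ p by rewrite ge0_ler_powR ?nnegrE.
  by rewrite powR1; lra.
have : y `^ p <= y `^ 1 by rewrite ler_powR// ltW.
by rewrite powRr1//; lra.
Qed.

Let sqr_powR (z : R) : 0 <= z -> (z ^+ 2) `^ 2^-1 = z.
Proof. by move=> z0; rewrite powR12_sqrt ?sqr_ge0// sqrtr_sqr ger0_norm. Qed.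

Let m : R := cavg phi t0.
Let psi x : R := `|phi x - m|.
(** With this weight the oscillation at the root, [psi * k], is the quantity [Z] to be estimated. *)
Let k x : R := psi x * h x.
Let W x : R := g x ^+ 2 * a x.
Let Z x : R := psi x ^+ 2 * h x.
Let F1 x : R := W x `^ tau.
Let F2 x : R := Z x `^ tau.

Let g0 x : 0 <= g x. Proof. exact: gradsum_ge0. Qed.
Let psi0 x : 0 <= psi x. Proof. exact: normr_ge0. Qed.
Let k0 x : 0 <= k x. Proof. exact: mulr_ge0. Qed.
Let W0 x : 0 <= W x. Proof. by rewrite mulr_ge0 ?sqr_ge0. Qed.
Let Z0 x : 0 <= Z x. Proof. by rewrite mulr_ge0 ?sqr_ge0. Qed.
Let F10 x : 0 <= F1 x. Proof. exact: powR_ge0. Qed.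
Let F20 x : 0 <= F2 x. Proof. exact: powR_ge0. Qed.

Let mpsi : measurable_fun setT psi.
Proof.
apply: (measurableT_comp (@normr_measurable R setT)); exact: measurable_funB.
Qed.
Let mkk : measurable_fun setT k. Proof. exact: measurable_funM. Qed.
Let mW : measurable_fun setT W.
Proof. by apply: measurable_funM => //; exact: measurable_funX. Qed.
Let mZ : measurable_fun setT Z.
Proof. by apply: measurable_funM => //; exact: measurable_funX. Qed.
Let mF1 : measurable_fun setT F1.
Proof. exact: (measurableT_comp (measurable_powR _)). Qed.
Let mF2 : measurable_fun setT F2.
Proof. exact: (measurableT_comp (measurable_powR _)). Qed.
Let mhs : measurable_fun setT (fun x => h x `^ s).
Proof. exact: (measurableT_comp (measurable_powR _)). Qed.
Let mas : measurable_fun setT (fun x => (a x)^-1 `^ s).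
Proof.
apply: (measurableT_comp (measurable_powR _)).
rewrite (_ : (fun x => _) = fun x => a x `^ (-1)).
  exact: (measurableT_comp (measurable_powR _)).
by apply/funext => x; rewrite powR_inv1.
Qed.

Let ih : cint t0 h.
Proof.
apply: (le_cint mh _ (cintD (cint_cst 1 t00) ihs)) => x _.
by rewrite ger0_norm// le_powR1// ltW.
Qed.

Let psi_le x : hc t0 x -> psi x <= L * t0.2.
Proof. exact: lipschitz_cavg. Qed.

Let ikk : cint t0 k.
Proof.
apply: (le_cint mkk _ (cintZ (L * t0.2) ih)) => x tx.
by rewrite ger0_norm// ler_wpM2r// psi_le.
Qed.

Let iZ : cint t0 Z.
Proof.
apply: (le_cint mZ _ (cintZ ((L * t0.2) ^+ 2) ih)) => x tx.
rewrite ger0_norm// ler_wpM2r// lerXn2r ?nnegrE//; last exact: psi_le.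
by rewrite mulr_ge0// ltW.
Qed.

Let iF (F : 'rV[R]_d -> R) : measurable_fun setT F -> (forall x, 0 <= F x) ->
  cint t0 F -> cint t0 (fun x => F x `^ tau).
Proof.
move=> mF F0 iF.
have mFt : measurable_fun setT (fun x => F x `^ tau).
  exact: (measurableT_comp (measurable_powR _)).
apply: (le_cint mFt _ (cintD (cint_cst 1 t00) iF)) => x _.
by have /andP[? ?] := tau01; rewrite ger0_norm ?powR_ge0// powR_le1// !ltW.
Qed.

(** The factors [a] and [a^-1] cancel. Where [a x = 0] the real inverse is 0 and the formula may
    fail, but [apos] makes this set null. *)
Let gE x : a x != 0 -> g x = F1 x `^ th * ((a x)^-1 `^ s) `^ (1 - th).
Proof.
move=> ax; have s1' := s1.
rewrite /F1 -!powRrM tauth (_ : s * (1 - th) = 2^-1); last first.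
  by rewrite /th; field; apply/eqP; lra.
rewrite -powRM// ?invr_ge0//; first by rewrite /W mulfK// sqr_powR.
Qed.

Let kE x : k x = F2 x `^ th * (h x `^ s) `^ (1 - th).
Proof.
have s1' := s1.
rewrite /F2 -!powRrM tauth (_ : s * (1 - th) = 2^-1); last first.
  by rewrite /th; field; apply/eqP; lra.
by rewrite -powRM// /Z -mulrA -expr2 -exprMn (sqr_powR (k0 x)).
Qed.

Let mprod (F G : 'rV[R]_d -> R) : measurable_fun setT F -> measurable_fun setT G ->
  measurable_fun setT (fun x => F x `^ th * G x `^ (1 - th)).
Proof.
by move=> mF mG; apply: measurable_funM; exact: (measurableT_comp (measurable_powR _)).
Qed.

Let cavg_g_le t : P t ->
  cavg g t <= cavg F1 t `^ th * cavg (fun x => (a x)^-1 `^ s) t `^ (1 - th).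
Proof.
move=> Pt; have [t20 ts] := Pt.
have iF1 := cintP Pt (iF mW W0 iga); have ia := cintP Pt ias.
have as0 x : 0 <= (a x)^-1 `^ s by exact: powR_ge0.
apply: le_trans (hoelder_cavg t20 th01 F10 as0 mF1 mas iF1 ia).
rewrite le_eqVlt; apply/orP; left; apply/eqP.
rewrite /cavg /Rintegral; congr (fine _ / _).
apply: ae_eq_integral; first exact: measurable_hc.
- by apply: measurable_funTS; apply/measurable_EFinP.
- by apply: measurable_funTS; apply/measurable_EFinP; exact: mprod.
exists (hc t0 `&` [set x | a x = 0]); split => //.
  apply: measurableI; first exact: measurable_hc.
  rewrite -[X in measurable X]setTI.
  exact: (ma measurableT (measurable_set1 0)).
move=> x /= /not_implyP[tx]; have [ax _|ax H] := eqVneq (a x) 0.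
  by split => //; exact: ts.
by exfalso; apply: H; rewrite -gE.
Qed.

Let cavg_k_le t : P t ->
  cavg k t <= cavg F2 t `^ th * cavg (fun x => h x `^ s) t `^ (1 - th).
Proof.
move=> Pt; have [t20 ts] := Pt.
have iF2 := cintP Pt (iF mZ Z0 iZ); have ih' := cintP Pt ihs.
have hs0 x : 0 <= h x `^ s by exact: powR_ge0.
apply: le_trans (hoelder_cavg t20 th01 F20 hs0 mF2 mhs iF2 ih').
by rewrite le_eqVlt; apply/orP; left; apply/eqP; congr (cavg _ t); apply/funext => x; exact: kE.
Qed.

Let thD (A : R) : 0 <= A -> A `^ q = (A `^ th) ^+ 2.
Proof.
move=> A0; rewrite -th2 powRD ?expr2//; apply/implyP => /eqP.
by have := q1; rewrite -th2; lra.
Qed.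

Let bump lam t : 0 < lam -> P t ->
  t.2 * cavg g t * cavg k t <=
  eta * (lam * cavg F1 t `^ q + lam^-1 * cavg F2 t `^ q).
Proof.
move=> lam0 Pt; have [t20 ts] := Pt.
have G0 : 0 <= cavg g t by exact: cavg_ge0.
have K0 : 0 <= cavg k t by exact: cavg_ge0.
have c1 : 0 <= cavg F1 t by exact: cavg_ge0.
have c2 : 0 <= cavg F2 t by exact: cavg_ge0.
have hg := cavg_g_le Pt; have hk := cavg_k_le Pt; have hA := A2 Pt.
rewrite [(2 * s)^-1]thE in hA; rewrite (thD c1) (thD c2).
exact: (weighted_bump (ltW t20) G0 K0 (powR_ge0 _ _) (powR_ge0 _ _) (ltW eta0) lam0 hg hk hA).
Qed.

(** Since [tau * q = 1], Jensen's inequality bounds each term by the average of [F] over the small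
    cube, and these averages form a martingale. *)
Let leaf (F : 'rV[R]_d -> R) N : measurable_fun setT F -> (forall x, 0 <= F x) ->
  cint t0 F ->
  avgN hchild N (fun t => cavg (fun x => F x `^ tau) t `^ q) t0 <= cavg F t0.
Proof.
move=> mF F0 iF'.
have mm := cavg_martingale iF' mF.
rewrite -(avgN_martingale (@subnode_child _ _ _) N mm (subnode_refl t00)).
apply: (ler_avgN (@subnode_child _ _ t0)); first exact: subnode_refl.
move=> t Pt; have [t20 _] := Pt.
have c0 : 0 <= cavg F t by exact: cavg_ge0.
have J := jensen_cavg t20 tau01 F0 mF (cintP Pt iF').
apply: (@le_trans _ _ ((cavg F t `^ tau) `^ q)).
  rewrite ge0_ler_powR ?nnegrE ?powR_ge0//; first by rewrite ltW// (lt_trans _ q1).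
  by apply: cavg_ge0 => // x _; exact: powR_ge0.
by rewrite -powRrM tauq powRr1.
Qed.

Let absorb lam : 0 < lam ->
  cavg Z t0 <= C1 * eta * (lam * cavg W t0 + lam^-1 * cavg Z t0).
Proof.
move=> lam0; apply/ler_addgt0Pr => e e0.
pose c := L * t0.2 * cavg k t0.
have ck0 : 0 <= cavg k t0 by exact: cavg_ge0.
have c0 : 0 <= c by exact: (mulr_ge0 (mulr_ge0 (ltW L0) (ltW t00)) ck0).
(* From [n < 2^n], this generation is deep enough for the remainder of [oscillation_treesum] to be
   at most [e]. *)
pose N := Num.truncn (c / e).
have Ne : c / 2 ^+ N <= e.
  rewrite ler_pdivrMr ?exprn_gt0// mulrC -ler_pdivrMr//.
  apply: (le_trans (ltW (truncnS_gt _))).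
  by rewrite -natrX ler_nat ltn_expl.
have Pt0 := subnode_refl t00.
have := oscillation_treesum mkk k0 ikk N Pt0.
have -> : cavg (fun x => `|phi x - cavg phi t0| * k x) t0 = cavg Z t0.
  by congr (cavg _ t0); apply/funext => x; rewrite /k mulrA -expr2.
move/le_trans; apply; apply: lerD; last first.
  by rewrite mulrAC.
have lamt : 0 <= lam `^ tau by exact: powR_ge0.
have lamVt : 0 <= lam^-1 `^ tau by exact: powR_ge0.
(* The martingales are scaled by the power [tau] of the weights because their [q]-th powers are then
   scaled by the weights [lam] and [lam^-1] themselves. *)
have lamq (b A : R) : 0 <= b -> 0 <= A -> (b `^ tau * A) `^ q = b * A `^ q.
  by move=> b0 A0; rewrite powRM ?powR_ge0// -powRrM tauq powRr1.
have iF1 := iF mW W0 iga; have iF2 := iF mZ Z0 iZ.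
have lamV0 : 0 <= lam^-1 by rewrite invr_ge0 ltW.
have cF10 t : P t -> 0 <= cavg F1 t by move=> [t20 _]; exact: cavg_ge0.
have cF20 t : P t -> 0 <= cavg F2 t by move=> [t20 _]; exact: cavg_ge0.
have /= := @treesum_bilinear R node {ffun 'I_d -> bool} hchild P card_hchild_gt0
  (@subnode_child _ _ t0) q eta (fun t => t.2) (cavg g) (cavg k)
  (fun t => lam `^ tau * cavg F1 t) (fun t => lam^-1 `^ tau * cavg F2 t) q1 (ltW eta0).
have mart (F : 'rV[R]_d -> R) (b : R) : cint t0 F -> measurable_fun setT F ->
    martingale hchild P (fun t => b * cavg F t).
  by move=> iF' mF t Pt; rewrite child_avgZ (cavg_martingale iF' mF Pt).
move=> /(_ (fun t Pt => ltW Pt.1) (fun _ _ _ => erefl)).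
move=> /(_ (fun t Pt => cavg_ge0 Pt.1 (fun x _ => g0 x))).
move=> /(_ (fun t Pt => cavg_ge0 Pt.1 (fun x _ => k0 x))).
move=> /(_ (fun t Pt => mulr_ge0 lamt (cF10 t Pt))).
move=> /(_ (fun t Pt => mulr_ge0 lamVt (cF20 t Pt))).
move=> /(_ (cavg_martingale ig mg) (cavg_martingale ikk mkk)).
move=> /(_ (mart _ _ iF1 mF1) (mart _ _ iF2 mF2)).
have bmp t : P t -> t.2 * cavg g t * cavg k t <=
    eta * ((lam `^ tau * cavg F1 t) `^ q + (lam^-1 `^ tau * cavg F2 t) `^ q).
  move=> Pt; rewrite (lamq _ _ (ltW lam0) (cF10 _ Pt)) (lamq _ _ lamV0 (cF20 _ Pt)).
  exact: (bump lam0 Pt).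
move=> /(_ bmp N t0 Pt0) H.
have dq := doob_cst_ge0 q1.
have HE1 t : P t -> (lam `^ tau * cavg F1 t) `^ q <= lam * cavg F1 t `^ q.
  by move=> Pt; rewrite (lamq _ _ (ltW lam0) (cF10 _ Pt)).
have HE2 t : P t -> (lam^-1 `^ tau * cavg F2 t) `^ q <= lam^-1 * cavg F2 t `^ q.
  by move=> Pt; rewrite (lamq _ _ lamV0 (cF20 _ Pt)).
have E1 : avgN hchild N (fun t => (lam `^ tau * cavg F1 t) `^ q) t0 <=
    lam * cavg W t0.
  apply: (@le_trans _ _ (avgN hchild N (fun t => lam * cavg F1 t `^ q) t0)).
    exact: (@ler_avgN _ _ _ hchild P (@subnode_child _ _ t0) N _ _ t0 Pt0 HE1).
  rewrite avgNZ; exact: (ler_wpM2l (ltW lam0) (leaf N mW W0 iga)).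
have E2 : avgN hchild N (fun t => (lam^-1 `^ tau * cavg F2 t) `^ q) t0 <=
    lam^-1 * cavg Z t0.
  apply: (@le_trans _ _ (avgN hchild N (fun t => lam^-1 * cavg F2 t `^ q) t0)).
    exact: (@ler_avgN _ _ _ hchild P (@subnode_child _ _ t0) N _ _ t0 Pt0 HE2).
  rewrite avgNZ; exact: (ler_wpM2l lamV0 (leaf N mZ Z0 iZ)).
have d20 : 0 <= 2 ^+ d :> R by rewrite exprn_ge0.
rewrite (_ : C1 * eta = 2 ^+ d * (8 * doob_cst q * eta)); last first.
  by rewrite /C1 /weighted_poincare_cst !mulrA.
rewrite -[leRHS]mulrA; apply: (ler_wpM2l d20); apply: (le_trans H).
by apply: (ler_wpM2l _ (lerD E1 E2)); rewrite mulr_ge0 ?(ltW eta0)// mulr_ge0.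
Qed.

Lemma weighted_poincare :
  cavg (fun x => `|phi x - cavg phi t0| ^+ 2 * h x) t0 <=
  (2 * weighted_poincare_cst * eta) ^+ 2 * cavg (fun x => g x ^+ 2 * a x) t0.
Proof.
have c0 : 0 < C1 * eta by exact: mulr_gt0 weighted_poincare_cst_gt0 eta0.
have lam0 : 0 < 2 * (C1 * eta) by exact: mulr_gt0.
have H := absorb_half c0 (absorb lam0); rewrite [2 * (C1 * eta)]mulrA in H.
exact: H.
Qed.

End weighted_poincare.

Lemma sqr_le_double {R : realFieldType} (x m : R) : x ^+ 2 <= 2 * (x - m) ^+ 2 + 2 * m ^+ 2.
Proof.
have := sqr_ge0 (x - 2 * m).
have -> : (x - 2 * m) ^+ 2 = 2 * (x - m) ^+ 2 + 2 * m ^+ 2 - x ^+ 2 by ring.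
by lra.
Qed.

Section cube_estimate.
Context {R : realType} {d : nat}.
Local Notation mu := (lebesgue_rV R d).
Local Notation node := ('rV[R]_d * R)%type.

Lemma subnode_side (t0 t : node) : (0 < d)%N -> 0 < t0.2 -> subnode t0 t -> t.2 <= t0.2.
Proof.
move=> d0 t00 [t20 ts].
have : (mu (hc t) <= mu (hc t0))%E.
  by apply: le_measure => //; rewrite inE; exact: measurable_hc.
rewrite (mu_hc t20) (mu_hc t00) lee_fin.
by rewrite ler_pXn2r// nnegrE ltW.
Qed.

Lemma cint_ltyP (t : node) (F : 'rV[R]_d -> R) : measurable_fun setT F ->
  (forall x, 0 <= F x) ->
  (\int[mu]_(x in hc t) (F x)%:E = +oo)%E \/ cint t F.
Proof.
move=> mF F0; have [->|H] := eqVneq (\int[mu]_(x in hc t) (F x)%:E)%E (+oo)%E.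
  by left.
by right; apply: cint_ltey => //; rewrite ltey.
Qed.

(** From [phi^2 <= 2 (phi - m)^2 + 2 m^2] with [m] the average of [phi]: the first part is the
    weighted Poincare inequality, the second is bounded by [m^2 <= avg phi^2]. *)
Lemma cube_estimate (phi h a : 'rV[R]_d -> R) (L s eta : R) (t0 : node) :
  0 < L -> (forall x y, `|phi x - phi y| <= L * `|x - y|) ->
  0 < t0.2 -> 1 < s -> 0 < eta ->
  measurable_fun setT h -> measurable_fun setT a ->
  (forall x, 0 <= h x) -> (forall x, 0 <= a x) ->
  mu (hc t0 `&` [set x | a x = 0]) = 0%E ->
  cint t0 (fun x => h x `^ s) -> cint t0 (fun x => (a x)^-1 `^ s) ->
  (forall t, subnode t0 t ->
    t.2 * cavg (fun x => h x `^ s) t `^ (2 * s)^-1 *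
        cavg (fun x => (a x)^-1 `^ s) t `^ (2 * s)^-1 <= eta) ->
  (\int[mu]_(x in hc t0) (phi x ^+ 2 * h x)%:E <=
   (2 * (2 * weighted_poincare_cst (d := d) s * eta) ^+ 2)%:E *
     \int[mu]_(x in hc t0) (gradsum phi x ^+ 2 * a x)%:E +
   (2 * cavg h t0)%:E * \int[mu]_(x in hc t0) (phi x ^+ 2)%:E)%E.
Proof.
move=> L0 phiL t00 s1 eta0 mh ma h0 a0 apos ihs ias A2.
set c := 2 * _ ^+ 2.
have mphi : measurable_fun setT phi := measurable_lipschitz_rV L0 phiL.
have mg := measurable_gradsum L0 phiL.
have td : 0 < t0.2 ^+ d by rewrite exprn_gt0.
have ih : cint t0 h.
  apply: (le_cint mh _ (cintD (cint_cst 1 t00) ihs)) => x _.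
  rewrite ger0_norm//; have := powR_ge0 (h x) s; have [|x1] := leP (h x) 1; first by lra.
  have : h x `^ 1 <= h x `^ s by rewrite ler_powR// ltW.
  by rewrite powRr1//; lra.
have ch0 : 0 <= cavg h t0 by exact: cavg_ge0.
have iphi := cint_lipschitz L0 phiL t00.
set m := cavg phi t0.
have psiL x : hc t0 x -> `|phi x - m| <= L * t0.2 by exact: lipschitz_cavg.
have ibd (F : 'rV[R]_d -> R) (M : R) : measurable_fun setT F ->
    (forall x, hc t0 x -> `|F x| <= M) -> cint t0 F.
  by move=> mF FM; apply: (le_cint mF _ (cint_cst M t00)).
have phib x : hc t0 x -> `|phi x| <= L * t0.2 + `|m|.
  move=> tx; rewrite -[phi x](subrK m); apply: (le_trans (ler_normD _ _)).
  by rewrite lerD2r psiL.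
have Lt : 0 <= L * t0.2 by rewrite mulr_ge0// ltW.
have iphi2 : cint t0 (fun x => phi x ^+ 2).
  apply: (ibd _ ((L * t0.2 + `|m|) ^+ 2)); first exact: measurable_funX.
  move=> x tx; rewrite normrX lerXn2r ?nnegrE ?addr_ge0//; exact: phib.
have mZ : measurable_fun setT (fun x => `|phi x - m| ^+ 2 * h x).
  apply: measurable_funM => //; apply: measurable_funX.
  by apply: (measurableT_comp (@normr_measurable R setT)); exact: measurable_funB.
have iZ : cint t0 (fun x => `|phi x - m| ^+ 2 * h x).
  apply: (le_cint mZ _ (cintZ ((L * t0.2) ^+ 2) ih)) => x tx.
  rewrite ger0_norm ?mulr_ge0 ?sqr_ge0// ler_wpM2r// lerXn2r ?nnegrE//; exact: psiL.
have mphih : measurable_fun setT (fun x => phi x ^+ 2 * h x).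
  by apply: measurable_funM => //; exact: measurable_funX.
have iphih : cint t0 (fun x => phi x ^+ 2 * h x).
  apply: (le_cint mphih _ (cintZ ((L * t0.2 + `|m|) ^+ 2) ih)) => x tx.
  have p0 : 0 <= phi x ^+ 2 * h x by rewrite mulr_ge0 ?sqr_ge0.
  rewrite (ger0_norm p0) ler_wpM2r// -(real_normK (num_real (phi x))).
  by rewrite lerXn2r ?nnegrE ?addr_ge0//; exact: phib.
have c0 : 0 < c.
  apply: mulr_gt0 => //; apply: exprn_gt0; apply: mulr_gt0 => //.
  by apply: mulr_gt0 => //; exact: weighted_poincare_cst_gt0.
have mga : measurable_fun setT (fun x => gradsum phi x ^+ 2 * a x).
  by apply: measurable_funM => //; exact: measurable_funX.
have ga0 x : 0 <= gradsum phi x ^+ 2 * a x by rewrite mulr_ge0 ?sqr_ge0.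
(* The weighted Poincare inequality is about real averages; if the gradient term is infinite, so is
   the right side. *)
have [->|iga] := cint_ltyP t0 mga ga0.
  rewrite gt0_muley ?lte_fin// addye ?leey//.
  rewrite -ltNye; apply: (@lt_le_trans _ _ 0%E); first exact: ltNy0.
  apply: mule_ge0; first by rewrite lee_fin mulr_ge0.
  by apply: integral_ge0 => x _; rewrite lee_fin sqr_ge0.
rewrite (cavgE t00 iphih) (cavgE t00 iga) (cavgE t00 iphi2) -!EFinM -EFinD lee_fin.
rewrite (_ : c * _ + _ = t0.2 ^+ d * (c * cavg (fun x => gradsum phi x ^+ 2 * a x) t0 +
  2 * cavg h t0 * cavg (fun x => phi x ^+ 2) t0)); last by ring.
rewrite ler_pM2l//.
have wp := @weighted_poincare R d phi L L0 phiL t0 t00 h a s eta s1 eta0 mh ma h0 a0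
  apos ihs ias iga A2.
have m2 : m ^+ 2 <= cavg (fun x => phi x ^+ 2) t0 by exact: sqr_cavg_le.
apply: (@le_trans _ _ (2 * cavg (fun x => `|phi x - m| ^+ 2 * h x) t0 +
    2 * m ^+ 2 * cavg h t0)).
  rewrite -!cavgZ// -cavgD; [|exact: cintZ|exact: cintZ].
  apply: le_cavg => //; first by apply: cintD; exact: cintZ.
  move=> x _; rewrite (mulrA 2) -mulrDl ler_wpM2r// real_normK ?num_real//.
  exact: sqr_le_double.
rewrite lerD//.
  by rewrite /c -mulrA ler_wpM2l.
by rewrite mulrAC ler_wpM2l// mulr_ge0.
Qed.

End cube_estimate.

Section covering.
Context {R : realType} {d : nat}.
Local Notation mu := (lebesgue_rV R d).
Local Open Scope ereal_scope.

(** By additivity over the halves the estimate passes from cubes of side [l] to cubes of side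
    [2 * l]; finitely many doublings reach one cube outside which [F] vanishes. *)
Lemma covering (F A B : 'rV[R]_d -> \bar R) (r e k M : R) :
  (0 < r)%R -> (0 <= e)%R -> (0 <= k)%R ->
  measurable_fun setT F -> measurable_fun setT A -> measurable_fun setT B ->
  (forall x, 0 <= F x) -> (forall x, 0 <= A x) -> (forall x, 0 <= B x) ->
  (forall x, (M < `|x|)%R -> F x = 0) ->
  (forall v, \int[mu]_(x in hcube v r) F x <=
    e%:E * \int[mu]_(x in hcube v r) A x + k%:E * \int[mu]_(x in hcube v r) B x) ->
  \int[mu]_x F x <= e%:E * \int[mu]_x A x + k%:E * \int[mu]_x B x.
Proof.
move=> r0 e0 k0 mF mA mB F0 A0 B0 FM H.
have mc v l := @measurable_hcube R d v l.
have big n v : \int[mu]_(x in hcube v (r * 2 ^+ n)) F x <=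
    e%:E * \int[mu]_(x in hcube v (r * 2 ^+ n)) A x +
    k%:E * \int[mu]_(x in hcube v (r * 2 ^+ n)) B x.
  elim: n v => [|n ih] v; first by rewrite expr0 mulr1.
  have rn : (0 <= r * 2 ^+ n.+1)%R by rewrite mulr_ge0 ?exprn_ge0// ltW.
  have half : (r * 2 ^+ n.+1 / 2 = r * 2 ^+ n)%R by rewrite exprS; field.
  rewrite !ge0_integral_hcube//; try by apply: measurable_funTS.
  rewrite !ge0_sume_distrr; try by move=> b _; apply: integral_ge0.
  by rewrite -big_split/=; apply: lee_sum => b _; rewrite half.
have [n Mn] : exists n : nat, (2 * M < r * 2 ^+ n)%R.
  exists (Num.truncn (2 * M / r)); rewrite (mulrC r) -ltr_pdivrMr//.
  apply: (lt_le_trans (truncnS_gt _)).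
  by rewrite -natrX ler_nat ltn_expl.
pose l : R := (r * 2 ^+ n)%R.
pose v : 'rV[R]_d := (\row__ (- (l / 2)))%R.
have FE : \int[mu]_x F x = \int[mu]_(x in hcube v l) F x.
  rewrite [RHS]integral_mkcond; apply: eq_integral => x _; rewrite patchE.
  case: ifPn => //; rewrite notin_setE => xv; apply: FM; rewrite ltNge.
  apply/negP => xM; apply: xv => i; rewrite !mxE.
  have : (`|x ord0 i| <= M)%R.
    apply: le_trans xM; rewrite (_ : `|x|%R = mx_norm x)// mx_normrE.
    exact: (le_trans _ (le_bigmax _ _ (ord0, i))).
  rewrite ler_norml => /andP[? ?].
  by apply/andP; split; rewrite /l in Mn *; lra.
rewrite FE; apply: (le_trans (big n v)); apply: leeD; apply: lee_wpmul2l;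
  rewrite ?lee_fin//; apply: ge0_subset_integral => //; exact: measurable_funTS.
Qed.

End covering.

(** * Riesz potentials *)

Section euclidean.
Context {R : realType} {d : nat}.
Implicit Types (v w z e : 'rV[R]_d).

Lemma edot_ge0 v : 0 <= edot v v.
Proof. by apply: sumr_ge0 => i _; rewrite -expr2 sqr_ge0. Qed.

Lemma enorm_ge0 v : 0 <= enorm v.
Proof. exact: sqrtr_ge0. Qed.

Lemma sqr_enorm v : enorm v ^+ 2 = edot v v.
Proof. by rewrite sqr_sqrtr// edot_ge0. Qed.

Lemma coord_le_norm v i : `|v ord0 i| <= `|v|.
Proof.
rewrite [leRHS](_ : _ = mx_norm v)// mx_normrE.
exact: (le_trans _ (le_bigmax _ _ (ord0, i))).
Qed.

Lemma coord_le_enorm v i : `|v ord0 i| <= enorm v.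
Proof.
rewrite -sqrtr_sqr ler_wsqrtr// /edot (bigD1 i)//= -expr2 lerDl.
by apply: sumr_ge0 => j _; rewrite -expr2 sqr_ge0.
Qed.

Lemma norm_le_enorm v : `|v| <= enorm v.
Proof. by apply: rV_norm_le; [exact: enorm_ge0|exact: coord_le_enorm]. Qed.

Lemma sqr_enorm_le v : enorm v ^+ 2 <= d%:R * `|v| ^+ 2.
Proof.
rewrite sqr_enorm; apply: (@le_trans _ _ (\sum_(i < d) `|v| ^+ 2)).
  apply: ler_sum => i _; rewrite -expr2 -(real_normK (num_real (v ord0 i))).
  by rewrite lerXn2r ?nnegrE//; exact: coord_le_norm.
by rewrite sumr_const card_ord mulr_natl.
Qed.

Lemma sqr_enormD_le v w : enorm (v + w) ^+ 2 <= 2 * enorm v ^+ 2 + 2 * enorm w ^+ 2.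
Proof.
rewrite !sqr_enorm /edot !mulr_sumr -big_split/=; apply: ler_sum => i _.
rewrite !mxE; have := sqr_ge0 (v ord0 i - w ord0 i); nra.
Qed.

Lemma bracket_gt0 v : 0 < bracket v.
Proof. by rewrite sqrtr_gt0 ltr_pwDl// sqr_ge0. Qed.

Lemma sqr_bracket v : bracket v ^+ 2 = 1 + enorm v ^+ 2.
Proof. by rewrite sqr_sqrtr// addr_ge0// sqr_ge0. Qed.

Lemma sqr_bracket_le v w : bracket v ^+ 2 <= 2 * bracket w ^+ 2 + 2 * enorm (v - w) ^+ 2.
Proof.
rewrite !sqr_bracket; have := sqr_enormD_le (v - w) w; rewrite subrK; lra.
Qed.

End euclidean.

Section riesz.
Context {R : realType} {d : nat}.
Local Notation mu := (lebesgue_rV R d).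
Implicit Types (v w x : 'rV[R]_d) (r : R).

Lemma measurable_cube v r : measurable (cube v r).
Proof.
rewrite (_ : cube v r = \bigcap_(i in [set: 'I_d])
  ((fun w : 'rV[R]_d => w ord0 i) @^-1` `[v ord0 i, v ord0 i + r]%classic)).
  apply: fin_bigcap_measurable => [|i _]; first exact: finite_finset.
  rewrite -[X in measurable X]setTI; exact: measurable_coord.
by apply/seteqP; split => [w /= H i _ |w /= H i]; [rewrite /= in_itv; exact: H|
  have := H i Logic.I; rewrite /= in_itv].
Qed.

Lemma powR_exprn (x g : R) k : 0 <= x -> (x ^+ k) `^ g = (x `^ g) ^+ k.
Proof. by move=> x0; rewrite -(powR_mulrn k x0) -(powR_mulrn k (powR_ge0 x g)) -!powRrM mulrC. Qed.

Lemma ler_npowR (g a b : R) : g <= 0 -> 0 < a -> a <= b -> b `^ g <= a `^ g.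
Proof.
move=> g0 a0 ab; have b0 := lt_le_trans a0 ab.
rewrite -[g]opprK ![_ `^ (- - g)]powRN lef_pV2 ?posrE ?powR_gt0//.
by rewrite ge0_ler_powR ?nnegrE ?(ltW a0) ?(ltW b0)// oppr_ge0.
Qed.

Lemma powR_natD (x g : R) : 0 < x -> x `^ (d%:R + g) = x `^ g * x ^+ d.
Proof.
move=> x0; rewrite powRD; last by rewrite (gt_eqF x0) implybT.
by rewrite powR_mulrn 1?mulrC// ltW.
Qed.

Lemma geometric_sum_le (q : R) n : 0 <= q < 1 -> \sum_(k < n) q ^+ k <= (1 - q)^-1.
Proof.
move=> /andP[q0 q1]; have q1' : 0 < 1 - q by lra.
rewrite -[leRHS]mul1r ler_pdivlMr//.
by have := subrX1 q n; have := exprn_ge0 n q0; lra.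
Qed.

Local Notation dy r k := (r * 2^-1 ^+ k).
Local Notation ccube w l := (cube (w - const_mx l) (2 * l)).

Lemma in_ccube w l x : `|x - w| <= l -> ccube w l x.
Proof.
move=> xl i; have := le_trans (coord_le_norm (x - w) i) xl.
by rewrite !mxE ler_norml => /andP[? ?]; apply/andP; split; lra.
Qed.

(** Each dyadic shell in the sup distance to [w] is enlarged to a full cube, on which the kernel is
    replaced by its bound at the inner radius of the shell. The sup norm is below the Euclidean one,
    so the bound has the right direction for [g < 0]. *)
Lemma riesz_dyadic (g r : R) w x : 0 < r -> g < 0 ->
  ((enorm (x - w) `^ g)%:E <= (r `^ g)%:E +
   \sum_(k <oo) (dy r k.+1 `^ g * \1_(ccube w (dy r k)) x)%:E)%E.
Proof.
move=> r0 g0; have dy0 k : 0 < dy r k by rewrite mulr_gt0// exprn_gt0.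
have s0 k : (0 <= (dy r k.+1 `^ g * \1_(ccube w (dy r k)) x)%:E)%E.
  by rewrite lee_fin mulr_ge0// powR_ge0.
have S0 : (0 <= \sum_(k <oo) (dy r k.+1 `^ g * \1_(ccube w (dy r k)) x)%:E)%E.
  exact: nneseries_ge0.
(* At the singularity the kernel has the value 0, by the convention for a power of 0 with nonzero
   exponent. *)
have [xw|xw] := eqVneq x w.
  have -> : enorm (x - w) = 0.
    rewrite xw subrr /enorm /edot big1 ?sqrtr0// => i _; by rewrite mxE mul0r.
  by rewrite powR0 ?lt_eqF// adde_ge0// lee_fin powR_ge0.
have sg0 : 0 < `|x - w| by rewrite normr_gt0 subr_eq0.
have [rs|sr] := leP r `|x - w|.
  apply: (@le_trans _ _ (r `^ g)%:E).
    rewrite lee_fin; apply: ler_npowR => //; [exact: ltW|exact: le_trans (norm_le_enorm _)].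
  by rewrite leeDl// nneseries_ge0.
have ex : exists n, dy r n < `|x - w|.
  exists (Num.truncn (r / `|x - w|)); rewrite exprVn ltr_pdivrMr ?exprn_gt0//.
  rewrite mulrC -ltr_pdivrMr//; apply: (lt_le_trans (truncnS_gt _)).
  by rewrite -natrX ler_nat ltn_expl.
case: (ex_minnP ex) => -[|n] nP nmin; first by move: nP; rewrite expr0 mulr1 ltNge (ltW sr).
have xn : `|x - w| <= dy r n by rewrite leNgt; apply/negP => /nmin; rewrite ltnn.
apply: (@le_trans _ _ (dy r n.+1 `^ g * \1_(ccube w (dy r n)) x)%:E).
  rewrite lee_fin indicE mem_set; last exact: in_ccube.
  rewrite mulr1; apply: ler_npowR => //; first exact: ltW.
  by apply/ltW/(lt_le_trans nP)/norm_le_enorm.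
rewrite (le_trans (_ : _ <= \sum_(k <oo) (dy r k.+1 `^ g * \1_(ccube w (dy r k)) x)%:E)%E)//.
  apply: (@le_trans _ _ (\sum_(0 <= k < n.+1) (dy r k.+1 `^ g * \1_(ccube w (dy r k)) x)%:E)%E).
    by rewrite big_nat_recr//= leeDr// sume_ge0.
  exact: nneseries_lim_ge.
by rewrite leeDr// lee_fin powR_ge0.
Qed.

(** The term 1 is the part of the kernel at distance at least [r]. In the second term, [2 ^+ d]
    comes from the side [2 * l] of the enclosing cubes, the power of 1/2 from the inner radius, and
    the denominator from a geometric series, convergent for [g > - d]. *)
Definition riesz_cst (g : R) : R :=
  1 + 2 ^+ d * 2^-1 `^ g / (1 - 2^-1 `^ (d%:R + g)).

Lemma half_powR_lt1 (g : R) : - d%:R < g -> 0 <= (2^-1 : R) `^ (d%:R + g) < 1.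
Proof.
move=> g1; rewrite powR_ge0/=; have : 0 < d%:R + g by lra.
move=> p0; have : (2^-1 : R) `^ (d%:R + g) < 1 `^ (d%:R + g) by rewrite gt0_ltr_powR ?nnegrE//; lra.
by rewrite powR1.
Qed.

Lemma riesz_cst_gt0 (g : R) : - d%:R < g -> 0 < riesz_cst g.
Proof.
by move=> /half_powR_lt1/andP[_ q1]; rewrite ltr_pwDl// divr_ge0 ?subr_ge0 ?(ltW q1)//.
Qed.

Lemma riesz_local (g : R) : - d%:R < g < 0 -> forall v w r, 0 < r ->
  (\int[mu]_(x in hcube v r) (enorm (x - w) `^ g)%:E <=
   (riesz_cst g * r `^ (d%:R + g))%:E)%E.
Proof.
move=> /andP[g1 g0] v w r r0; have mc := @measurable_hcube R d v r.
have dy0 k : 0 < dy r k by rewrite mulr_gt0// exprn_gt0.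
have mk k : measurable_fun (hcube v r) (fun x => (dy r k.+1 `^ g * \1_(ccube w (dy r k)) x)%:E).
  apply/measurable_EFinP; apply: measurable_funTS; apply: measurable_funM => //.
  by apply: measurable_indic; exact: measurable_cube.
have k0 k x : (0 <= (dy r k.+1 `^ g * \1_(ccube w (dy r k)) x)%:E)%E.
  by rewrite lee_fin mulr_ge0// powR_ge0.
apply: (@le_trans _ _ (\int[mu]_(x in hcube v r) ((r `^ g)%:E +
   \sum_(k <oo) (dy r k.+1 `^ g * \1_(ccube w (dy r k)) x)%:E))%E).
  apply: ge0_le_integral => //.
  - by move=> x _; rewrite lee_fin powR_ge0.
  - apply/measurable_EFinP; apply: measurable_funTS.
    apply: (measurableT_comp (measurable_powR g)); apply: measurable_enorm.
    exact: measurable_rVB.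
  - apply: emeasurable_funD => //; exact: ge0_emeasurable_sum.
  - by move=> x _; exact: riesz_dyadic.
rewrite ge0_integralD//; last 3 first.
- by move=> x _; rewrite lee_fin powR_ge0.
- by move=> x _; rewrite nneseries_ge0.
- exact: ge0_emeasurable_sum.
rewrite integral_cst// [X in (_ * X)%E](lebesgue_rV_hcube v (ltW r0)).
rewrite integral_nneseries//.
pose A : R := r `^ (d%:R + g) * (2 ^+ d * 2^-1 `^ g).
pose q : R := 2^-1 `^ (d%:R + g).
have q01 := half_powR_lt1 g1.
have rE : r `^ g * r ^+ d = r `^ (d%:R + g).
  by rewrite powR_natD.
have term k : (\int[mu]_(x in hcube v r) (dy r k.+1 `^ g * \1_(ccube w (dy r k)) x)%:E <=
    (A * q ^+ k)%:E)%E.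
  apply: (@le_trans _ _ (\int[mu]_x (dy r k.+1 `^ g * \1_(ccube w (dy r k)) x)%:E)%E).
    apply: ge0_subset_integral => //; apply/measurable_EFinP; apply: measurable_funM => //.
    by apply: measurable_indic; exact: measurable_cube.
  under eq_integral do rewrite EFinM.
  rewrite ge0_integralZl//; last 2 first.
  - by apply/measurable_EFinP; apply: measurable_indic; exact: measurable_cube.
  - by rewrite lee_fin powR_ge0.
  rewrite integral_indic//; last exact: measurable_cube.
  have l0 : 0 <= 2 * dy r k by rewrite mulr_ge0// ltW.
  rewrite setIT [X in (_ * X)%E](lebesgue_rV_cube _ l0) -EFinM lee_fin.
  rewrite le_eqVlt; apply/orP; left; apply/eqP.
  rewrite powRM ?(ltW r0) ?exprn_ge0// powR_exprn// /A -rE /q.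
  rewrite powR_natD//.
  rewrite 3!exprMn exprS -2![2^-1 ^+ _ ^+ _]exprM (mulnC k d).
  ring.
apply: (@le_trans _ _ ((r `^ (d%:R + g))%:E + (A / (1 - q))%:E)%E).
  rewrite -rE EFinM; apply: leeD => //.
  apply: lime_le; first by apply: is_cvg_nneseries => n _ _; exact: integral_ge0.
  apply: nearW => n; rewrite big_mkord.
  apply: (@le_trans _ _ (\sum_(k < n) (A * q ^+ k)%:E)%E); first exact: lee_sum.
  rewrite sumEFin lee_fin -mulr_sumr ler_wpM2l ?geometric_sum_le//.
  by rewrite /A !mulr_ge0 ?powR_ge0 ?exprn_ge0.
rewrite -EFinD lee_fin /riesz_cst /A /q le_eqVlt; apply/orP; left; apply/eqP; ring.
Qed.

End riesz.

Section potential.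
Context {R : realType} {d : nat}.
Local Notation mu := (lebesgue_rV R d).
Implicit Types (v w x : 'rV[R]_d) (r g : R) (f : 'rV[R]_d -> R).
Local Open Scope ereal_scope.

Definition potential g f v : \bar R := \int[mu]_w (enorm (v - w) `^ g * f w)%:E.

Lemma measurable_kernel g f : measurable_fun setT f ->
  measurable_fun setT (fun p : 'rV[R]_d * 'rV[R]_d => (enorm (p.1 - p.2) `^ g * f p.2)%R).
Proof.
move=> mf; apply: measurable_funM; last exact: (measurableT_comp mf measurable_snd).
apply: (measurableT_comp (measurable_powR g)); apply: measurable_enorm.
by apply: measurable_rVB; [exact: measurable_fst|exact: measurable_snd].
Qed.

Lemma measurable_potential g f : density f -> measurable_fun setT (potential g f).
Proof.
move=> [mf f0]; have mk : measurable_fun setT (fun p : 'rV[R]_d * 'rV[R]_d =>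
    (enorm (p.1 - p.2) `^ g * f p.2)%:E).
  by apply/measurable_EFinP; exact: measurable_kernel.
apply: (measurable_fun_fubini_tonelli_F (m2 := mu) _ mk) => p.
by rewrite lee_fin mulr_ge0 ?powR_ge0.
Qed.

Lemma potential_ge0 g f v : density f -> 0 <= potential g f v.
Proof. by move=> [mf f0]; apply: integral_ge0 => w _; rewrite lee_fin mulr_ge0 ?powR_ge0. Qed.

(** Tonelli's theorem puts the integral over the cube on the kernel, whose bound does not depend on
    the position of the singularity [w]. *)
Lemma potential_hcube g f : density f -> (- d%:R < g < 0)%R -> forall v r, (0 < r)%R ->
  \int[mu]_(x in hcube v r) potential g f x <=
  (riesz_cst (d := d) g * r `^ (d%:R + g))%:E * mass f.
Proof.
move=> df g0 v r r0; have [mf f0] := df; have mc := @measurable_hcube R d v r.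
pose J (p : 'rV[R]_d * 'rV[R]_d) : \bar R :=
  ((enorm (p.1 - p.2) `^ g * f p.2) * \1_(hcube v r) p.1)%:E.
have mJ : measurable_fun setT J.
  apply/measurable_EFinP; apply: measurable_funM; first exact: measurable_kernel.
  by apply: (measurableT_comp _ measurable_fst); exact: measurable_indic.
have J0 p : 0 <= J p by rewrite lee_fin !mulr_ge0 ?powR_ge0.
have -> : \int[mu]_(x in hcube v r) potential g f x = \int[mu]_x \int[mu]_w J (x, w).
  rewrite integral_mkcond; apply: eq_integral => x _; rewrite patchE /J /=.
  case: ifPn => xv; rewrite indicE.
    by rewrite xv; apply: eq_integral => w _; rewrite mulr1.
  by rewrite (negbTE xv) integral0_eq// => w _; rewrite mulr0.
rewrite (fubini_tonelli (m1 := mu) (m2 := mu) _ mJ J0) /mass.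
have c0 : (0 <= riesz_cst (d := d) g * r `^ (d%:R + g))%R.
  have /andP[g1 _] := g0.
  by rewrite mulr_ge0 ?powR_ge0// ltW// riesz_cst_gt0.
have mfE : measurable_fun setT (fun w => (f w)%:E) by apply/measurable_EFinP.
rewrite -ge0_integralZl//; last by move=> w _; rewrite lee_fin.
apply: ge0_le_integral => //.
- by move=> w _; apply: integral_ge0.
- by apply: (measurable_fun_fubini_tonelli_G (m1 := mu) _ mJ J0).
- by apply: measurable_funeM.
move=> w _; rewrite (_ : \int[mu]_x J (x, w) =
    (f w)%:E * \int[mu]_(x in hcube v r) (enorm (x - w) `^ g)%:E).
  rewrite muleC; apply: lee_wpmul2r; first by rewrite lee_fin.
  exact: riesz_local.
have mk : measurable_fun setT (fun x => (enorm (x - w) `^ g)%:E).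
  apply/measurable_EFinP; apply: (measurableT_comp (measurable_powR g)).
  by apply: measurable_enorm; exact: measurable_rVB.
rewrite -ge0_integralZl ?lee_fin//; last 2 first.
- exact: measurable_funTS.
- by move=> x _; rewrite lee_fin powR_ge0.
rewrite [RHS]integral_mkcond; apply: eq_integral => x _; rewrite patchE /J /= indicE.
by case: ifPn => _; rewrite ?mulr1 ?mulr0// EFinM muleC.
Qed.

Lemma ae_ltey_hcube (F : 'rV[R]_d -> \bar R) : measurable_fun setT F -> (forall x, 0 <= F x) ->
  (forall v r, (0 < r)%R -> \int[mu]_(x in hcube v r) F x < +oo) ->
  {ae mu, forall x, F x < +oo}.
Proof.
move=> mF F0 H.
pose Q (n : nat) := hcube (const_mx (- n.+1%:R)%R : 'rV[R]_d) (2 * n.+1%:R).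
have Qae : {ae mu, forall x, forall n, Q n x -> F x \is a fin_num}.
  apply: ae_foralln => n; apply: integrable_ae; first exact: measurable_hcube.
  apply/integrableP; split; first exact: measurable_funTS.
  under eq_integral do rewrite gee0_abs//.
  by apply: H; rewrite mulr_gt0.
apply: filterS Qae => x Qx.
have : F x \is a fin_num.
  apply: (Qx (Num.truncn `|x|)) => i; rewrite !mxE.
  have := coord_le_norm x i; have := truncnS_gt `|x|; rewrite ler_norml => ? /andP[? ?].
  by apply/andP; split; lra.
by rewrite ge0_fin_numE.
Qed.

Lemma potential_ae_ltey g f : density f -> (- d%:R < g < 0)%R -> mass f < +oo ->
  {ae mu, forall x, potential g f x < +oo}.
Proof.
move=> df g0 fm; apply: ae_ltey_hcube.
- exact: measurable_potential.
- by move=> x; exact: potential_ge0.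
move=> v r r0; apply: (le_lt_trans (potential_hcube df g0 v r0)).
have /andP[g1 _] := g0.
by rewrite lte_mul_pinfty// lee_fin mulr_ge0 ?powR_ge0// ltW// riesz_cst_gt0.
Qed.

Lemma measurable_reaction (k g : R) f : density f ->
  measurable_fun setT (reaction k g f).
Proof.
move=> df; have [mf _] := df; rewrite /reaction; case: (g == _).
  exact/measurable_EFinP.
by apply: measurable_funeM; exact: measurable_potential.
Qed.

Lemma reaction_ge0 (k g : R) f v : (0 <= k)%R -> density f -> 0 <= reaction k g f v.
Proof.
move=> k0 df; rewrite /reaction; case: ifPn => _; first by rewrite lee_fin; case: df.
by rewrite mule_ge0 ?lee_fin//; exact: potential_ge0.
Qed.

(** In the bound, 1 is the mass of [f], which settles [g = -d], and the other term is the Riesz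
    bound, where [r <= 1] removes the power of [r]. *)
Lemma reaction_hcube (k g : R) f : (0 <= k)%R -> density f -> mass f = 1 ->
  (- d%:R <= g < 0)%R -> forall v r, (0 < r <= 1)%R ->
  \int[mu]_(x in hcube v r) reaction k g f x <=
  (1 + k * `|riesz_cst (d := d) g|)%:E.
Proof.
move=> k0 df f1 /andP[g1 g0] v r /andP[r0 r1]; have [mf f0] := df.
have mc := @measurable_hcube R d v r.
rewrite /reaction; have [_|gd] := eqVneq g (- d%:R)%R.
  apply: (@le_trans _ _ (mass f)).
    apply: ge0_subset_integral => //; first exact/measurable_EFinP.
    by move=> x _; rewrite lee_fin.
  by rewrite f1 lee_fin lerDl mulr_ge0.
have gd' : (- d%:R < g)%R by rewrite lt_def gd.
rewrite ge0_integralZl//; last 2 first.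
- by apply: measurable_funTS; exact: measurable_potential.
- by move=> x _; exact: potential_ge0.
have gg : (- d%:R < g < 0)%R by rewrite gd' g0.
apply: (@le_trans _ _ (k%:E * (riesz_cst (d := d) g * r `^ (d%:R + g))%:E)).
  apply: lee_wpmul2l; first by rewrite lee_fin.
  by apply: (le_trans (potential_hcube df gg v r0)); rewrite f1 mule1.
rewrite -EFinM lee_fin; apply: (@le_trans _ _ (k * `|riesz_cst (d := d) g|)%R); last first.
  by rewrite lerDr.
rewrite ler_wpM2l//; have K0 := riesz_cst_gt0 gd'; rewrite (gtr0_norm K0) ler_piMr ?(ltW K0)//.
have p0 : (0 <= d%:R + g)%R by have := gd'; lra.
have : (r `^ (d%:R + g) <= 1 `^ (d%:R + g))%R.
  by rewrite ge0_ler_powR ?nnegrE// ltW.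
by rewrite powR1.
Qed.

End potential.

(** * Diffusion matrix *)

Lemma measurable_invr {R : realType} d (T : measurableType d) (F : T -> R) :
  measurable_fun setT F -> measurable_fun setT (fun x => (F x)^-1).
Proof.
move=> mF; rewrite (_ : (fun x => _) = fun x => F x * (F x ^+ 2) `^ (-1)).
  apply: measurable_funM => //; apply: (measurableT_comp (measurable_powR (-1))).
  exact: measurable_funX.
apply/funext => x; rewrite powR_inv1 ?sqr_ge0//.
by have [->|F0] := eqVneq (F x) 0; [rewrite invr0 mul0r|field].
Qed.

Section quadratic_form.
Context {R : realType} {d : nat}.
Implicit Types (v w z e : 'rV[R]_d) (A : 'M[R]_d).

Lemma qformE A e :
  qform A e = \sum_(p : 'I_d * 'I_d) e ord0 p.1 * A p.1 p.2 * e ord0 p.2.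
Proof.
rewrite -(pair_bigA _ (fun i j => e ord0 i * A i j * e ord0 j))/= exchange_big/=.
rewrite /qform mxE; apply: eq_bigr => j _; rewrite !mxE mulr_suml.
by apply: eq_bigr => i _.
Qed.

Lemma qformZ A (c : R) e : qform A (c *: e) = c ^+ 2 * qform A e.
Proof. by rewrite !qformE mulr_sumr; apply: eq_bigr => p _; rewrite !mxE; ring. Qed.

Lemma edotZ (c : R) e : edot (c *: e) (c *: e) = c ^+ 2 * edot e e.
Proof. by rewrite /edot mulr_sumr; apply: eq_bigr => p _; rewrite !mxE; ring. Qed.

Lemma edot_eq0 e : edot e e = 0 -> e = 0.
Proof.
move=> e0; apply/rowP => i; rewrite mxE; apply/eqP; rewrite -normr_le0.
by rewrite (le_trans (coord_le_enorm e i))// /enorm e0 sqrtr0.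
Qed.

Lemma PiE z i j : Pi z i j = (i == j)%:R - (enorm z ^+ 2)^-1 * (z ord0 i * z ord0 j).
Proof. by rewrite !mxE big_ord1 !mxE. Qed.

Lemma norm_Pi_le z i j : `|Pi z i j| <= 2.
Proof.
rewrite PiE; apply: (le_trans (ler_normB _ _)).
have : `|(i == j)%:R : R| <= 1 by case: (i == j); rewrite ?normr1 ?normr0.
suff : `|(enorm z ^+ 2)^-1 * (z ord0 i * z ord0 j)| <= 1 by lra.
have [z0|z0] := eqVneq (enorm z ^+ 2) 0; first by rewrite z0 invr0 mul0r normr0.
have z1 : 0 < enorm z ^+ 2 by rewrite lt_def z0 sqr_ge0.
rewrite normrM gtr0_norm ?invr_gt0// mulrC ler_pdivrMr// mul1r normrM expr2.
by rewrite ler_pM ?coord_le_enorm.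
Qed.

Lemma qform_Pi z e : qform (Pi z) e = edot e e - (enorm z ^+ 2)^-1 * edot z e ^+ 2.
Proof.
rewrite qformE; under eq_bigr do rewrite PiE mulrBr mulrBl.
rewrite big_split/= sumrN; congr (_ - _).
  rewrite -(pair_bigA _ (fun i j => e ord0 i * (i == j)%:R * e ord0 j))/= /edot.
  apply: eq_bigr => i _; rewrite (bigD1 i)//= eqxx mulr1 big1 ?addr0// => j ji.
  by rewrite eq_sym (negbTE ji) mulr0 mul0r.
rewrite [edot z e ^+ 2]expr2 /edot big_distrlr/= pair_big mulr_sumr/=.
by apply: eq_bigr => p _; ring.
Qed.

Lemma lagrange_identity z e :
  \sum_(p : 'I_d * 'I_d) (z ord0 p.1 * e ord0 p.2 - z ord0 p.2 * e ord0 p.1) ^+ 2 =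
  2 * (edot z z * edot e e - edot z e ^+ 2).
Proof.
transitivity (\sum_(p : 'I_d * 'I_d)
  ((z ord0 p.1 * z ord0 p.1) * (e ord0 p.2 * e ord0 p.2) +
   ((e ord0 p.1 * e ord0 p.1) * (z ord0 p.2 * z ord0 p.2) -
   2 * ((z ord0 p.1 * e ord0 p.1) * (z ord0 p.2 * e ord0 p.2))))).
  by apply: eq_bigr => p _; ring.
rewrite !big_split/= sumrN -mulr_sumr.
have E (F G : 'I_d -> R) : \sum_(p : 'I_d * 'I_d) F p.1 * G p.2 = (\sum_i F i) * (\sum_i G i).
  by rewrite big_distrlr/= pair_big.
rewrite (E (fun i => z ord0 i * z ord0 i) (fun i => e ord0 i * e ord0 i)).
rewrite (E (fun i => e ord0 i * e ord0 i) (fun i => z ord0 i * z ord0 i)).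
rewrite (E (fun i => z ord0 i * e ord0 i) (fun i => z ord0 i * e ord0 i)).
rewrite /edot; ring.
Qed.

(** Keeps the equal terms [(i, j)] and [(j, i)] of the Lagrange identity. This quantifies the
    ellipticity of [Pi z] by a single minor of [z] and [e], whose small values define a slab. *)
Lemma lagrange_le z e i j : i != j ->
  (z ord0 i * e ord0 j - z ord0 j * e ord0 i) ^+ 2 <=
  edot z z * edot e e - edot z e ^+ 2.
Proof.
move=> ij; have := lagrange_identity z e.
rewrite (bigD1 (i, j))//= (bigD1 (j, i))//=; last first.
  by apply/eqP => -[ji _]; rewrite ji eqxx in ij.
set S := \sum_(p | _) _; have S0 : 0 <= S by apply: sumr_ge0 => p _; exact: sqr_ge0.
by move: S0; clearbody S; have := sqr_ge0 (z ord0 i * e ord0 j - z ord0 j * e ord0 i); nra.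
Qed.

Lemma qform_Pi_ge0 z e : 0 <= qform (Pi z) e.
Proof.
rewrite qform_Pi; have [z0|z0] := eqVneq (enorm z ^+ 2) 0.
  by rewrite z0 invr0 mul0r subr0 edot_ge0.
have z1 : 0 < enorm z ^+ 2 by rewrite lt_def z0 sqr_ge0.
rewrite subr_ge0 mulrC ler_pdivrMr// mulrC sqr_enorm -subr_ge0.
rewrite -(pmulr_rge0 _ (ltr0n R 2)) -lagrange_identity.
by apply: sumr_ge0 => p _; exact: sqr_ge0.
Qed.

End quadratic_form.

Section diffusion.
Context {R : realType} {d : nat}.
Local Notation mu := (lebesgue_rV R d).
Implicit Types (v w z e : 'rV[R]_d) (k g : R) (f : 'rV[R]_d -> R).

Definition diffusion_entry g f v w i j : R :=
  enorm (v - w) `^ (2 + g) * Pi (v - w) i j * f w.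

Lemma measurable_diffusion_entry g f i j : measurable_fun setT f ->
  measurable_fun setT (fun p : 'rV[R]_d * 'rV[R]_d => diffusion_entry g f p.1 p.2 i j).
Proof.
move=> mf.
have mz : measurable_fun setT (fun p : 'rV[R]_d * 'rV[R]_d => p.1 - p.2).
  by apply: measurable_rVB; [exact: measurable_fst|exact: measurable_snd].
have mn := measurable_enorm mz.
apply: measurable_funM; last exact: (measurableT_comp mf measurable_snd).
apply: measurable_funM; first exact: (measurableT_comp (measurable_powR _) mn).
rewrite (_ : (fun _ => _) = fun p : 'rV[R]_d * 'rV[R]_d => (i == j)%:R -
  (enorm (p.1 - p.2) ^+ 2)^-1 * ((p.1 - p.2) ord0 i * (p.1 - p.2) ord0 j)); last first.
  by apply/funext => p; rewrite PiE.
apply: measurable_funB => //; apply: measurable_funM.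
  by apply: measurable_invr; exact: measurable_funX.
by apply: measurable_funM; exact: measurable_coord_comp.
Qed.

Lemma measurable_diffusion k g f i j : measurable_fun setT f ->
  measurable_fun setT (fun v => diffusion k g f v i j).
Proof.
move=> mf; have mF : measurable_fun setT (fun p : 'rV[R]_d * 'rV[R]_d =>
    (diffusion_entry g f p.1 p.2 i j)%:E).
  by apply/measurable_EFinP; exact: measurable_diffusion_entry.
rewrite (_ : (fun v => _) = fun v => k * fine (\int[mu]_w (diffusion_entry g f v w i j)%:E)%E);
  last by apply/funext => v; rewrite mxE.
apply: measurable_funM => //; apply: (measurableT_comp (fine_measurable measurableT)).
under eq_fun do rewrite integralE.
apply: emeasurable_funB.
- have m1 := measurable_funepos mF.
  rewrite (_ : (fun v => _) = fun v => \int[mu]_w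
      (fun p : 'rV[R]_d * 'rV[R]_d => (diffusion_entry g f p.1 p.2 i j)%:E)^\+ (v, w))%E.
    exact: (measurable_fun_fubini_tonelli_F (m2 := mu) _ m1 (fun p => funepos_ge0 _ p)).
  by apply/funext => v; apply: eq_integral => w _; rewrite !funeposE.
- have m1 := measurable_funeneg mF.
  rewrite (_ : (fun v => _) = fun v => \int[mu]_w
      (fun p : 'rV[R]_d * 'rV[R]_d => (diffusion_entry g f p.1 p.2 i j)%:E)^\- (v, w))%E.
    exact: (measurable_fun_fubini_tonelli_F (m2 := mu) _ m1 (fun p => funeneg_ge0 _ p)).
  by apply/funext => v; apply: eq_integral => w _; rewrite !funenegE.
Qed.

Lemma measurable_qform_diffusion k g f (h : 'rV[R]_d -> 'rV[R]_d) :
  measurable_fun setT f -> measurable_fun setT h ->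
  measurable_fun setT (fun v => qform (diffusion k g f v) (h v)).
Proof.
move=> mf mh; under eq_fun do rewrite qformE.
apply: measurable_sum => p; apply: measurable_funM; last exact: measurable_coord_comp.
apply: measurable_funM; first exact: measurable_coord_comp.
exact: measurable_diffusion.
Qed.

Lemma integrable_diffusion_entry g f v i j : density f ->
  (potential (2 + g) f v < +oo)%E ->
  mu.-integrable setT (fun w => (diffusion_entry g f v w i j)%:E).
Proof.
move=> [mf f0] Poo.
have mk : measurable_fun setT (fun w => enorm (v - w) `^ (2 + g) * f w).
  exact: (measurableT_comp (measurable_kernel (2 + g) mf) (measurable_pair1 v)).
have k0 w : 0 <= enorm (v - w) `^ (2 + g) * f w by rewrite mulr_ge0 ?powR_ge0.
have ik : mu.-integrable setT (fun w => (enorm (v - w) `^ (2 + g) * f w)%:E).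
  apply/integrableP; split; first exact/measurable_EFinP.
  by under eq_integral do rewrite gee0_abs ?lee_fin//.
apply: (le_integrable measurableT _ _ (integrableZl measurableT 2 ik)).
  apply/measurable_EFinP.
  exact: (measurableT_comp (measurable_diffusion_entry g i j mf) (measurable_pair1 v)).
move=> w _; rewrite -EFinM !abse_EFin lee_fin [leRHS]ger0_norm ?mulr_ge0 ?powR_ge0//.
rewrite /diffusion_entry mulrAC normrM (ger0_norm (k0 w)) mulrC ler_wpM2r//.
exact: norm_Pi_le.
Qed.

(** The matrix is defined by integrating its entries separately; as the entries of [Pi] are bounded,
    a finite potential makes them integrable, and the sum can be moved under the integral. *)
Lemma qform_diffusion k g f v e : density f -> (potential (2 + g) f v < +oo)%E ->
  (qform (diffusion k g f v) e)%:E =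
  (k%:E * \int[mu]_w (enorm (v - w) `^ (2 + g) * qform (Pi (v - w)) e * f w)%:E)%E.
Proof.
move=> df Poo; pose F (p : 'I_d * 'I_d) w := diffusion_entry g f v w p.1 p.2.
have iF p : mu.-integrable setT (EFin \o F p) by exact: integrable_diffusion_entry.
transitivity (k%:E * \int[mu]_w \sum_(p : 'I_d * 'I_d)
    ((e ord0 p.1 * e ord0 p.2)%:E * (F p w)%:E))%E; last first.
  congr (_ * _)%E; apply: eq_integral => w _; rewrite qformE sumEFin; congr EFin.
  rewrite mulr_sumr mulr_suml; apply: eq_bigr => p _; rewrite /F /diffusion_entry; ring.
rewrite integral_sum//; last by move=> p; exact: (integrableZl measurableT _ (iF p)).
rewrite (eq_bigr (fun p => (e ord0 p.1 * e ord0 p.2 * \int[mu]_w F p w)%:E)); last first.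
  by move=> p _; rewrite (integralZl measurableT (iF p)) [RHS]EFinM; congr (_ * _)%E;
    rewrite /Rintegral fineK//; exact: (integrable_fin_num measurableT (iF p)).
rewrite sumEFin -EFinM; congr EFin; rewrite qformE mulr_sumr; apply: eq_bigr => p _.
have -> : diffusion k g f v p.1 p.2 = k * \int[mu]_w F p w by rewrite mxE.
by ring.
Qed.

Lemma qform_diffusion_ge0 k g f v e : 0 <= k -> density f ->
  (potential (2 + g) f v < +oo)%E -> 0 <= qform (diffusion k g f v) e.
Proof.
move=> k0 df Poo; have [_ f0] := df; rewrite -lee_fin qform_diffusion//.
apply: mule_ge0; rewrite ?lee_fin//; apply: integral_ge0 => w _.
by rewrite lee_fin !mulr_ge0 ?powR_ge0 ?qform_Pi_ge0.
Qed.

Lemma astar_ge0 k g f v : (forall e, 0 <= qform (diffusion k g f v) e) ->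
  0 <= astar k g f v.
Proof.
move=> psd; rewrite /astar; set E := [set _ | _ in _].
(* In dimension 0 the unit sphere is empty and the infimum is 0 by convention. *)
have [->|/set0P E0] := eqVneq E set0; first by rewrite inf0.
by apply: lb_le_inf => // _ [e _ <-].
Qed.

Lemma astar_le_qform k g f v e : (forall e, 0 <= qform (diffusion k g f v) e) ->
  astar k g f v * edot e e <= qform (diffusion k g f v) e.
Proof.
move=> psd; have [e0|e0] := eqVneq (edot e e) 0.
  by rewrite e0 mulr0.
have e1 : 0 < edot e e by rewrite lt_def e0 edot_ge0.
have n1 : 0 < enorm e by rewrite sqrtr_gt0.
pose u := (enorm e)^-1 *: e.
have u1 : enorm u = 1 by rewrite /enorm edotZ -sqr_enorm -exprMn mulVf ?gt_eqF// expr1n sqrtr1.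
have -> : qform (diffusion k g f v) e = edot e e * qform (diffusion k g f v) u.
  by rewrite qformZ mulrA -sqr_enorm -exprMn mulfV ?gt_eqF// expr1n mul1r.
rewrite mulrC ler_pM2l//; apply: ge_inf; last by exists u.
by exists 0 => _ [w _ <-].
Qed.

Lemma continuous_qform (A : 'M[R]_d) : continuous (qform A).
Proof.
rewrite (_ : qform A =
  fun e => \sum_(p : 'I_d * 'I_d) e ord0 p.1 * A p.1 p.2 * e ord0 p.2); last first.
  by apply/funext => x; rewrite qformE.
apply: continuous_big => [|p _ e]; first exact: add_continuous.
have c i : (x : 'rV[R]_d) ord0 i @[x --> e] --> (e ord0 i : R) by exact: coord_continuous.
exact: (cvgM (cvgM (c _) (cvg_cst _)) (c _)).
Qed.

(** Measurability of an infimum over the uncountable sphere: by homogeneity the strict inequality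
    can be tested on all nonzero vectors, and by continuity on rational ones, so sublevel sets
    become countable unions. *)
Lemma astar_ltP k g f v t : (0 < d)%N ->
  (astar k g f v < t) <-> exists q : 'rV[rat]_d, let e := map_mx ratr q in
     0 < edot e e /\ qform (diffusion k g f v) e < t * edot e e.
Proof.
move=> d0; set A := diffusion k g f v; split.
  move=> /inf_lt[].
    pose i0 := Ordinal d0; exists (qform A (delta_mx ord0 i0)); exists (delta_mx ord0 i0) => //=.
    rewrite /enorm /edot (bigD1 i0)//= mxE !eqxx big1 ?addr0 ?mulr1 ?sqrtr1// => j ji.
    by rewrite mxE (negbTE ji) andbF mulr0.
  move=> _ [e e1 <-] et; have ee : edot e e = 1 by rewrite -sqr_enorm e1 expr1n.
  have qI (x : 'rV[R]_d) : edot x x = qform 1%:M x.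
    by rewrite /qform mulmx1 mxE; apply: eq_bigr => i _; rewrite mxE.
  have c1 : {for e, continuous (fun x : 'rV[R]_d => edot x x : R)}.
    by rewrite (_ : (fun x => _) = qform 1%:M); [exact: continuous_qform|exact/funext].
  have c2 : {for e, continuous (fun x : 'rV[R]_d => t * edot x x - qform A x)}.
    exact: (cvgB (cvgM (cvg_cst t) c1) (@continuous_qform A e)).
  have n1 : \forall x \near e, 0 < edot x x by apply: (cvgr_gt _ c1); rewrite ee.
  have n2 : \forall x \near e, 0 < t * edot x x - qform A x.
    by apply: (cvgr_gt _ c2); rewrite ee mulr1 subr_gt0.
  have := filterI n1 n2; rewrite nbhs_ballP => -[eps /= eps0 H].
  have eps2 : 0 < eps / 2 by rewrite divr_gt0.
  have [q qP] := rV_rat_dense e eps2; exists q.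
  have [|h1 h2] := H (map_mx ratr q); last by split=> //; rewrite -subr_gt0.
  rewrite -ball_normE /=; apply: (@le_lt_trans _ _ (eps / 2)); last by move: eps0; lra.
  by apply: rV_norm_le => [|i]; [exact: ltW|rewrite !mxE ltW].
move=> [q [e1 lt]]; set e := map_mx ratr q in e1 lt.
have n1 : 0 < enorm e by rewrite sqrtr_gt0.
pose u := (enorm e)^-1 *: e.
have u1 : enorm u = 1 by rewrite /enorm edotZ -sqr_enorm -exprMn mulVf ?gt_eqF// expr1n sqrtr1.
have ut : qform A u < t.
  by rewrite qformZ exprVn sqr_enorm mulrC ltr_pdivrMr.
apply: le_lt_trans ut; apply: ge_inf; last by exists u.
(* A lower bound on the sphere valid without any sign of [A]; [astar] must be handled also where the
   entries have junk values. *)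
exists (- \sum_(p : 'I_d * 'I_d) `|A p.1 p.2|) => _ [w w1 <-].
rewrite lerNl qformE -sumrN; apply: ler_sum => p _.
rewrite -[leRHS]mul1r; apply: (le_trans (ler_norm _)); rewrite normrN !normrM mulrAC.
rewrite ler_wpM2r// -[leRHS]mul1r ler_pM// -w1; exact: coord_le_enorm.
Qed.

Lemma measurable_astar k g f : (0 < d)%N -> measurable_fun setT f ->
  measurable_fun setT (astar k g f).
Proof.
move=> d0 mf; apply: (measurability _ (RGenInftyO.measurableE R)) => _ [_ [t ->] <-].
pose B (q : 'rV[rat]_d) : set 'rV[R]_d := let e := map_mx ratr q in
  if 0 < edot e e then [set v | qform (diffusion k g f v) e < t * edot e e] else set0.
rewrite setTI (_ : _ @^-1` _ = \bigcup_q B q).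
  apply: countable_bigcupT_measurable => [|q]; first exact: countableP.
  rewrite /B; case: ifPn => // _; set e := map_mx _ _.
  rewrite (_ : [set _ | _] = (fun v => qform (diffusion k g f v) e) @^-1` `]-oo, t * edot e e[).
    rewrite -[X in measurable X]setTI; apply: measurable_qform_diffusion => //.
  by apply/seteqP; split => v; rewrite /= in_itv.
apply/seteqP; split => [v|v [q _]] /=; rewrite in_itv/=.
  by move/(astar_ltP _ _ _ _ _ d0) => [q [e1 lt]]; exists q => //; rewrite /B e1.
rewrite /B; case: ifPn => // e1 lt; apply/(astar_ltP _ _ _ _ _ d0).
by exists q.
Qed.

End diffusion.

(** * From extended-real averages to the estimate on a cube *)

Section ereal_cube.
Context {R : realType} {d : nat}.
Local Notation mu := (lebesgue_rV R d).
Local Notation node := ('rV[R]_d * R)%type.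
Local Open Scope ereal_scope.

Lemma measurable_invEFin (b : 'rV[R]_d -> R) : measurable_fun setT b ->
  measurable_fun setT (fun x => (b x)%:E^-1).
Proof.
move=> mb; rewrite (_ : (fun x => _) = fun x => if (b x == 0)%R then +oo else ((b x)^-1)%:E).
  apply: measurable_fun_ifT => //; last by apply/measurable_EFinP; exact: measurable_invr.
  exact: measurable_fun_eqr.
by apply/funext => x; rewrite inver.
Qed.

Lemma average_cube v (l : R) (G : 'rV[R]_d -> \bar R) : (0 < l)%R ->
  average (cube v l) G = (l ^+ d)^-1%:E * \int[mu]_(x in cube v l) G x.
Proof.
move=> l0; rewrite /average (lebesgue_rV_cube _ (ltW l0)) inver.
by rewrite gt_eqF// exprn_gt0.
Qed.

Lemma cube_side v (l : R) : (0 < d)%N -> (0 < l)%R ->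
  (mu (cube v l)) `^ d%:R^-1 = l%:E.
Proof.
move=> d0 l0; rewrite [X in X `^ _](lebesgue_rV_cube _ (ltW l0)) poweR_EFin.
by rewrite -powR_mulrn ?(ltW l0)// -powRrM mulfV ?powRr1 ?(ltW l0)// pnatr_eq0 -lt0n.
Qed.

Lemma cavg_le_average (t : node) (F : 'rV[R]_d -> R) (G : 'rV[R]_d -> \bar R) :
  (0 < t.2)%R -> cint t F -> measurable_fun setT F -> measurable_fun setT G ->
  (forall x, 0 <= F x)%R -> (forall x, (F x)%:E <= G x) ->
  (cavg F t)%:E <= average (cube t.1 t.2) G.
Proof.
move=> t0 iF mF mG F0 FG; rewrite average_cube// /cavg mulrC EFinM -cint_Rintegral//.
have G0 x : 0 <= G x by rewrite (le_trans _ (FG x))// lee_fin.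
apply: lee_wpmul2l; first by rewrite lee_fin invr_ge0 exprn_ge0// ltW.
apply: (@le_trans _ _ (\int[mu]_(x in hc t) G x)).
  apply: ge0_le_integral => //; first exact: measurable_hc.
  - by move=> x _; rewrite lee_fin.
  - by apply/measurable_EFinP; exact: measurable_funTS.
  - exact: measurable_funTS.
apply: ge0_subset_integral => //; [exact: measurable_hc|exact: measurable_cube| |].
  exact: measurable_funTS.
exact: hcube_subset_cube.
Qed.

Lemma negligible_cube_F v (l : R) (P : set 'rV[R]_d) : (0 < l)%R ->
  {ae mu, forall x, cube v l x -> P x} -> exists2 x, cube v l x & P x.
Proof.
move=> l0 H; apply: contrapT => nex.
have : mu.-negligible (cube v l).
  apply: negligibleS H => x vx /= /(_ vx) Px; apply: nex; by exists x.
move/(negligibleP _ (measurable_cube v l)) => Q0.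
have := etrans (esym (lebesgue_rV_cube v (ltW l0))) Q0; move=> -[]/eqP.
by rewrite gt_eqF// exprn_gt0.
Qed.

Lemma EFinM_powR (t x y p : R) :
  (t * x `^ p * y `^ p)%R%:E = t%:E * (x%:E `^ p) * (y%:E `^ p).
Proof. by []. Qed.

(** The smallness hypothesis lives in the extended reals, where a product with a zero factor carries
    no information on the other one. Once both integrals on the whole cube are known to be positive,
    the finite bound [e] makes both finite, and the real-valued [cube_estimate] applies. *)
Lemma cube_step (H : 'rV[R]_d -> \bar R) (b phi : 'rV[R]_d -> R) (L s r e M : R) v :
  (0 < d)%N -> measurable_fun setT H -> (forall x, 0 <= H x) ->
  measurable_fun setT b -> {ae mu, forall x, (0 <= b x)%R} ->
  (0 < L)%R -> (forall x y, `|phi x - phi y| <= L * `|x - y|)%R ->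
  (1 < s)%R -> (0 < r)%R -> (0 < e)%R -> (0 <= M)%R ->
  \int[mu]_(x in hcube v r) H x <= M%:E ->
  (forall v' l, (0 < l <= r)%R ->
    (mu (cube v' l)) `^ d%:R^-1 *
    (average (cube v' l) (fun x => H x `^ s)) `^ (2 * s)^-1 *
    (average (cube v' l) (fun x => ((b x)%:E^-1) `^ s)) `^ (2 * s)^-1 <= e%:E) ->
  \int[mu]_(x in hcube v r) ((phi x ^+ 2)%:E * H x) <=
   (2 * (2 * weighted_poincare_cst (d := d) s * e) ^+ 2)%:E *
     \int[mu]_(x in hcube v r) (gradsum phi x ^+ 2 * Num.max 0 (b x))%:E +
   (2 * (M / r ^+ d))%:E * \int[mu]_(x in hcube v r) (phi x ^+ 2)%:E.
Proof.
move=> d0 mH H0 mb b0 L0 phiL s1 r0 e0 M0 HM A2.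
have s0 : (0 < s)%R by rewrite (lt_trans _ s1).
have p0 : (0 < (2 * s)^-1)%R by rewrite invr_gt0 mulr_gt0.
have rd : (0 < r ^+ d)%R by rewrite exprn_gt0.
have mphi : measurable_fun setT phi := measurable_lipschitz_rV L0 phiL.
have mg := measurable_gradsum L0 phiL.
have mQ := measurable_cube v r; have mq := @measurable_hcube R d v r.
have qQ : hcube v r `<=` cube v r := @hcube_subset_cube R d v r.
pose F x := ((b x)%:E^-1) `^ s.
have mF : measurable_fun setT F.
  by apply: (measurableT_comp (measurable_poweR s)); exact: measurable_invEFin.
have F0 x : 0 <= F x by exact: poweR_ge0.
pose G x := H x `^ s.
have mG : measurable_fun setT G by exact: (measurableT_comp (measurable_poweR s)).
have G0 x : 0 <= G x by exact: poweR_ge0.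
pose a x := Num.max 0%R (b x).
have ma : measurable_fun setT a by apply: measurable_maxr.
have a0 x : (0 <= a x)%R by rewrite le_max lexx.
have rhs0 : 0 <= (2 * (2 * weighted_poincare_cst (d := d) s * e) ^+ 2)%:E *
     \int[mu]_(x in hcube v r) (gradsum phi x ^+ 2 * Num.max 0 (b x))%:E +
   (2 * (M / r ^+ d))%:E * \int[mu]_(x in hcube v r) (phi x ^+ 2)%:E.
  apply: adde_ge0; apply: mule_ge0.
  - by rewrite lee_fin mulr_ge0// sqr_ge0.
  - by apply: integral_ge0 => x _; rewrite lee_fin; apply: mulr_ge0; [exact: sqr_ge0|exact: a0].
  - by rewrite lee_fin mulr_ge0// divr_ge0// ltW.
  - by apply: integral_ge0 => x _; rewrite lee_fin sqr_ge0.
have mphiH : measurable_fun setT (fun x => (phi x ^+ 2)%:E * H x).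
  by apply: emeasurable_funM => //; apply/measurable_EFinP; exact: measurable_funX.
(* If the integral of [H^s] vanishes, then [H = 0] almost everywhere on the cube and the left side
   is 0. *)
have [XI0|XIn0] := eqVneq (\int[mu]_(x in cube v r) G x) 0.
  rewrite (_ : \int[mu]_(x in hcube v r) _ = 0)//.
  have /(ae_eq_integral_abs mu mQ (measurable_funTS mG)) : \int[mu]_(x in cube v r) `|G x| = 0.
    by rewrite -[RHS]XI0; apply: eq_integral => x _; rewrite gee0_abs.
  move=> aeG; rewrite (ae_eq_integral (cst 0))//; first by rewrite integral0.
    exact: measurable_funTS.
  apply: filterS aeG => x xG qx; have /(poweR_eq0_eq0 (H0 x)) -> := xG (qQ x qx).
  by rewrite mule0.
(* The other integrand vanishes nowhere: it is [+oo] where [b = 0] and a power of a nonzero real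
   elsewhere. *)
have YIn0 : \int[mu]_(x in cube v r) F x != 0.
  apply/eqP => YI0.
  have /(ae_eq_integral_abs mu mQ (measurable_funTS mF)) : \int[mu]_(x in cube v r) `|F x| = 0.
    by rewrite -[RHS]YI0; apply: eq_integral => x _; rewrite gee0_abs.
  move=> /(negligible_cube_F r0)[x _]; rewrite /F inver; have [//|bx] := eqVneq (b x) 0%R.
    by rewrite poweRyr// gt_eqF.
  by rewrite poweR_EFin => -[]/eqP; rewrite powR_eq0 invr_eq0 (negbTE bx).
have := A2 v r; rewrite r0 lexx => /(_ erefl); rewrite cube_side// !average_cube//.
rewrite -/(G) -/(F).
have XIp : 0 < \int[mu]_(x in cube v r) G x by rewrite lt_def XIn0 integral_ge0.
have YIp : 0 < \int[mu]_(x in cube v r) F x by rewrite lt_def YIn0 integral_ge0.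
have rdV : 0 < ((r ^+ d)^-1)%:E by rewrite lte_fin invr_gt0.
move=> A20.
have XIoo : \int[mu]_(x in cube v r) G x < +oo.
  rewrite ltey; apply/eqP => XI; move: A20; rewrite XI gt0_muley// poweRyr ?gt_eqF//.
  rewrite gt0_muley ?lte_fin// gt0_mulye ?poweR_gt0 ?mule_gt0//.
have YIoo : \int[mu]_(x in cube v r) F x < +oo.
  rewrite ltey; apply/eqP => YI; move: A20; rewrite YI gt0_muley// poweRyr ?gt_eqF//.
  by rewrite gt0_muley// mule_gt0 ?lte_fin// poweR_gt0// mule_gt0.
(* On the cube, the real functions [h] and [a] differ from [H] and [b] on null sets only, by
   finiteness of the integral of [H^s] and by [b0]. *)
pose h x := fine (H x).
have h0 x : (0 <= h x)%R by exact: fine_ge0.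
have mh : measurable_fun setT h by exact: (measurableT_comp (fine_measurable measurableT)).
have mhs : measurable_fun setT (fun x => h x `^ s)%R.
  exact: (measurableT_comp (measurable_powR s)).
have hG x : ((h x `^ s)%R)%:E <= G x.
  by rewrite /h /G; case: (H x) (H0 x) => [y||]//= _; rewrite gt_eqF ?leey.
have mas : measurable_fun setT (fun x => (a x)^-1 `^ s)%R.
  by apply: (measurableT_comp (measurable_powR s)); exact: measurable_invr.
have aF x : (((a x)^-1 `^ s)%R)%:E <= F x.
  rewrite /a /F; have [b1|b1|b1] := ltrgtP 0%R (b x).
  - by rewrite inver gt_eqF.
  - by rewrite invr0 powR0 ?gt_eqF// poweR_ge0.
  - by rewrite invr0 powR0 ?gt_eqF// poweR_ge0.
have cintle (f : 'rV[R]_d -> R) (g : 'rV[R]_d -> \bar R) : measurable_fun setT f ->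
    measurable_fun setT g -> (forall x, 0 <= f x)%R -> (forall x, (f x)%:E <= g x) ->
    \int[mu]_(x in cube v r) g x < +oo -> cint (v, r) f.
  move=> mf mg' f0 fg goo; apply: cint_ltey => //; apply: le_lt_trans goo.
  have g0 x : 0 <= g x by rewrite (le_trans _ (fg x))// lee_fin.
  apply: (@le_trans _ _ (\int[mu]_(x in hcube v r) g x)).
    apply: ge0_le_integral => //.
    - by move=> x _; rewrite lee_fin.
    - by apply/measurable_EFinP; exact: measurable_funTS.
    - exact: measurable_funTS.
  by apply: ge0_subset_integral => //; exact: measurable_funTS.
have ihs : cint (v, r) (fun x => h x `^ s)%R.
  by apply: (cintle _ G) => // x; exact: powR_ge0.
have ias : cint (v, r) (fun x => (a x)^-1 `^ s)%R.
  by apply: (cintle _ F) => // x; exact: powR_ge0.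
have aefin (g : 'rV[R]_d -> \bar R) : measurable_fun setT g -> (forall x, 0 <= g x) ->
    \int[mu]_(x in cube v r) g x < +oo ->
    {ae mu, forall x, cube v r x -> g x \is a fin_num}.
  move=> mg' g0 goo; apply: integrable_ae => //; apply/integrableP; split.
    exact: measurable_funTS.
  by under eq_integral do rewrite gee0_abs//.
have apos : mu (hc (v, r) `&` [set x | a x = 0%R]) = 0.
  apply/negligibleP.
    apply: measurableI; first exact: measurable_hc.
    rewrite -[X in measurable X]setTI; exact: (ma measurableT [set 0%R]).
  have Z : {ae mu, forall x, ~ (hc (v, r) `&` [set x | a x = 0%R]) x}.
    apply: filterS2 (aefin F mF F0 YIoo) b0 => x Fx bx [qx ax0].
    have := Fx (qQ x qx); have bx0 : b x = 0%R by move: ax0; rewrite /= /a max_r.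
    by rewrite /F bx0 inver eqxx poweRyr// gt_eqF.
  by apply: negligibleS Z => x Ax /=; exact.
have hH x : (h x)%:E <= H x by rewrite /h; case: (H x) (H0 x) => //= _; rewrite leey.
have HMh : \int[mu]_(x in hcube v r) (h x)%:E <= M%:E.
  apply: le_trans HM; apply: ge0_le_integral => //.
  - by move=> x _; rewrite lee_fin.
  - by apply/measurable_EFinP; exact: measurable_funTS.
  - exact: measurable_funTS.
have ih : cint (v, r) h by apply: cint_ltey => //; rewrite (le_lt_trans HMh)// ltry.
have hM : (cavg h (v, r) <= M / r ^+ d)%R.
  rewrite ler_wpM2r ?invr_ge0 ?(ltW rd)//.
  by have := HMh; rewrite (cint_Rintegral ih) lee_fin.
have A2t t : subnode (v, r) t -> (t.2 * cavg (fun x => h x `^ s) t `^ (2 * s)^-1 *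
    cavg (fun x => (a x)^-1 `^ s) t `^ (2 * s)^-1 <= e)%R.
  move=> Pt; have [t0 _] := Pt; have tr := @subnode_side R d (v, r) t d0 r0 Pt; simpl in tr.
  rewrite -lee_fin EFinM_powR.
  have := A2 t.1 t.2; rewrite t0 tr => /(_ erefl); rewrite cube_side//; apply: le_trans.
  have pw (x y : \bar R) : 0 <= x -> x <= y -> x `^ (2 * s)^-1 <= y `^ (2 * s)^-1.
    move=> x0 xy; apply: gt0_ler_poweR => //; first exact: ltW.
      by rewrite in_itv/= x0 leey.
    by rewrite in_itv/= (le_trans x0 xy) leey.
  have c1 : (0 <= cavg (fun x => h x `^ s) t)%R.
    by apply: cavg_ge0 => // x _; exact: powR_ge0.
  have c2 : (0 <= cavg (fun x => (a x)^-1 `^ s) t)%R.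
    by apply: cavg_ge0 => // x _; exact: powR_ge0.
  apply: lee_pmul.
  - by rewrite mule_ge0 ?poweR_ge0// lee_fin ltW.
  - exact: poweR_ge0.
  - apply: lee_wpmul2l; first by rewrite lee_fin ltW.
    apply: pw; first (rewrite lee_fin; exact: c1).
    apply: cavg_le_average => // [|x]; [exact: cint_sub ihs|exact: powR_ge0].
  - apply: pw; first by rewrite lee_fin.
    apply: cavg_le_average => // [|x]; [exact: cint_sub ias|exact: powR_ge0].
have := @cube_estimate R d phi h a L s e (v, r) L0 phiL r0 s1 e0 mh ma h0 a0 apos ihs ias A2t.
have -> : \int[mu]_(x in hc (v, r)) (phi x ^+ 2 * h x)%:E =
    \int[mu]_(x in hcube v r) ((phi x ^+ 2)%:E * H x).
  apply: ae_eq_integral => //.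
  - apply/measurable_EFinP; apply: measurable_funTS; apply: measurable_funM => //.
    exact: measurable_funX.
  - exact: measurable_funTS.
  apply: filterS (aefin G mG G0 XIoo) => x Gx qx; rewrite EFinM /h fineK//.
  by have := Gx (qQ x qx); rewrite /G; case: (H x) (H0 x) => //= _; rewrite gt_eqF.
move=> ce; apply: (le_trans ce); apply: leeD => //; apply: lee_wpmul2r.
  by apply: integral_ge0 => x _; rewrite lee_fin sqr_ge0.
by rewrite lee_fin ler_wpM2l.
Qed.

End ereal_cube.

(** * Entropy and coercivity *)

Section entropy.
Context {R : realType} {d : nat}.
Local Notation mu := (lebesgue_rV R d).
Implicit Types (v w : 'rV[R]_d) (f : 'rV[R]_d -> R).

(* The convex conjugate of [t ln t] is [expR (b - 1)]. *)
Lemma xlnx_conj (t b : R) : 0 <= t -> t * b - expR (b - 1) <= t * ln t.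
Proof.
rewrite le0r => /orP[/eqP->|t0].
  by rewrite !mul0r sub0r oppr_le0 expR_ge0.
have : t * (1 + (b - 1 - ln t)) <= t * expR (b - 1 - ln t).
  by rewrite ler_pM2l// expR_ge1Dx.
rewrite expRB lnK ?posrE// mulrCA mulfV ?gt_eqF// mulr1; lra.
Qed.

Lemma integral_gauss_rV : exists2 c : R, 0 <= c &
  (\int[mu]_v (expR (- enorm v ^+ 2))%:E = c%:E)%E.
Proof.
have ig := @integrableT_gauss R.
pose c1 := fine (\int[lebesgue_measure]_x (gauss_fun x)%:E)%E : R.
have c1E : (\int[lebesgue_measure]_x (gauss_fun x)%:E)%E = c1%:E :> \bar R.
  by rewrite /c1 fineK//; exact: integrable_fin_num ig.
have c10 : 0 <= c1.
  by rewrite -lee_fin -c1E; apply: integral_ge0 => x _; rewrite lee_fin gauss_fun_ge0.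
exists (\prod_(i < d) c1); first by apply: prodr_ge0.
rewrite -(@ge0_integral_rV_prod R d (fun _ => @gauss_fun R))//.
- apply: eq_integral => v _; rewrite sqr_enorm /edot -sumrN expR_sum.
  by congr EFin; apply: eq_bigr => i _; rewrite /gauss_fun expr2.
- by move=> i; exact: measurable_gauss_fun.
- by move=> i x; exact: gauss_fun_ge0.
Qed.

Lemma measurable_xlnx f : measurable_fun setT f ->
  measurable_fun setT (fun v => f v * ln (f v)).
Proof. by move=> mf; apply: measurable_funM => //; exact: measurableT_comp. Qed.

(** By [xlnx_conj] at [b = - |v|^2], the negative part of [f ln f] is at most
    [f |v|^2 + exp(- |v|^2)]. Its integral is therefore controlled by the second moment [d] and a
    Gaussian integral. *)
Lemma entropy_pos_bound : exists2 c : R, 0 <= c & forall f, density f ->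
  second_moment f = d%:R%:E -> (entropy f < +oo)%E ->
  (\int[mu]_v (Num.max 0 (f v * ln (f v)))%:E <= (`|fine (entropy f)| + c)%:E)%E.
Proof.
have [c c0 cE] := integral_gauss_rV.
exists (d%:R + c); first by rewrite addr_ge0.
move=> f [mf f0] f2 fe.
have mx := measurable_xlnx mf.
pose N v := Num.max 0 (- (f v * ln (f v))).
have mN : measurable_fun setT N by apply: measurable_maxr => //; exact: measurableT_comp.
have N0 v : 0 <= N v by rewrite le_max lexx.
pose P v := Num.max 0 (f v * ln (f v)).
have mP : measurable_fun setT P by exact: measurable_maxr.
have P0 v : 0 <= P v by rewrite le_max lexx.
have mg : measurable_fun setT (fun v : 'rV[R]_d => expR (- enorm v ^+ 2)).
  apply: (measurableT_comp (@measurable_expR R)); apply: measurable_funN.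
  by apply: measurable_funX; exact: measurable_enorm.
have m2 : measurable_fun setT (fun v => f v * enorm v ^+ 2).
  by apply: measurable_funM => //; apply: measurable_funX; exact: measurable_enorm.
have Nle : (\int[mu]_v (N v)%:E <= (d%:R + c)%:E)%E.
  rewrite EFinD -f2 -cE /second_moment -ge0_integralD//; first last.
  - exact/measurable_EFinP.
  - exact/measurable_EFinP.
  - by move=> v _; rewrite lee_fin mulr_ge0 ?sqr_ge0.
  apply: ge0_le_integral => //.
  - by move=> v _; rewrite lee_fin.
  - exact/measurable_EFinP.
  - by apply: emeasurable_funD; exact/measurable_EFinP.
  move=> v _; rewrite -EFinD lee_fin /N ge_max addr_ge0 ?expR_ge0 ?mulr_ge0 ?enorm_ge0//=.
  have := @xlnx_conj (f v) (- enorm v ^+ 2) (f0 v).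
  have : expR (- enorm v ^+ 2 - 1) <= expR (- enorm v ^+ 2) by rewrite ler_expR gerBl.
  lra.
have eE : entropy f = (\int[mu]_v (P v)%:E - \int[mu]_v (N v)%:E)%E.
  rewrite /entropy integralE; congr (_ - _)%E; apply: eq_integral => v _.
    by rewrite funeposE /P EFin_max maxC.
  by rewrite funenegE /N EFin_max maxC.
have NPoo : (\int[mu]_v (N v)%:E)%E \is a fin_num.
  rewrite ge0_fin_numE; first exact: le_lt_trans Nle (ltry _).
  by apply: integral_ge0 => v _; rewrite lee_fin.
have PE : (\int[mu]_v (P v)%:E = entropy f + \int[mu]_v (N v)%:E)%E by rewrite eE subeK.
have Pge : (0 <= \int[mu]_v (P v)%:E)%E by apply: integral_ge0 => v _; rewrite lee_fin.
have ef : entropy f \is a fin_num.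
  rewrite fin_numE -ltey fe andbT; apply/eqP => e; move: Pge; rewrite PE e.
  by rewrite addNye.
rewrite PE EFinD; apply: leeD => //.
by rewrite -[leLHS](fineK ef) lee_fin ler_norm.
Qed.

Lemma le_entropy_tail (t M : R) : 0 <= t -> 1 < M -> t <= M + Num.max 0 (t * ln t) / ln M.
Proof.
move=> t0 M1; have lM : 0 < ln M by rewrite ln_gt0.
have [tM|Mt] := leP t M.
  by rewrite (le_trans tM)// lerDl divr_ge0 ?(ltW lM)// le_max lexx.
have tl : t <= Num.max 0 (t * ln t) / ln M.
  rewrite ler_pdivlMr// le_max; apply/orP; right; rewrite ler_wpM2l//.
  by rewrite ler_ln ?posrE ?(ltW Mt)//; move: M1 Mt; lra.
by move: tl M1; lra.
Qed.

End entropy.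

(** * Volume of slabs *)

Section slab.
Context {R : realType} {d : nat}.
Local Notation mu := (lebesgue_rV R d).
Implicit Types (v w : 'rV[R]_d).

(** Used with [lam = e_i / e_j]: for bounded [w] outside it, the minor [z_i e_j - z_j e_i] of
    [z = v - w] and [e] is at least [delta * |e_j|] in absolute value. *)
Definition slab v (i j : 'I_d) (lam rho delta : R) : set 'rV[R]_d :=
  [set w : 'rV[R]_d | (forall k, `|w ord0 k| <= rho) /\
           `|(v - w) ord0 i - lam * (v - w) ord0 j| < delta].

Lemma measurable_slab v i j (lam rho delta : R) : measurable (slab v i j lam rho delta).
Proof.
apply: measurableI.
  rewrite [X in measurable X](_ : _ = \bigcap_(k in [set: 'I_d])
    ((fun w : 'rV[R]_d => `|w ord0 k|) @^-1` `]-oo, rho]%classic)).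
    apply: fin_bigcap_measurable => [|k _]; first exact: finite_finset.
    rewrite -[X in measurable X]setTI.
    apply: (measurableT_comp (@normr_measurable R setT) (measurable_coord k)) => //.
  by apply/seteqP; split => [w /= H k _|w /= H k]; [rewrite /= in_itv; exact: H|
    have := H k Logic.I; rewrite /= in_itv].
rewrite [X in measurable X](_ : _ = (fun w => `|(v - w) ord0 i - lam * (v - w) ord0 j|) @^-1`
  `]-oo, delta[%classic); last by apply/seteqP; split => w; rewrite /= in_itv.
rewrite -[X in measurable X]setTI.
have mz : measurable_fun setT (fun w => v - w) by exact: measurable_rVB.
apply: (measurableT_comp (@normr_measurable R setT)) => //.
apply: measurable_funB; first exact: measurable_coord_comp.
by apply: measurable_funM => //; exact: measurable_coord_comp.
Qed.

(* The translates of the slab by multiples of [2 * delta] along the [i]-th axis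
   are disjoint. *)
Lemma slab_volume v i j (lam rho : R) n : i != j -> 0 <= rho -> (0 < n)%N ->
  (mu (slab v i j lam rho (2 * n%:R)^-1) <= ((2 * rho + 1) ^+ d / n%:R)%:E)%E.
Proof.
move=> ij rho0 n0; set delta := (2 * n%:R)^-1; set S := slab _ _ _ _ _ _.
have n0' : 0 < n%:R :> R by rewrite ltr0n.
have de : delta * 2 * n%:R = 1 by rewrite /delta; field; rewrite gt_eqF.
have de0 : 0 < delta by rewrite invr_gt0 mulr_gt0.
have mS : measurable S by exact: measurable_slab.
have mI : measurable_fun setT (\1_S : 'rV[R]_d -> R) by exact: measurable_indic.
pose a m : 'rV[R]_d := - (2 * delta * m%:R) *: delta_mx ord0 i.
(* The [n] shifts have length at most 1, which accounts for the side [2 * rho + 1] of the cube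
   containing all translates. *)
have l0 : 0 <= 2 * rho + 1 by lra.
pose c : 'rV[R]_d := const_mx (- rho).
have key w : \sum_(m < n) \1_S (w + a m) <= \1_(cube c (2 * rho + 1)) w :> R.
  have aE m k : a m ord0 k = if k == i then - (2 * delta * m%:R) else 0.
    by rewrite !mxE eqxx /= eq_sym; case: eqP => _; rewrite ?mulr1 ?mulr0.
  have wE m k : (w + a m) ord0 k = w ord0 k + a m ord0 k by rewrite !mxE.
  have zE m k : (v - (w + a m)) ord0 k = v ord0 k - (w ord0 k + a m ord0 k) by rewrite !mxE.
  have [[m0 Sm0]|no] := pselect (exists m : 'I_n, S (w + a m)); last first.
    rewrite big1// => m _; rewrite indicE memNset// => Sm; apply: no; by exists m.
  have [wb wd] := Sm0.
  rewrite (bigD1 m0)//= big1 ?addr0; last first.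
    move=> m mm0; rewrite indicE memNset// => -[_].
    move: wd; rewrite !zE !aE eqxx eq_sym (negbTE ij) addr0.
    set p := v ord0 i; set q := w ord0 i; set b := lam * _.
    rewrite !ltr_norml => /andP[h1 h2] /andP[h3 h4].
    have : (m%:R - m0%:R : R) < 1 by rewrite -(ltr_pM2l de0); lra.
    have : (m0%:R - m%:R : R) < 1 by rewrite -(ltr_pM2l de0); lra.
    have [mlt|mlt|/val_inj mE] := ltngtP m m0; last by rewrite mE eqxx in mm0.
    - have : (m.+1%:R : R) <= m0%:R by rewrite ler_nat.
      by rewrite -natr1; lra.
    - have : (m0.+1%:R : R) <= m%:R by rewrite ler_nat.
      by rewrite -natr1; lra.
  rewrite [leLHS]indicE mem_set// indicE mem_set// => k; rewrite /c mxE.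
  have := wb k; rewrite wE aE ler_norml => /andP[h1 h2].
  have t0 : 0 <= 2 * delta * m0%:R by rewrite !mulr_ge0// ltW.
  have t1 : 2 * delta * m0%:R <= 1.
    by rewrite -[X in _ <= X]de (mulrC delta 2) ler_wpM2l ?mulr_ge0 ?(ltW de0)// ler_nat ltnW.
  by move: h1 h2; case: ifP => _ h1 h2; apply/andP; split; lra.
have mIa m : measurable_fun setT (fun w => \1_S (w + a m) : R).
  by apply: (measurableT_comp mI); exact: measurable_rVD.
have I0 w : 0 <= \1_S w :> R by [].
have vol : (\int[mu]_w (\sum_(m < n) \1_S (w + a m))%:E = (n%:R)%:E * mu S)%E.
  under eq_integral do rewrite -sumEFin.
  rewrite ge0_integral_sum//; last by move=> m; exact/measurable_EFinP.
  rewrite (eq_bigr (fun=> mu S)); last first.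
    move=> m _; rewrite (@ge0_integral_rV_shift R d (a m) (fun w => (\1_S w)%:E))//.
      by rewrite integral_indic// setIT.
    exact/measurable_EFinP.
  by rewrite sumr_const card_ord mule_natl.
have cv : (mu (cube c (2 * rho + 1)) = ((2 * rho + 1) ^+ d)%:E)%E.
  exact: lebesgue_rV_cube.
have mc := @measurable_cube R d c (2 * rho + 1).
have : ((n%:R)%:E * mu S <= ((2 * rho + 1) ^+ d)%:E)%E.
  rewrite -vol -cv -(setIT (cube _ _)) -integral_indic//.
  apply: ge0_le_integral => //.
  - by move=> w _; rewrite lee_fin sumr_ge0.
  - by apply/measurable_EFinP; apply: measurable_sum.
  - by apply/measurable_EFinP; exact: measurable_indic.
  - by move=> w _; rewrite lee_fin.
move=> H; rewrite -(@lee_pmul2l _ (n%:R)%:E)// ?lte_fin//.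
by rewrite -EFinM mulrC divfK// gt_eqF.
Qed.

End slab.

Section coercivity.
Context {R : realType} {d : nat}.
Local Notation mu := (lebesgue_rV R d).
Implicit Types (v w e : 'rV[R]_d) (k g : R) (f : 'rV[R]_d -> R).

Lemma sqr_enormB_le v w : enorm (v - w) ^+ 2 <= 2 * enorm v ^+ 2 + 2 * enorm w ^+ 2.
Proof.
rewrite (le_trans (sqr_enormD_le v (- w)))// lerD2l ler_wpM2l// !sqr_enorm.
rewrite le_eqVlt; apply/orP; left; apply/eqP; apply: eq_bigr => i _; rewrite !mxE; ring.
Qed.

Lemma powR_le_1Dsqr (x p : R) : 0 <= x -> 0 <= p <= 2 -> x `^ p <= 1 + x ^+ 2.
Proof.
move=> x0 /andP[p0 p2]; have x2 := sqr_ge0 x; have [x1|x1] := leP x 1.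
  have : x `^ p <= 1 `^ p by rewrite ge0_ler_powR ?nnegrE.
  by rewrite powR1; lra.
have : x `^ p <= x `^ 2 by rewrite ler_powR// ltW.
by rewrite powR_mulrn//; lra.
Qed.

Lemma potential_ltey_nneg (p : R) f v : 0 <= p <= 2 -> density f -> mass f = 1%E ->
  (second_moment f < +oo)%E -> (potential p f v < +oo)%E.
Proof.
move=> p02 [mf f0] f1 f2.
have mn : measurable_fun setT (fun w => f w * enorm w ^+ 2).
  by apply: measurable_funM => //; apply: measurable_funX; exact: measurable_enorm.
have c0 : 0 <= 1 + 2 * enorm v ^+ 2 by rewrite addr_ge0// mulr_ge0// sqr_ge0.
have ff0 w : 0 <= f w * enorm w ^+ 2 by rewrite mulr_ge0 ?sqr_ge0.
apply: (@le_lt_trans _ _ ((1 + 2 * enorm v ^+ 2)%:E * mass f + 2%:E * second_moment f)%E).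
  rewrite /mass /second_moment -!ge0_integralZl//; last 4 first.
  - exact/measurable_EFinP.
  - by move=> w _; rewrite lee_fin.
  - exact/measurable_EFinP.
  - by move=> w _; rewrite lee_fin.
  rewrite -ge0_integralD//; last 4 first.
  - by move=> w _; rewrite mule_ge0 ?lee_fin.
  - by apply: measurable_funeM; exact/measurable_EFinP.
  - by move=> w _; rewrite mule_ge0 ?lee_fin.
  - by apply: measurable_funeM; exact/measurable_EFinP.
  apply: ge0_le_integral => //.
  - by move=> w _; rewrite lee_fin mulr_ge0 ?powR_ge0.
  - apply/measurable_EFinP.
    exact: (measurableT_comp (measurable_kernel p mf) (measurable_pair1 v)).
  - by apply: emeasurable_funD; apply: measurable_funeM; exact/measurable_EFinP.
  move=> w _; rewrite -!EFinM -EFinD lee_fin.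
  rewrite [leRHS](_ : _ = (1 + 2 * enorm v ^+ 2 + 2 * enorm w ^+ 2) * f w); last by ring.
  rewrite ler_wpM2r// (le_trans (powR_le_1Dsqr (enorm_ge0 _) p02))//.
  by rewrite -addrA lerD2l sqr_enormB_le.
rewrite f1 mule1 lte_add_pinfty ?ltry//.
by rewrite lte_mul_pinfty.
Qed.

(** The left factor and the form combine into [|z|^g (|z|^2 |e|^2 - (z.e)^2)]. The bracket is at
    least [(e_j u)^2] by [lagrange_le], a largest coordinate satisfies [e_j^2 >= |e|^2 / d], and
    [|z|] is at most a multiple of [<v>] since [w] is bounded, which gives [<v>^g] as [g <= 0]. *)
Lemma kernel_lower_bound (g delta rho : R) v w e i j :
  i != j -> g <= 0 -> 0 < delta -> e ord0 j != 0 ->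
  (forall l, `|e ord0 l| <= `|e ord0 j|) -> (forall l, `|w ord0 l| <= rho) ->
  delta <= `|(v - w) ord0 i - e ord0 i / e ord0 j * (v - w) ord0 j| ->
  delta ^+ 2 / d%:R * (2 + 2 * d%:R * rho ^+ 2) `^ g * bracket v `^ g * edot e e <=
  enorm (v - w) `^ (2 + g) * qform (Pi (v - w)) e.
Proof.
move=> ij g0 delta0 ej0 emax wrho; set z := v - w; set u := z ord0 i - _ => du.
have d0 : 0 < d%:R :> R by rewrite ltr0n (leq_ltn_trans (leq0n i) (ltn_ord i)).
set n := enorm z; set B := 2 + _.
have rho2 : 0 <= 2 * d%:R * rho ^+ 2 by apply: mulr_ge0; [rewrite mulr_ge0 ?ler0n|exact: sqr_ge0].
have B0 : 0 < B by rewrite /B; lra.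
have n0 : 0 < n.
  rewrite lt_def enorm_ge0 andbT; apply/eqP => nz.
  have zl l : z ord0 l = 0.
    by apply/eqP; rewrite -normr_le0 -nz; exact: coord_le_enorm.
  by move: du; rewrite /u !zl mulr0 subrr normr0 leNgt delta0.
have n2 : 0 < n ^+ 2 by rewrite exprn_gt0.
have -> : n `^ (2 + g) * qform (Pi z) e = n `^ g * (edot z z * edot e e - edot z e ^+ 2).
  rewrite qform_Pi -/n powRD; last by rewrite (gt_eqF n0) implybT.
  by rewrite powR_mulrn ?(ltW n0)// -(sqr_enorm z) -/n; field; rewrite gt_eqF.
have ub : delta ^+ 2 <= u ^+ 2.
  by rewrite -(real_normK (num_real u)) lerXn2r ?nnegrE ?(ltW delta0).
have ee : edot e e <= d%:R * e ord0 j ^+ 2.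
  apply: (@le_trans _ _ (\sum_(l < d) e ord0 j ^+ 2)).
    apply: ler_sum => l _; rewrite -expr2 -(real_normK (num_real (e ord0 l))).
    by rewrite -(real_normK (num_real (e ord0 j))) lerXn2r ?nnegrE.
  by rewrite sumr_const card_ord mulr_natl.
have lag : e ord0 j ^+ 2 * u ^+ 2 <= edot z z * edot e e - edot z e ^+ 2.
  apply: le_trans (lagrange_le z e ij); rewrite -exprMn /u le_eqVlt; apply/orP; left.
  by apply/eqP; congr (_ ^+ 2); field.
have nB : n <= B * bracket v.
  rewrite -(@ler_sqr R) ?nnegrE ?mulr_ge0 ?(ltW n0) ?(ltW B0) ?(ltW (bracket_gt0 _))//.
  rewrite exprMn sqr_bracket (le_trans (sqr_enormB_le v w))//.
  have ww : enorm w ^+ 2 <= d%:R * rho ^+ 2.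
    rewrite sqr_enorm; apply: (@le_trans _ _ (\sum_(l < d) rho ^+ 2)).
      apply: ler_sum => l _; rewrite -expr2 -(real_normK (num_real (w ord0 l))).
      by rewrite lerXn2r ?nnegrE// (le_trans _ (wrho l)).
    by rewrite sumr_const card_ord mulr_natl.
  apply: (@le_trans _ _ (B * (1 + enorm v ^+ 2))).
    by have := sqr_ge0 (enorm v); rewrite /B; nra.
  rewrite ler_wpM2r ?addr_ge0 ?sqr_ge0// expr2 ler_peMr ?(ltW B0)//.
  by rewrite /B; lra.
have gB : B `^ g * bracket v `^ g <= n `^ g.
  rewrite -powRM ?(ltW B0) ?(ltW (bracket_gt0 _))//.
  exact: ler_npowR.
rewrite [leLHS](_ : _ = (B `^ g * bracket v `^ g) * (delta ^+ 2 / d%:R * edot e e)); last by ring.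
apply: ler_pM => //.
- by rewrite mulr_ge0 ?powR_ge0.
- by rewrite mulr_ge0 ?edot_ge0// divr_ge0 ?sqr_ge0// ltW.
apply: le_trans lag; rewrite mulrAC ler_pdivrMr//.
rewrite [leRHS](_ : _ = u ^+ 2 * (d%:R * e ord0 j ^+ 2)); last by ring.
by apply: ler_pM => //; [exact: sqr_ge0|exact: edot_ge0].
Qed.

Lemma diffusion_coercive k g (h : \bar R) : 0 < k -> -2 < g <= 0 -> (1 < d)%N ->
  exists2 a0 : R, 0 < a0 & forall f, density f -> mass f = 1%E ->
    second_moment f = d%:R%:E -> entropy f = h -> (h < +oo)%E ->
    forall v e, a0 * bracket v `^ g * edot e e <= qform (diffusion k g f v) e.
Proof.
move=> k0 /andP[g2 g0] d1.
have d0 : 0 < d%:R :> R by rewrite ltr0n ltnW.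
have [c c0 cP] := @entropy_pos_bound R d.
pose E := `|fine h| + c.
have E0 : 0 <= E by rewrite addr_ge0.
(* High values: [E / ln M <= 1/8], so the part of the slab where [f > M] carries at most 1/8 of the
   mass. *)
pose M := expR (8 * E + 1).
have M1 : 1 < M by rewrite expR_gt1; lra.
have lM : ln M = 8 * E + 1 by rewrite expRK.
(* Large velocities: by the second moment, the mass beyond [rho] is at most [d / rho^2 <= 1/4]. *)
pose rho : R := 2 * d%:R.
have rho0 : 0 < rho by rewrite mulr_gt0.
(* Low values: the slab is so thin that [M] times its volume is at most 1/8. At least half of the
   mass thus remains at bounded [w] outside the slab. *)
pose n := (Num.truncn (8 * M * (2 * rho + 1) ^+ d)).+1.
have nP : 8 * M * (2 * rho + 1) ^+ d <= n%:R by rewrite ltW// truncnS_gt.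
pose delta : R := (2 * n%:R)^-1.
have delta0 : 0 < delta by rewrite invr_gt0 mulr_gt0// ltr0n.
pose B : R := 2 + 2 * d%:R * rho ^+ 2.
have B0 : 0 < B.
  by rewrite /B ltr_pwDl//; apply: mulr_ge0; [rewrite mulr_ge0 ?ler0n|exact: sqr_ge0].
pose kap0 := delta ^+ 2 / d%:R * B `^ g.
have kap00 : 0 < kap0.
  by apply: mulr_gt0; [apply: divr_gt0 => //; exact: exprn_gt0|exact: powR_gt0].
exists (k * kap0 / 2); first by apply: divr_gt0 => //; exact: mulr_gt0.
move=> f df f1 f2 fh hoo v e; have [mf f0] := df.
have Poo : (potential (2 + g) f v < +oo)%E.
  apply: potential_ltey_nneg => //; last by rewrite f2 ltry.
  by apply/andP; split; lra.
have [->|e0] := eqVneq e 0.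
  rewrite (_ : edot 0 0 = 0); last by rewrite /edot big1// => l _; rewrite mxE mul0r.
  by rewrite mulr0; apply: qform_diffusion_ge0 => //; exact: ltW.
have [j ej] : exists j, `|e| = `|e ord0 j|.
  have e0' : mx_norm e != 0 by rewrite -[mx_norm e]/(`|e|) normr_eq0.
  have [[i' j'] /= E'] := mx_norm_neq0 e0'; exists j'.
  by rewrite -[LHS]/(mx_norm e) E' (ord1 i').
have emax l : `|e ord0 l| <= `|e ord0 j| by rewrite -ej coord_le_norm.
have ej0 : e ord0 j != 0 by rewrite -normr_eq0 -ej normr_eq0.
have [i ij] : exists i : 'I_d, i != j.
  have [j0|j0] := eqVneq (val j) 0%N.
    by exists (Ordinal d1); rewrite -val_eqE /= j0.
  by exists (Ordinal (ltnW d1)); rewrite -val_eqE /= eq_sym.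
have ee0 : 0 < edot e e.
  by rewrite lt_def edot_ge0 andbT; apply: contra e0 => /eqP/edot_eq0 ->.
pose kap := kap0 * bracket v `^ g * edot e e.
have kapp : 0 < kap.
  by apply: mulr_gt0 => //; apply: mulr_gt0 => //; rewrite powR_gt0// bracket_gt0.
pose X w := enorm (v - w) `^ (2 + g) * qform (Pi (v - w)) e * f w.
have X0 w : 0 <= X w by rewrite !mulr_ge0 ?powR_ge0 ?qform_Pi_ge0.
pose S := slab v i j (e ord0 i / e ord0 j) rho delta.
have mS : measurable S by exact: measurable_slab.
pose P w := Num.max 0 (f w * ln (f w)).
have P0 w : 0 <= P w by rewrite le_max lexx.
pose Y w := f w * enorm w ^+ 2.
have Y0 w : 0 <= Y w by rewrite mulr_ge0 ?sqr_ge0.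
have lMp : 0 < ln M by rewrite lM; lra.
have kY : 0 <= kap / rho ^+ 2 by apply: divr_ge0; [exact: ltW|exact: sqr_ge0].
have kI : 0 <= kap * M by apply: mulr_ge0; [exact: ltW|exact: expR_ge0].
have kP : 0 <= kap / ln M by apply: divr_ge0; exact: ltW.
(* Each [w] falls under one of three cases: [w] is far, [w] lies in the slab, or the kernel is
   bounded below. The first two are paid for by the moment, volume and entropy terms. *)
have pt w : kap * f w <= X w + (kap / rho ^+ 2 * Y w + (kap * M * \1_S w + kap / ln M * P w)).
  have A1 : 0 <= kap / rho ^+ 2 * Y w by apply: mulr_ge0.
  have A2 : 0 <= kap * M * \1_S w by apply: mulr_ge0; first exact: kI.
  have A3 : 0 <= kap / ln M * P w by apply: mulr_ge0.
  have X0' := X0 w.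
  have [wrho|/existsNP[l /negP]] := pselect (forall l, `|w ord0 l| <= rho); last first.
    rewrite -ltNge => wl; suff : kap * f w <= kap / rho ^+ 2 * Y w by lra.
    rewrite [leRHS](_ : _ = kap * (f w * (enorm w ^+ 2 / rho ^+ 2))); last by rewrite /Y; ring.
    rewrite (ler_pM2l kapp) ler_peMr// ler_pdivlMr ?exprn_gt0// mul1r.
    rewrite lerXn2r ?nnegrE ?(ltW rho0) ?enorm_ge0//.
    exact: le_trans (ltW wl) (coord_le_enorm _ _).
  have [ud|du] := ltP `|(v - w) ord0 i - e ord0 i / e ord0 j * (v - w) ord0 j| delta.
    suff : kap * f w <= kap * M * \1_S w + kap / ln M * P w by lra.
    rewrite [leRHS](_ : _ = kap * (M + P w / ln M)); last by rewrite indicE mem_set// mulr1; ring.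
    by rewrite (ler_pM2l kapp); exact: le_entropy_tail.
  suff : kap * f w <= X w by lra.
  exact: (ler_wpM2r (f0 w) (kernel_lower_bound ij g0 delta0 ej0 emax wrho du)).
have mX : measurable_fun setT X.
  have mz : measurable_fun setT (fun w => v - w) by exact: measurable_rVB.
  have mn := measurable_enorm mz.
  apply: measurable_funM => //; apply: measurable_funM.
    exact: (measurableT_comp (measurable_powR (2 + g)) mn).
  under eq_fun do rewrite qform_Pi; apply: measurable_funB => //.
  apply: measurable_funM; first by apply: measurable_invr; exact: measurable_funX.
  by apply: measurable_funX; exact: measurable_edot.
have mY : measurable_fun setT Y.
  by apply: measurable_funM => //; apply: measurable_funX; exact: measurable_enorm.
have mP : measurable_fun setT P by apply: measurable_maxr => //; exact: measurable_xlnx.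
have mI : measurable_fun setT (\1_S : 'rV[R]_d -> R) by exact: measurable_indic.
have mE (F : 'rV[R]_d -> R) : measurable_fun setT F -> measurable_fun setT (EFin \o F).
  by move=> mF; exact/measurable_EFinP.
have intZ (q : R) (F : 'rV[R]_d -> R) : 0 <= q -> measurable_fun setT F -> (forall w, 0 <= F w) ->
    (\int[mu]_w (q * F w)%:E = q%:E * \int[mu]_w (F w)%:E)%E.
  move=> q0 mF F0; under eq_integral do rewrite EFinM.
  by rewrite ge0_integralZl//; [exact: mE|move=> w _; rewrite lee_fin].
have I0 w : 0 <= \1_S w :> R by [].
pose I := (\int[mu]_w (X w)%:E)%E.
have step : (kap%:E <= I + (kap / 2)%:E)%E.
  rewrite -[leLHS]mule1 -f1 /mass -intZ ?(ltW kapp)//.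
  apply: (@le_trans _ _ (\int[mu]_w ((X w)%:E + ((kap / rho ^+ 2 * Y w)%:E +
      ((kap * M * \1_S w)%:E + (kap / ln M * P w)%:E))))%E).
    apply: ge0_le_integral => //.
    - by move=> w _; rewrite lee_fin mulr_ge0// ltW.
    - by apply: mE; exact: measurable_funM.
    - apply: emeasurable_funD; first exact: mE.
      apply: emeasurable_funD; first by apply: mE; exact: measurable_funM.
      by apply: emeasurable_funD; apply: mE; exact: measurable_funM.
    by move=> w _; rewrite -!EFinD lee_fin.
  have m1 : measurable_fun setT (fun w => (kap / rho ^+ 2 * Y w)%:E).
    by apply: mE; exact: measurable_funM.
  have m2 : measurable_fun setT (fun w => (kap * M * \1_S w)%:E).
    by apply: mE; exact: measurable_funM.
  have m3 : measurable_fun setT (fun w => (kap / ln M * P w)%:E).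
    by apply: mE; exact: measurable_funM.
  have p1 w : (0 <= (kap / rho ^+ 2 * Y w)%:E)%E by rewrite lee_fin mulr_ge0.
  have p2 w : (0 <= (kap * M * \1_S w)%:E)%E by rewrite lee_fin mulr_ge0.
  have p3 w : (0 <= (kap / ln M * P w)%:E)%E by rewrite lee_fin mulr_ge0.
  have m23 := emeasurable_funD m2 m3; have m123 := emeasurable_funD m1 m23.
  rewrite (ge0_integralD _ measurableT _ (mE _ mX) _ m123)//; last 2 first.
  - by move=> w _; rewrite lee_fin.
  - by move=> w _; rewrite !adde_ge0.
  rewrite leeD2l//.
  rewrite (ge0_integralD _ measurableT _ m1 _ m23)//; last first.
    by move=> w _; rewrite adde_ge0.
  rewrite (ge0_integralD _ measurableT _ m2 _ m3)//.
  rewrite !intZ//.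
  have YE : (\int[mu]_w (Y w)%:E = d%:R%:E)%E by rewrite -f2.
  have SE : (\int[mu]_w (\1_S w)%:E = mu S)%E by rewrite integral_indic// setIT.
  have Svol : (mu S <= ((2 * rho + 1) ^+ d / n%:R)%:E)%E by apply: slab_volume => //; exact: ltW.
  have PE : (\int[mu]_w (P w)%:E <= E%:E)%E.
    by rewrite /E -fh; apply: cP => //; rewrite fh.
  rewrite YE SE.
  apply: (@le_trans _ _ ((kap / rho ^+ 2)%:E * d%:R%:E + ((kap * M)%:E *
      ((2 * rho + 1) ^+ d / n%:R)%:E + (kap / ln M)%:E * E%:E))%E).
    by rewrite leeD2l//; apply: leeD; apply: lee_wpmul2l => //; rewrite lee_fin.
  rewrite -!EFinM -!EFinD lee_fin.
  have n0 : 0 < n%:R :> R by rewrite ltr0n.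
  have b1 : d%:R / rho ^+ 2 <= 4^-1.
    rewrite ler_pdivrMr ?exprn_gt0// /rho.
    have : 1 <= d%:R :> R by rewrite ler1n ltnW.
    by nra.
  have b2 : M * ((2 * rho + 1) ^+ d / n%:R) <= 8^-1.
    rewrite mulrA ler_pdivrMr//; move: nP; lra.
  have b3 : E / ln M <= 8^-1 by rewrite ler_pdivrMr// lM; lra.
  rewrite [leLHS](_ : _ = kap * (d%:R / rho ^+ 2 + (M * ((2 * rho + 1) ^+ d / n%:R) + E / ln M))).
    by rewrite ler_pM2l//; lra.
  ring.
have Ige : ((kap / 2)%:E <= I)%E.
  have : (kap%:E - (kap / 2)%:E <= I)%E by rewrite leeBlDr.
  by rewrite -EFinB; congr (_%:E <= _)%E; lra.
have := qform_diffusion k e df Poo; rewrite -/I => Q.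
have : ((k * (kap / 2))%:E <= (qform (diffusion k g f v) e)%:E)%E.
  by rewrite Q EFinM; apply: lee_wpmul2l => //; rewrite lee_fin ltW.
rewrite lee_fin; apply: le_trans; rewrite /kap le_eqVlt; apply/orP; left; apply/eqP; ring.
Qed.

End coercivity.

(** * Global estimates from estimates on cubes *)

Section assembly.
Context {R : realType} {d : nat}.
Local Notation mu := (lebesgue_rV R d).
Implicit Types (v w x : 'rV[R]_d) (phi f a : 'rV[R]_d -> R) (k g L : R).

Lemma sqr_sum_le n (y : 'I_n -> R) : (\sum_i y i) ^+ 2 <= n%:R * \sum_i y i ^+ 2.
Proof.
rewrite expr2 big_distrlr /=.
apply: (@le_trans _ _ (\sum_(i < n) \sum_(j < n) 2^-1 * (y i ^+ 2 + y j ^+ 2))).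
  apply: ler_sum => i _; apply: ler_sum => j _.
  by have := sqr_ge0 (y i - y j); rewrite sqrrB; lra.
rewrite le_eqVlt; apply/orP; left; apply/eqP.
rewrite (eq_bigr (fun i => 2^-1 * (n%:R * y i ^+ 2 + \sum_j y j ^+ 2))); last first.
  by move=> i _; rewrite -mulr_sumr big_split/= sumr_const card_ord mulr_natl.
rewrite -mulr_sumr big_split/= -mulr_sumr sumr_const card_ord -[X in _ + X]mulr_natl.
by field.
Qed.

Lemma sqr_gradsum_le phi x : gradsum phi x ^+ 2 <= d%:R * edot (grad phi x) (grad phi x).
Proof.
apply: (le_trans (sqr_sum_le _)); rewrite ler_wpM2l//; apply: ler_sum => i _.
by rewrite mxE -expr2 real_normK ?num_real.
Qed.

Lemma weighted_gradient_le phi L k g f a : 0 < L ->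
  (forall x y, `|phi x - phi y| <= L * `|x - y|) -> measurable_fun setT f ->
  measurable_fun setT a -> (forall x, 0 <= a x) ->
  {ae mu, forall x, forall e, a x * edot e e <= qform (diffusion k g f x) e} ->
  (\int[mu]_x (gradsum phi x ^+ 2 * a x)%:E <= d%:R%:E * int_diffusion k g f phi)%E.
Proof.
move=> L0 phiL mf ma a0 aq.
have mg := measurable_gradsum L0 phiL.
have mgrad : measurable_fun setT (grad phi).
  apply/measurable_fun_rVP => i.
  rewrite (_ : (fun x => _) = 'D_(delta_mx ord0 i) phi).
    exact: measurable_derive_lipschitz phiL _.
  by apply/funext => x; rewrite mxE.
pose q x := qform (diffusion k g f x) (grad phi x).
have mq : measurable_fun setT q by exact: measurable_qform_diffusion.
(* The quadratic form is nonnegative almost everywhere only; its positive part has the same integral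
   and allows nonnegative integration. *)
have qE : int_diffusion k g f phi = (\int[mu]_x (Num.max 0 (q x))%:E)%E.
  rewrite /int_diffusion; apply: ae_eq_integral => //.
  - exact/measurable_EFinP.
  - by apply/measurable_EFinP; exact: measurable_maxr.
  apply: filterS aq => x xq _ /=; rewrite max_r//; apply: le_trans (xq _).
  by rewrite mulr_ge0 ?edot_ge0.
have mm : measurable_fun setT (fun x => (Num.max 0 (q x))%:E).
  by apply/measurable_EFinP; exact: measurable_maxr.
rewrite qE -ge0_integralZl//; last by move=> x _; rewrite lee_fin le_max lexx.
apply: ae_ge0_le_integral => //.
- by move=> x _; rewrite lee_fin mulr_ge0 ?sqr_ge0.
- by apply/measurable_EFinP; apply: measurable_funM => //; exact: measurable_funX.
- by move=> x _; rewrite mule_ge0// lee_fin le_max lexx.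
- exact: measurable_funeM.
apply: filterS aq => x xq _; rewrite -EFinM lee_fin.
apply: (@le_trans _ _ (d%:R * edot (grad phi x) (grad phi x) * a x)).
  by rewrite ler_wpM2r// sqr_gradsum_le.
by rewrite -mulrA ler_wpM2l// mulrC le_max xq orbT.
Qed.

Lemma test_functionP phi : test_function phi ->
  exists L M : R, [/\ 0 < L, forall x y, `|phi x - phi y| <= L * `|x - y| &
    forall x, M < `|x| -> phi x = 0].
Proof.
move=> [/lipschitzP[L L0 phiL] cphi]; have [M [_ MP]] := compact_bounded cphi.
exists L, (M + 1); split => // x Mx; apply/eqP/negP => /negP phix.
have := MP (M + 1); rewrite ltrDl => /(_ ltr01 x) /=.
have cx : closure [set v | phi v != 0] x by apply: subset_closure; exact: phix.
by move=> /(_ cx); rewrite leNgt Mx.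
Qed.

Lemma local_to_global phi f a (b : 'rV[R]_d -> R) (H : 'rV[R]_d -> \bar R)
    (L M k g r e1 e K : R) : (0 < d)%N -> 0 < L ->
  (forall x y, `|phi x - phi y| <= L * `|x - y|) ->
  (forall x, M < `|x| -> phi x = 0) -> measurable_fun setT f ->
  measurable_fun setT a -> (forall x, 0 <= a x) ->
  measurable_fun setT b -> (forall x, 0 <= b x) ->
  measurable_fun setT H -> (forall x, 0 <= H x)%E ->
  0 < r -> 0 <= e1 -> e1 * d%:R <= e -> 0 <= K ->
  {ae mu, forall x, forall e, a x * edot e e <= qform (diffusion k g f x) e} ->
  (forall v, \int[mu]_(x in hcube v r) ((phi x ^+ 2)%:E * H x) <=
     e1%:E * \int[mu]_(x in hcube v r) (gradsum phi x ^+ 2 * a x)%:E +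
     K%:E * \int[mu]_(x in hcube v r) (phi x ^+ 2 * b x)%:E)%E ->
  (\int[mu]_x ((phi x ^+ 2)%:E * H x) <= e%:E * int_diffusion k g f phi +
     K%:E * \int[mu]_x (phi x ^+ 2 * b x)%:E)%E.
Proof.
move=> d0 L0 phiL phiM mf ma a0 mb b0 mH H0 r0 e10 e1e K0 aq cube.
have mphi : measurable_fun setT phi := measurable_lipschitz_rV L0 phiL.
have mphi2 : measurable_fun setT (fun x => phi x ^+ 2) by exact: measurable_funX.
have mg := measurable_gradsum L0 phiL.
have wg := weighted_gradient_le L0 phiL mf ma a0 aq.
have := @covering R d _ (fun x => (gradsum phi x ^+ 2 * a x)%:E)
  (fun x => (phi x ^+ 2 * b x)%:E) r e1 K M r0 e10 K0 _ _ _ _ _ _ _ cube.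
move=> cov; apply: (le_trans (cov _ _ _ _ _ _ _)) => {cov}.
- by apply: emeasurable_funM => //; exact/measurable_EFinP.
- by apply/measurable_EFinP; apply: measurable_funM => //; exact: measurable_funX.
- by apply/measurable_EFinP; exact: measurable_funM.
- by move=> x; rewrite mule_ge0// lee_fin sqr_ge0.
- by move=> x; rewrite lee_fin mulr_ge0 ?sqr_ge0.
- by move=> x; rewrite lee_fin mulr_ge0 ?sqr_ge0.
- by move=> x /phiM ->; rewrite expr0n/= mul0e.
rewrite leeD2r//.
have G0 : (0 <= \int[mu]_x (gradsum phi x ^+ 2 * a x)%:E)%E.
  by apply: integral_ge0 => x _; rewrite lee_fin mulr_ge0 ?sqr_ge0.
have d0' : 0 < d%:R :> R by rewrite ltr0n.
have D0 : (0 <= int_diffusion k g f phi)%E.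
  by rewrite -(@pmule_rge0 _ d%:R%:E) ?lte_fin// (le_trans G0).
apply: (@le_trans _ _ (e1%:E * (d%:R%:E * int_diffusion k g f phi))%E).
  by apply: lee_wpmul2l.
rewrite muleA -EFinM; apply: lee_wpmul2r => //; by rewrite lee_fin.
Qed.

End assembly.

(** * Very soft potentials *)

Section singular_potentials.
Context {R : realType} {d : nat}.
Local Notation mu := (lebesgue_rV R d).
Implicit Types (v w x : 'rV[R]_d) (phi f a : 'rV[R]_d -> R) (k g L s : R) (eta : R -> R).

(** The total coefficient of [eta(r)^2] in front of the diffusion term: the one of [cube_step] times
    the factor [d] from [gradsum]. *)
Definition poincare_scale s : R := d%:R * (2 * (2 * weighted_poincare_cst (d := d) s) ^+ 2).

(** Radii are chosen along the thresholds [1 / (n + 1)] so that summing their inverse powers up to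
    [1 / eps] gives a monotone function of [eps], whatever the choices are. *)
Definition radius s eta (n : nat) : R :=
  xget 1 [set r | 0 < r < 1 /\ poincare_scale s * eta r ^+ 2 <= n.+1%:R^-1].

(* The term [eps^-1] makes the function strictly decreasing and unbounded. *)
Definition inverse_modulus s eta (eps : R) : R :=
  \sum_(n < (Num.truncn eps^-1).+1) (radius s eta n ^+ d)^-1 + eps^-1.

Lemma radiusP s eta n : 1 < s -> modulus eta ->
  0 < radius s eta n < 1 /\ poincare_scale s * eta (radius s eta n) ^+ 2 <= n.+1%:R^-1.
Proof.
move=> s1 [eta_gt0 _ eta0]; rewrite /radius; case: xgetP => [r -> //|none]; exfalso.
have D0 : 0 <= poincare_scale s.
  by rewrite /poincare_scale; apply: mulr_ge0 => //; apply: mulr_ge0 => //; exact: sqr_ge0.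
have cv : (poincare_scale s * (eta r * eta r)) @[r --> 0^'+] --> poincare_scale s * (0 * 0).
  exact: (cvgM (cvg_cst _) (cvgM eta0 eta0)).
rewrite !mulr0 in cv.
have n0 : (0 : R) < n.+1%:R^-1 by rewrite invr_gt0.
have n1 : \forall r \near (0 : R)^'+, poincare_scale s * (eta r * eta r) < n.+1%:R^-1.
  exact: (cvgr_lt _ cv _ n0).
have n2 : \forall r \near (0 : R)^'+, 0 < r by exact: nbhs_right_gt.
have n3 : \forall r \near (0 : R)^'+, r < 1 by exact: nbhs_right_lt.
have : \forall r \near (0 : R)^'+, 0 < r < 1 /\ poincare_scale s * eta r ^+ 2 <= n.+1%:R^-1.
  by apply: filterS3 n1 n2 n3 => r h1 -> ->; rewrite expr2; split => //; exact: ltW.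
by move=> /filter_ex[r]; exact: none.
Qed.

Lemma radius_ge0 s eta n : 0 <= radius s eta n.
Proof. by rewrite /radius; case: xgetP => // r -> [/andP[/ltW]]. Qed.

Lemma inverse_modulus_decr s eta (x y : R) : 0 < x -> x < y -> inverse_modulus s eta y < inverse_modulus s eta x.
Proof.
move=> x0 xy; have y0 := lt_trans x0 xy.
have yx : y^-1 < x^-1 by rewrite ltf_pV2.
rewrite /inverse_modulus ler_ltD//.
have le : ((Num.truncn y^-1).+1 <= (Num.truncn x^-1).+1)%N by rewrite ltnS; apply: le_truncn; exact: ltW.
rewrite -!(big_mkord xpredT (fun n => (radius s eta n ^+ d)^-1)).
rewrite [leRHS](big_cat_nat (n := (Num.truncn y^-1).+1))//= lerDl.
by apply: sumr_ge0 => n _; rewrite invr_ge0 exprn_ge0// radius_ge0.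
Qed.

Lemma inverse_modulus_cvg s eta : inverse_modulus s eta x @[x --> 0^'+] --> +oo.
Proof.
apply/cvgryPge => A.
have e0 : 0 < (1 + `|A|)^-1 by rewrite invr_gt0 ltr_pwDl.
have n2 : \forall r \near (0 : R)^'+, 0 < r by exact: nbhs_right_gt.
have n3 : \forall r \near (0 : R)^'+, r < (1 + `|A|)^-1 by exact: nbhs_right_lt.
apply: filterS2 n2 n3 => x x0 x1; rewrite /inverse_modulus.
have S0 : 0 <= \sum_(n < (Num.truncn x^-1).+1) (radius s eta n ^+ d)^-1.
  by apply: sumr_ge0 => n _; rewrite invr_ge0 exprn_ge0// radius_ge0.
have : 1 + `|A| < x^-1 by rewrite -[1 + _]invrK ltf_pV2 ?posrE.
by have := ler_norm A; move: S0; lra.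
Qed.

(** For [n] the integer part of [1 / eps] one has [1 / (n + 1) < eps], and the radius of index [n]
    provides the last summand of [inverse_modulus]. *)
Lemma radius_le_inverse_modulus s eta (eps : R) : 1 < s -> modulus eta -> 0 < eps ->
  let r := radius s eta (Num.truncn eps^-1) in
  poincare_scale s * eta r ^+ 2 <= eps /\ (r ^+ d)^-1 <= inverse_modulus s eta eps.
Proof.
move=> s1 etam eps0 r; have [_ rP] := radiusP (Num.truncn eps^-1) s1 etam; split.
  apply: (le_trans rP); rewrite -[leRHS]invrK lef_pV2 ?posrE ?invr_gt0//.
  by rewrite ltW// truncnS_gt.
rewrite /inverse_modulus big_ord_recr/= -/r -addrA addrCA lerDl addr_ge0 ?invr_ge0 ?(ltW eps0)//.
by apply: sumr_ge0 => n _; rewrite invr_ge0 exprn_ge0// radius_ge0.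
Qed.

Lemma astar_ae_coercive k g f : 0 <= k -> density f ->
  {ae mu, forall v, (potential (2 + g) f v < +oo)%E} ->
  {ae mu, forall v, 0 <= astar k g f v /\
    forall e, Num.max 0 (astar k g f v) * edot e e <= qform (diffusion k g f v) e}.
Proof.
move=> k0 df; apply: filterS => v Poo.
have psd e : 0 <= qform (diffusion k g f v) e by exact: qform_diffusion_ge0.
by have a0 := astar_ge0 psd; split => // e; rewrite max_r//; exact: astar_le_qform.
Qed.

(** [reaction_constant] gives a sign to [k] for [g > - d] only; with [|k|] the bounds for
    nonnegative constants cover [g = - d] as well. *)
Lemma reaction_norm k g f : (- d%:R < g -> 0 <= k) -> - d%:R <= g ->
  reaction k g f = reaction `|k| g f.
Proof.
move=> kg dg; apply/funext => v; rewrite /reaction; have [//|gd] := eqVneq g (- d%:R).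
by rewrite ger0_norm// kg// lt_def gd.
Qed.

Definition singular_cst k g : R := 2 * (1 + `|k| * `|riesz_cst (d := d) g|).

Lemma reaction_le_diffusion (kA kh g s eps : R) f eta phi : (1 < d)%N ->
  0 < kA -> (- d%:R < g -> 0 <= kh) -> - d%:R <= g <= -2 ->
  density f -> mass f = 1%E -> (second_moment f < +oo)%E -> 1 < s -> modulus eta ->
  local_A2_smallness kA kh g s eta f -> test_function phi -> 0 < eps ->
  (int_reaction kh g f phi <= eps%:E * int_diffusion kA g f phi +
    (singular_cst kh g * inverse_modulus s eta eps)%:E * \int[mu]_v (phi v ^+ 2)%:E)%E.
Proof.
move=> d1 kA0 kh0 /andP[dg g2] df f1 f2 s1 etam A2 tphi eps0.
have [mf f0] := df.
have [L [M [L0 phiL phiM]]] := test_functionP tphi.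
have d0 : (0 < d)%N by exact: ltnW.
have d0' : 0 < d%:R :> R by rewrite ltr0n.
have [eta_gt0 eta_mono _] := etam.
pose r := radius s eta (Num.truncn eps^-1).
have [/andP[r0 r1] _] := radiusP (Num.truncn eps^-1) s1 etam.
have [reps rle] := radius_le_inverse_modulus s1 etam eps0.
rewrite -/r in r0 r1 reps rle.
have g0 : g < 0 by lra.
have mass_oo : (mass f < +oo)%E by rewrite f1 ltry.
have Poo : {ae mu, forall v, (potential (2 + g) f v < +oo)%E}.
  (* For [g < -2] the kernel of the diffusion is a singular Riesz kernel and the potential is finite
     almost everywhere; for [g = -2] its exponent is 0 and the mass bounds it everywhere. *)
  have [g2'|g2'] := ltP (2 + g) 0.
    by apply: potential_ae_ltey => //; apply/andP; split=> //; lra.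
  apply: nearW => v; apply: potential_ltey_nneg => //; apply/andP; split=> //; lra.
have aae := astar_ae_coercive (ltW kA0) df Poo.
have ma := measurable_astar kA g d0 mf.
have rE := reaction_norm f kh0 dg.
have mH := measurable_reaction kh g df.
have H0 v : (0 <= reaction kh g f v)%E by rewrite rE; exact: reaction_ge0.
pose Mr : R := 1 + `|kh| * `|riesz_cst (d := d) g|.
have Mr0 : 0 <= Mr by rewrite addr_ge0// mulr_ge0.
have er := eta_gt0 _ r0.
have K0 : 0 <= singular_cst kh g * inverse_modulus s eta eps.
  apply: mulr_ge0; first by apply: mulr_ge0.
  by apply: le_trans rle; rewrite invr_ge0 exprn_ge0// ltW.
have -> : (\int[mu]_v (phi v ^+ 2)%:E = \int[mu]_v (phi v ^+ 2 * 1)%:E)%E.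
  by under [RHS]eq_integral do rewrite mulr1.
rewrite /int_reaction.
apply: (@local_to_global R d phi f (fun x => Num.max 0 (astar kA g f x)) (fun=> 1)
  (reaction kh g f) L M kA g r
  (2 * (2 * weighted_poincare_cst (d := d) s * eta r) ^+ 2)) => //.
- exact: measurable_maxr.
- by move=> x; rewrite le_max lexx.
- by apply: mulr_ge0 => //; exact: sqr_ge0.
- apply: le_trans reps; rewrite le_eqVlt; apply/orP; left; apply/eqP.
  by rewrite /poincare_scale; ring.
- by apply: filterS aae => x [].
move=> v; under [X in (_ + _ * X)%E]eq_integral do rewrite mulr1.
apply: (le_trans (@cube_step R d (reaction kh g f) (astar kA g f) phi L s r (eta r) Mr v
  d0 mH H0 ma _ L0 phiL s1 r0 er Mr0 _ _)).
- by apply: filterS aae => x [].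
- rewrite rE; apply: reaction_hcube => //; first by rewrite dg.
  by rewrite r0 ltW.
- move=> v' l /andP[l0 lr]; apply: (le_trans (A2 v' l _)).
    by rewrite l0 (le_lt_trans lr).
  by rewrite lee_fin eta_mono.
rewrite leeD2l//; apply: lee_wpmul2r.
  by apply: integral_ge0 => x _; rewrite lee_fin sqr_ge0.
rewrite lee_fin /singular_cst -/Mr mulrA ler_wpM2l// mulr_ge0//.
Qed.

End singular_potentials.

(** * Moderately soft potentials *)

Section soft_potentials.
Context {R : realType} {d : nat}.
Local Notation mu := (lebesgue_rV R d).
Implicit Types (v w x : 'rV[R]_d) (f phi : 'rV[R]_d -> R) (k g l : R).

(** The first term bounds [x^g] for [x >= lam]; below [lam], write [x^g = x^(2 + g) x^(-2)] with
    [2 + g > 0]. *)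
Lemma powR_interpolation g (lam x : R) : -2 < g < 0 -> 0 < lam -> 0 <= x ->
  x `^ g <= lam `^ g + lam `^ (2 + g) * x `^ (-2).
Proof.
move=> /andP[g2 g0] lam0; rewrite le0r => /orP[/eqP->|x0].
  by rewrite powR0 ?lt_eqF// addr_ge0 ?mulr_ge0 ?powR_ge0.
have [lx|xl] := leP lam x.
  rewrite (le_trans (ler_npowR (ltW g0) lam0 lx))// lerDl.
  by rewrite mulr_ge0 ?powR_ge0.
apply: (@le_trans _ _ (lam `^ (2 + g) * x `^ (-2))); last by rewrite lerDr powR_ge0.
rewrite [leLHS](_ : _ = x `^ (2 + g) * x `^ (-2)).
  by rewrite ler_wpM2r ?powR_ge0// ge0_ler_powR ?nnegrE ?(ltW x0) ?(ltW lam0) ?(ltW xl)//; lra.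
by rewrite -powRD ?(gt_eqF x0) ?implybT//; congr (_ `^ _); lra.
Qed.

Lemma potential_interpolation g f v (lam : R) : -2 < g < 0 -> density f -> mass f = 1%E ->
  0 < lam ->
  (potential g f v <= (lam `^ g)%:E + (lam `^ (2 + g))%:E * potential (-2) f v)%E.
Proof.
move=> g02 df f1 lam0; have [mf f0] := df.
have mk p : measurable_fun setT (fun w => (enorm (v - w) `^ p * f w)%:E).
  apply/measurable_EFinP.
  exact: (measurableT_comp (measurable_kernel p mf) (measurable_pair1 v)).
have k0 p w : (0 <= (enorm (v - w) `^ p * f w)%:E)%E by rewrite lee_fin mulr_ge0 ?powR_ge0.
have mf' : measurable_fun setT (fun w => (f w)%:E) by exact/measurable_EFinP.
have f0' w : (0 <= (f w)%:E)%E by rewrite lee_fin.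
have m1 p (F : 'rV[R]_d -> \bar R) : measurable_fun setT F ->
    measurable_fun setT (fun w => p%:E * F w)%E by move=> mF; exact: measurable_funeM.
rewrite -[(lam `^ g)%:E]mule1 -f1 /mass /potential.
rewrite -(ge0_integralZl mu measurableT mf' (fun w _ => f0' w)) ?lee_fin ?powR_ge0//.
rewrite -(ge0_integralZl mu measurableT (mk (-2)) (fun w _ => k0 (-2) w)) ?lee_fin ?powR_ge0//.
have m2 := m1 (lam `^ g) _ mf'; have m3 := m1 (lam `^ (2 + g)) _ (mk (-2)).
rewrite -(ge0_integralD _ measurableT _ m2 _ m3); last 2 first.
- by move=> w _; rewrite mule_ge0// lee_fin powR_ge0.
- by move=> w _; rewrite mule_ge0// lee_fin powR_ge0.
apply: ge0_le_integral => //; first exact: emeasurable_funD m2 m3.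
move=> w _; rewrite -!EFinM -EFinD lee_fin mulrA -mulrDl ler_wpM2r//.
exact: (powR_interpolation g02 lam0 (enorm_ge0 _)).
Qed.

(* The second term keeps the potential positive, so that its power [-1/2] can
   serve as the interpolation scale below. *)
Definition reg_potential f x : \bar R := (potential (-2) f x + ((bracket x ^+ 2)^-1)%:E)%E.

Lemma bracket_sqr_gt0 x : 0 < bracket x ^+ 2.
Proof. by rewrite exprn_gt0 ?bracket_gt0. Qed.

Lemma measurable_bracket : measurable_fun setT (@bracket R d).
Proof.
apply: (measurableT_comp measurable_sqrt); apply: measurable_funD => //.
by apply: measurable_funX; exact: measurable_enorm.
Qed.

Lemma measurable_reg_potential f : density f -> measurable_fun setT (reg_potential f).
Proof.
move=> df; apply: emeasurable_funD; first exact: measurable_potential.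
apply/measurable_EFinP; apply: measurable_invr; apply: measurable_funX.
exact: measurable_bracket.
Qed.

Lemma reg_potential_gt0 f x : density f -> (0 < reg_potential f x)%E.
Proof.
move=> df; apply: (@lt_le_trans _ _ ((bracket x ^+ 2)^-1)%:E).
  by rewrite lte_fin invr_gt0 bracket_sqr_gt0.
by rewrite leeDr// potential_ge0.
Qed.

(** The scale [lam = j^(-1/2)], with [j] the regularised potential, makes both interpolation terms
    equal to [j^(- g / 2)]; the power [-2/g] turns this into [j]. *)
Lemma reaction_powR_le k g f x : 0 < k -> -2 < g < 0 -> density f -> mass f = 1%E ->
  ((k%:E * potential g f x) `^ (- (2 / g)) <=
   ((2 * k) `^ (- (2 / g)))%:E * reg_potential f x)%E.
Proof.
move=> k0 g02 df f1; have /andP[g2 g0] := g02; set s := - (2 / g).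
have s0 : 0 < s by rewrite oppr_gt0 pmulr_rlt0// invr_lt0.
have J0 := reg_potential_gt0 x df.
case JE : (reg_potential f x) J0 => [j| |]// j0; last first.
  by rewrite gt0_muley ?leey// lte_fin powR_gt0// mulr_gt0.
rewrite lte_fin in j0.
pose lam := j `^ (- 2^-1); have lam0 : 0 < lam by exact: powR_gt0.
have lamE p : lam `^ p = j `^ (- (p / 2)) by rewrite -powRrM; congr (_ `^ _); lra.
have pj : (potential (-2) f x <= j%:E)%E.
  by rewrite -JE leeDl// lee_fin invr_ge0 ltW// bracket_sqr_gt0.
have pot : (potential g f x <= (2 * j `^ (- (g / 2)))%:E)%E.
  apply: (le_trans (potential_interpolation x g02 df f1 lam0)).
  apply: (@le_trans _ _ ((lam `^ g)%:E + (lam `^ (2 + g))%:E * j%:E)%E).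
    by rewrite leeD2l//; apply: lee_wpmul2l => //; rewrite lee_fin powR_ge0.
  rewrite -EFinM -EFinD lee_fin !lamE.
  have -> : j `^ (- ((2 + g) / 2)) * j = j `^ (- (g / 2)).
    rewrite -[X in _ * X](powRr1 (ltW j0)) -powRD ?(gt_eqF j0) ?implybT//.
    by congr (_ `^ _); lra.
  by rewrite -mulr2n mulr_natl.
have kp : (k%:E * potential g f x <= (2 * k * j `^ (- (g / 2)))%:E)%E.
  rewrite (_ : 2 * k * _ = k * (2 * j `^ (- (g / 2)))); last by ring.
  by rewrite EFinM; apply: lee_wpmul2l => //; rewrite lee_fin ltW.
have pot0 : (0 <= k%:E * potential g f x)%E.
  by rewrite mule_ge0 ?potential_ge0// lee_fin ltW.
apply: (@le_trans _ _ ((2 * k * j `^ (- (g / 2)))%:E `^ s)%E).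
  apply: gt0_ler_poweR => //; first exact: ltW.
    by rewrite in_itv/= pot0 leey.
  by rewrite in_itv/= (le_trans pot0 kp) leey.
rewrite poweR_EFin -EFinM lee_fin powRM ?mulr_ge0 ?powR_ge0 ?(ltW k0)//.
rewrite -powRrM (_ : - (g / 2) * s = 1); first by rewrite powRr1// ltW.
by rewrite /s; field; rewrite lt_eqF.
Qed.

Lemma sqr_bracket_le_close x y : `|x - y| <= 1 ->
  bracket x ^+ 2 <= (2 + 2 * d%:R) * bracket y ^+ 2.
Proof.
move=> xy; apply: (le_trans (sqr_bracket_le x y)).
have := sqr_enorm_le (x - y).
have : d%:R * `|x - y| ^+ 2 <= d%:R.
  by rewrite ler_piMr// expr_le1.
have : 1 <= bracket y ^+ 2 by rewrite sqr_bracket lerDl sqr_ge0.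
have : (0 : R) <= d%:R by exact: ler0n.
by nra.
Qed.

Lemma cube_norm_le v l x : 0 <= l -> cube v l x -> `|x - v| <= l.
Proof.
move=> l0 vx; apply: rV_norm_le => // i; have /andP[? ?] := vx i.
by rewrite !mxE ler_norml; apply/andP; split; lra.
Qed.

(** [1 + d] is the mass of [<w>^2 f]; 12 is the additive constant 3 of the pointwise bound times
    [l^2 <= 4]. *)
Definition reg_potential_cst : R := 2 * riesz_cst (d := d) (-2) * (1 + d%:R) + 12.

(** The weight [<x>^2] is moved onto [f] by the triangle inequality. The range [l <= 2] leaves room
    to enclose closed cubes of side at most 1 in half-open ones of twice the side. *)
Lemma reg_potential_hcube f : (2 < d)%N -> density f -> mass f = 1%E ->
  second_moment f = d%:R%:E -> forall v l, 0 < l <= 2 ->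
  (\int[mu]_(x in hcube v l) ((bracket x ^+ 2)%:E * reg_potential f x) <=
   (reg_potential_cst * l `^ (d%:R + -2))%:E)%E.
Proof.
move=> d2 df f1 f2 v l /andP[l0 l2]; have [mf f0] := df.
have d2' : 2 < d%:R :> R by rewrite ltr_nat.
pose F w := f w * bracket w ^+ 2.
have mb2 : measurable_fun setT (fun x => bracket x ^+ 2 : R).
  by apply: measurable_funX; exact: measurable_bracket.
have dF : density F.
  split; first by apply: measurable_funM.
  by move=> w; rewrite mulr_ge0// ltW// bracket_sqr_gt0.
have F1 : mass F = (1 + d%:R)%:E.
  have -> : mass F = (mass f + second_moment f)%E; last by rewrite f1 f2.
  rewrite /mass /second_moment -ge0_integralD//; last 4 first.
  - by move=> w _; rewrite lee_fin.
  - exact/measurable_EFinP.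
  - by move=> w _; rewrite lee_fin mulr_ge0 ?sqr_ge0.
  - apply/measurable_EFinP; apply: measurable_funM => //.
    by apply: measurable_funX; exact: measurable_enorm.
  by apply: eq_integral => w _; rewrite -EFinD /F sqr_bracket; congr EFin; ring.
have mp := measurable_potential (-2) dF.
have mc := @measurable_hcube R d v l.
have pt x : ((bracket x ^+ 2)%:E * reg_potential f x <= 2%:E * potential (-2) F x + 3%:E)%E.
  rewrite /reg_potential ge0_muleDr ?potential_ge0//; last first.
    by rewrite lee_fin invr_ge0 ltW// bracket_sqr_gt0.
  rewrite -EFinM mulfV ?gt_eqF ?bracket_sqr_gt0// (_ : 3%:E = 2%:E * mass f + 1%:E)%E; last first.
    by rewrite f1 mule1 -EFinD; congr EFin; ring.
  rewrite addeA leeD2r// /potential /mass.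
  have mk (G : 'rV[R]_d -> R) : measurable_fun setT G ->
      measurable_fun setT (fun w => (enorm (x - w) `^ (-2) * G w)%:E).
    move=> mG; apply/measurable_EFinP.
    exact: (measurableT_comp (measurable_kernel (-2) mG) (measurable_pair1 x)).
  have mkf := mk f mf; have mkF := mk F dF.1.
  have mf' : measurable_fun setT (fun w => (f w)%:E) by exact/measurable_EFinP.
  have b0 : (0 <= (bracket x ^+ 2)%:E)%E by rewrite lee_fin ltW// bracket_sqr_gt0.
  have kf0 w : (0 <= (enorm (x - w) `^ (-2) * f w)%:E)%E by rewrite lee_fin mulr_ge0 ?powR_ge0.
  have kF0 w : (0 <= (enorm (x - w) `^ (-2) * F w)%:E)%E.
    by rewrite lee_fin mulr_ge0 ?powR_ge0//; case: dF.
  have f0' w : (0 <= (f w)%:E)%E by rewrite lee_fin.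
  rewrite -(ge0_integralZl mu measurableT mkf (fun w _ => kf0 w) b0).
  rewrite -(ge0_integralZl mu measurableT mkF (fun w _ => kF0 w))// -(ge0_integralZl mu measurableT mf' (fun w _ => f0' w))//.
  rewrite -(ge0_integralD _ measurableT _ (measurable_funeM _ mkF) _ (measurable_funeM _ mf')); last 2 first.
  - by move=> w _; rewrite mule_ge0.
  - by move=> w _; rewrite mule_ge0.
  apply: ge0_le_integral => //.
  - by move=> w _; rewrite mule_ge0.
  - exact: measurable_funeM.
  - by apply: emeasurable_funD; exact: measurable_funeM.
  move=> w _; rewrite -!EFinM -EFinD lee_fin /F !mulrA.
  rewrite [leRHS](_ : _ = (2 * bracket w ^+ 2 * enorm (x - w) `^ (-2) + 2) * f w); last by ring.
  rewrite ler_wpM2r//.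
  have n0 := enorm_ge0 (x - w).
  apply: (@le_trans _ _ ((2 * bracket w ^+ 2 + 2 * enorm (x - w) ^+ 2) * enorm (x - w) `^ (-2))).
    by rewrite ler_wpM2r ?powR_ge0// sqr_bracket_le.
  rewrite mulrDl lerD2l -mulrA ler_piMr//.
  have [->|nz] := eqVneq (enorm (x - w)) 0; first by rewrite expr0n/= mul0r.
  by rewrite powRN powR_mulrn// mulfV// expf_neq0.
apply: (@le_trans _ _ (\int[mu]_(x in hcube v l) (2%:E * potential (-2) F x + 3%:E))%E).
  apply: ge0_le_integral => //.
  - move=> x _; rewrite mule_ge0// ?lee_fin ?(ltW (bracket_sqr_gt0 x))//.
    by rewrite ltW// reg_potential_gt0.
  - apply: measurable_funTS; apply: emeasurable_funM; first exact/measurable_EFinP.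
    exact: measurable_reg_potential.
  - by apply: measurable_funTS; apply: emeasurable_funD => //; exact: measurable_funeM.
rewrite ge0_integralD//; last 2 first.
- by move=> x _; rewrite mule_ge0// potential_ge0.
- by apply: measurable_funTS; exact: measurable_funeM.
rewrite integral_cst// [X in (_ * X)%E](lebesgue_rV_hcube v (ltW l0)).
rewrite ge0_integralZl//; last 2 first.
- exact: measurable_funTS.
- by move=> x _; exact: potential_ge0.
have m2 : - d%:R < (-2 : R) < 0 by apply/andP; split; lra.
apply: (@le_trans _ _ (2%:E * ((riesz_cst (d := d) (-2) * l `^ (d%:R + -2))%:E * (1 + d%:R)%:E) +
    3%:E * (l ^+ d)%:E)%E).
  rewrite leeD2r//; apply: lee_wpmul2l => //; rewrite -F1.
  exact: potential_hcube.
rewrite -!EFinM -EFinD lee_fin.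
have -> : l ^+ d = l `^ (d%:R + -2) * l ^+ 2.
  rewrite powR_natD// mulrAC powRN powR_mulrn ?(ltW l0)// mulVf ?mul1r//.
  by rewrite expf_neq0// gt_eqF.
have l4 : l ^+ 2 <= 4 by move: l0 l2; nra.
have := powR_ge0 l (d%:R + -2); rewrite /reg_potential_cst.
by nra.
Qed.

End soft_potentials.

Section soft_estimate.
Context {R : realType} {d : nat}.
Local Notation mu := (lebesgue_rV R d).
Implicit Types (v w x : 'rV[R]_d) (f phi : 'rV[R]_d -> R) (k g l : R).
Local Notation B1 := (2 + 2 * d%:R : R).
Local Notation C3 := (reg_potential_cst (R := R) (d := d)).

Lemma bracket_powR_close g x y : g <= 0 -> `|x - y| <= 1 ->
  bracket y `^ g <= B1 `^ (- (g / 2)) * bracket x `^ g.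
Proof.
move=> g0 xy; have B10 : 0 < B1 by rewrite ltr_pwDl// mulr_ge0.
have E z : bracket z `^ g = (bracket z ^+ 2) `^ (g / 2).
  rewrite -powR_mulrn ?(ltW (bracket_gt0 _))// -powRrM; congr (_ `^ _); lra.
have := sqr_bracket_le_close xy; rewrite -ler_pdivrMl// => le.
rewrite !E; apply: (le_trans (ler_npowR _ _ le)).
- by rewrite pmulr_lle0.
- by rewrite mulr_gt0 ?invr_gt0// bracket_sqr_gt0.
rewrite powRM ?invr_ge0 ?(ltW B10) ?(ltW (bracket_sqr_gt0 _))//.
by rewrite -(powR_inv1 (ltW B10)) -powRrM mulN1r.
Qed.

Lemma bracket_sqr_quotient x v : `|x - v| <= 1 -> 1 <= B1 / bracket v ^+ 2 * bracket x ^+ 2.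
Proof.
move=> xv; rewrite mulrAC ler_pdivlMr ?bracket_sqr_gt0// mul1r.
by apply: sqr_bracket_le_close; rewrite distrC.
Qed.

Lemma reg_potential_cst_gt0 : (2 < d)%N -> 0 < C3.
Proof.
move=> d2; have d2' : 2 < d%:R :> R by rewrite ltr_nat.
have K0 : 0 < riesz_cst (R := R) (d := d) (-2) by apply: riesz_cst_gt0; lra.
by rewrite /reg_potential_cst ltr_wpDl// !mulr_ge0 ?(ltW K0)// addr_ge0.
Qed.

(** The base is the coefficient of [l^(-2)] in the product of the bounds for the two averages: one
    factor [2 + 2 d] for each bracket frozen at the corner of the cube, and [2^(d - 2)] from
    enclosing it in a half-open cube of side [2 * l]. *)
Definition soft_A2_cst k g (a0 : R) : R :=
  let s := - (2 / g) in
  ((2 * k) `^ s * a0 `^ (- s) * B1 ^+ 2 * C3 * 2 `^ (d%:R + -2)) `^ (2 * s)^-1.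

(** Up to constants the first average is at most [<v>^-2 l^-2] and the second at most [<v>^2], so
    the brackets cancel. The power [(2 * s)^-1 = - g / 4] leaves [l * l^(g / 2)]. *)
Lemma soft_A2 k g (a0 : R) f v l (s : R) : s = - (2 / g) -> (2 < d)%N -> 0 < k -> 0 < a0 -> -2 < g < 0 ->
  density f -> mass f = 1%E -> second_moment f = d%:R%:E -> 0 < l <= 1 ->
  ((mu (cube v l)) `^ d%:R^-1 *
   (average (cube v l) (fun x => (k%:E * potential g f x) `^ s)) `^ (2 * s)^-1 *
   (average (cube v l) (fun x => ((a0 * bracket x `^ g)%:E^-1) `^ s)) `^ (2 * s)^-1
   <= (soft_A2_cst k g a0 * l `^ (1 + g / 2))%:E)%E.
Proof.
move=> ->{s}; set s := - (2 / g); move=> d2 k0 a00 g02 df f1 f2 /andP[l0 l1]; have /andP[g2 g0] := g02.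
have d0 : (0 < d)%N by rewrite (ltn_trans _ d2).
have s0 : 0 < s by rewrite oppr_gt0 pmulr_rlt0// invr_lt0.
have gs : g * s = -2 by rewrite /s; field; rewrite lt_eqF.
set p := (2 * s)^-1; have p0 : 0 < p by rewrite invr_gt0 mulr_gt0.
have pE : 2 * p = - (g / 2) by rewrite /p /s; field; rewrite lt_eqF.
have B10 : 0 < B1 by rewrite ltr_pwDl// mulr_ge0.
have C30 := reg_potential_cst_gt0 d2.
have V0 := bracket_sqr_gt0 v; set V := bracket v ^+ 2 in V0 *.
have ld : 0 < l ^+ d by rewrite exprn_gt0.
have mQ := @measurable_cube R d v l.
have QE : mu (cube v l) = (l ^+ d)%:E by exact: lebesgue_rV_cube (ltW l0).
have close x : cube v l x -> `|x - v| <= 1.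
  by move=> vx; rewrite (le_trans (cube_norm_le (ltW l0) vx)).
have mb2 : measurable_fun setT (fun x => bracket x ^+ 2 : R).
  by apply: measurable_funX; exact: measurable_bracket.
have mJ := measurable_reg_potential df.
have mbJ : measurable_fun setT (fun x => (bracket x ^+ 2)%:E * reg_potential f x)%E.
  by apply: emeasurable_funM => //; exact/measurable_EFinP.
have J0 x : (0 <= reg_potential f x)%E by rewrite ltW// reg_potential_gt0.
have bJ0 x : (0 <= (bracket x ^+ 2)%:E * reg_potential f x)%E.
  by rewrite mule_ge0// lee_fin ltW// bracket_sqr_gt0.
pose X := (l ^+ d)^-1 * ((2 * k) `^ s * (B1 / V * (C3 * (2 * l) `^ (d%:R + -2)))).
pose Y := a0 `^ (- s) * (B1 * V).
have BV0 : 0 <= B1 / V by rewrite divr_ge0 ?(ltW B10)// ltW.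
have XP : (average (cube v l) (fun x => (k%:E * potential g f x) `^ s) <= X%:E)%E.
  rewrite average_cube// [leRHS]EFinM; apply: lee_wpmul2l; first by rewrite lee_fin invr_ge0 ltW.
  apply: (@le_trans _ _ (\int[mu]_(x in cube v l) (((2 * k) `^ s * (B1 / V))%:E *
      ((bracket x ^+ 2)%:E * reg_potential f x)))%E).
    apply: ge0_le_integral => //.
    - by move=> x _; exact: poweR_ge0.
    - apply: measurable_funTS; apply: (measurableT_comp (measurable_poweR s)).
      by apply: measurable_funeM; exact: measurable_potential.
    - by apply: measurable_funTS; exact: measurable_funeM.
    move=> x vx; apply: (le_trans (reaction_powR_le x k0 g02 df f1)).
    rewrite EFinM -!muleA; apply: lee_wpmul2l; first by rewrite lee_fin powR_ge0.
    rewrite muleA -EFinM -[leLHS]mul1e; apply: lee_wpmul2r => //.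
    by rewrite lee_fin bracket_sqr_quotient// close.
  have q0 : 0 <= (2 * k) `^ s * (B1 / V) by rewrite mulr_ge0 ?powR_ge0.
  rewrite ge0_integralZl//; last exact: measurable_funTS.
  rewrite [X in (_ <= X%:E)%E]mulrA [leRHS]EFinM; apply: lee_wpmul2l; first by rewrite lee_fin.
  have mH := @measurable_hcube R d v (2 * l).
  apply: (@le_trans _ _ (\int[mu]_(x in hcube v (2 * l))
      ((bracket x ^+ 2)%:E * reg_potential f x))%E).
    apply: ge0_subset_integral => //; first exact: measurable_funTS.
    by move=> x vx i; have /andP[? ?] := vx i; apply/andP; split; lra.
  by apply: reg_potential_hcube => //; apply/andP; split; lra.
have YP : (average (cube v l) (fun x => ((a0 * bracket x `^ g)%:E^-1) `^ s) <= Y%:E)%E.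
  rewrite average_cube//.
  apply: (@le_trans _ _ ((l ^+ d)^-1%:E * \int[mu]_(x in cube v l) (cst Y%:E) x)%E); last first.
    rewrite integral_cst// [X in (_ * (_ * X))%E]QE -!EFinM lee_fin mulrC mulfK ?gt_eqF//.
  apply: lee_wpmul2l; first by rewrite lee_fin invr_ge0 ltW.
  apply: ge0_le_integral => //.
  - by move=> x _; exact: poweR_ge0.
  - apply: measurable_funTS; apply: (measurableT_comp (measurable_poweR s)).
    apply: measurable_invEFin; apply: measurable_funM => //.
    exact: (measurableT_comp (measurable_powR g) measurable_bracket).
  move=> x vx; have b0 : 0 < bracket x `^ g by rewrite powR_gt0// bracket_gt0.
  rewrite inver gt_eqF ?mulr_gt0// poweR_EFin lee_fin.
  rewrite -powR_inv1 ?mulr_ge0 ?(ltW a00) ?(ltW b0)// -powRrM mulN1r.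
  have bE : (bracket x `^ g) `^ (- s) = bracket x ^+ 2.
    by rewrite -powRrM mulrN gs opprK (powR_mulrn 2 (ltW (bracket_gt0 x))).
  rewrite powRM ?(ltW a00) ?(ltW b0)// bE.
  by rewrite ler_wpM2l ?powR_ge0//; apply: sqr_bracket_le_close; exact: close.
have X0 : 0 <= X by rewrite !mulr_ge0 ?powR_ge0 ?invr_ge0 ?(ltW ld) ?(ltW C30) ?(ltW B10) ?(ltW V0).
have Y0 : 0 <= Y by apply: mulr_ge0; [exact: powR_ge0|exact: mulr_ge0 (ltW B10) (ltW V0)].
rewrite cube_side//.
apply: (@le_trans _ _ (l * X `^ p * Y `^ p)%R%:E).
  rewrite EFinM_powR.
  have ave0 (G : 'rV[R]_d -> \bar R) : (forall x, 0 <= G x)%E -> (0 <= average (cube v l) G)%E.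
    move=> G0; rewrite average_cube// mule_ge0 ?lee_fin ?invr_ge0 ?(ltW ld)//.
    by apply: integral_ge0.
  have pw (x y : \bar R) : (0 <= x -> x <= y -> x `^ p <= y `^ p)%E.
    move=> x0 xy; apply: gt0_ler_poweR => //; first exact: ltW.
      by rewrite in_itv/= x0 leey.
    by rewrite in_itv/= (le_trans x0 xy) leey.
  apply: lee_pmul.
  - by rewrite mule_ge0 ?poweR_ge0// lee_fin ltW.
  - exact: poweR_ge0.
  - apply: lee_wpmul2l; first by rewrite lee_fin ltW.
    by apply: pw => //; apply: ave0 => x; exact: poweR_ge0.
  - by apply: pw => //; apply: ave0 => x; exact: poweR_ge0.
rewrite lee_fin -mulrA -powRM// le_eqVlt; apply/orP; left; apply/eqP.
set C4 := (2 * k) `^ s * a0 `^ (- s) * B1 ^+ 2 * C3 * 2 `^ (d%:R + -2).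
have C40 : 0 <= C4.
  apply: mulr_ge0; last exact: powR_ge0.
  apply: mulr_ge0; last exact: ltW.
  by apply: mulr_ge0; [rewrite mulr_ge0 ?powR_ge0|exact: sqr_ge0].
have -> : X * Y = C4 * l `^ (-2).
  have -> : X = (l ^+ d)^-1 * ((2 * k) `^ s * (B1 / V * (C3 * (2 `^ (d%:R + -2) * (l `^ (-2) * l ^+ d))))).
    by rewrite -(powR_natD (-2) l0) -powRM ?(ltW l0).
  rewrite /Y /C4; field.
  by rewrite !gt_eqF.
rewrite powRM ?powR_ge0// -powRrM /soft_A2_cst -/s -/p -/C4 mulrCA; congr (_ * _).
rewrite -[X in X * _](powRr1 (ltW l0)) -powRD ?(gt_eqF l0) ?implybT//.
by congr (_ `^ _); lra.
Qed.

(** The interpolation scale [r * <v>] gives both terms the size [r^d (r <v>)^g]; this produces the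
    weight [<v>^g] of the zeroth order term. *)
Lemma soft_mass k g f v (r : R) : (2 < d)%N -> 0 < k -> -2 < g < 0 ->
  density f -> mass f = 1%E -> second_moment f = d%:R%:E -> 0 < r <= 1 ->
  (\int[mu]_(x in hcube v r) (k%:E * potential g f x) <=
   (k * (r ^+ d * (r * bracket v) `^ g * (1 + B1 * C3)))%:E)%E.
Proof.
move=> d2 k0 g02 df f1 f2 /andP[r0 r1]; have /andP[g2 g0] := g02.
have B10 : 0 < B1 by rewrite ltr_pwDl// mulr_ge0.
have C30 := reg_potential_cst_gt0 d2.
set lam := r * bracket v; have lam0 : 0 < lam by rewrite mulr_gt0// bracket_gt0.
have V0 := bracket_sqr_gt0 v; set V := bracket v ^+ 2 in V0 *.
have mc := @measurable_hcube R d v r.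
have mp := measurable_potential g df.
have mb2 : measurable_fun setT (fun x => bracket x ^+ 2 : R).
  by apply: measurable_funX; exact: measurable_bracket.
have mbJ : measurable_fun setT (fun x => (bracket x ^+ 2)%:E * reg_potential f x)%E.
  by apply: emeasurable_funM; [exact/measurable_EFinP|exact: measurable_reg_potential].
have bJ0 x : (0 <= (bracket x ^+ 2)%:E * reg_potential f x)%E.
  rewrite mule_ge0// ?lee_fin ltW// ?bracket_sqr_gt0//.
  exact: reg_potential_gt0.
have BV0 : 0 <= B1 / V by rewrite divr_ge0 ?(ltW B10)// ltW.
rewrite ge0_integralZl//; last 3 first.
- exact: measurable_funTS.
- by move=> x _; exact: potential_ge0.
- by rewrite lee_fin ltW.
rewrite EFinM; apply: lee_wpmul2l; first by rewrite lee_fin ltW.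
have q0 : (0 <= (lam `^ (2 + g) * (B1 / V))%:E)%E by rewrite lee_fin mulr_ge0 ?powR_ge0.
apply: (@le_trans _ _ (\int[mu]_(x in hcube v r) ((lam `^ g)%:E +
    (lam `^ (2 + g) * (B1 / V))%:E * ((bracket x ^+ 2)%:E * reg_potential f x)))%E).
  apply: ge0_le_integral => //.
  - by move=> x _; exact: potential_ge0.
  - exact: measurable_funTS.
  - apply: measurable_funTS; apply: emeasurable_funD => //; exact: measurable_funeM.
  move=> x vx; apply: (le_trans (potential_interpolation x g02 df f1 lam0)).
  rewrite leeD2l// EFinM -!muleA; apply: lee_wpmul2l; first by rewrite lee_fin powR_ge0.
  rewrite muleA -EFinM; apply: (@le_trans _ _ (reg_potential f x)).
    by rewrite leeDl// lee_fin invr_ge0 ltW// bracket_sqr_gt0.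
  rewrite -[leLHS]mul1e; apply: lee_wpmul2r; first by rewrite ltW// reg_potential_gt0.
  rewrite lee_fin bracket_sqr_quotient// (le_trans (cube_norm_le (ltW r0) _) r1)//.
  exact: hcube_subset_cube.
rewrite ge0_integralD//; last 3 first.
- by move=> x _; rewrite lee_fin powR_ge0.
- by move=> x _; rewrite mule_ge0.
- by apply: measurable_funTS; exact: measurable_funeM.
rewrite integral_cst// [X in (_ * X)%E](lebesgue_rV_hcube v (ltW r0)).
rewrite ge0_integralZl//; last exact: measurable_funTS.
apply: (@le_trans _ _ ((lam `^ g)%:E * (r ^+ d)%:E +
    (lam `^ (2 + g) * (B1 / V))%:E * (C3 * r `^ (d%:R + -2))%:E)%E).
  rewrite leeD2l//; apply: lee_wpmul2l => //; apply: reg_potential_hcube => //.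
  by apply/andP; split; lra.
rewrite -!EFinM -EFinD lee_fin le_eqVlt; apply/orP; left; apply/eqP.
have -> : lam `^ (2 + g) = lam ^+ 2 * lam `^ g.
  by rewrite powRD ?(gt_eqF lam0) ?implybT// powR_mulrn// ltW.
rewrite (powR_natD _ r0) powRN powR_mulrn ?(ltW r0)//.
rewrite (_ : lam ^+ 2 = r ^+ 2 * V); last by rewrite /lam exprMn.
by field; rewrite !gt_eqF.
Qed.

Lemma reaction_le_diffusion_soft kA kh g (h : \bar R) : (2 < d)%N -> 0 < kA -> 0 < kh ->
  -2 < g <= 0 -> exists2 K : R, 0 < K & forall f phi (eps : R),
    density f -> mass f = 1%E -> second_moment f = d%:R%:E -> entropy f = h ->
    (h < +oo)%E -> test_function phi -> 0 < eps < 1 ->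
    (int_reaction kh g f phi <= eps%:E * int_diffusion kA g f phi +
      (K * eps `^ (g / (2 + g)))%:E * \int[mu]_v (phi v ^+ 2 * bracket v `^ g)%:E)%E.
Proof.
move=> d2 kA0 kh0 g02; have /andP[g2 g0] := g02.
have d1 : (1 < d)%N by rewrite (ltn_trans _ d2).
have d0 : (0 < d)%N by rewrite (ltn_trans _ d2).
have d2' : 2 < d%:R :> R by rewrite ltr_nat.
have [a0 a00 a0P] := diffusion_coercive h kA0 g02 d1.
have rE f : reaction kh g f = (fun x => kh%:E * potential g f x)%E.
  apply/funext => x; rewrite /reaction; case: eqP => // gd.
  by exfalso; move: gd d2' g2; lra.
(* For [g = 0] the exponent [-2/g] is meaningless, but the reaction coefficient is the constant [kh]
   times the mass, and the zeroth order term alone suffices. *)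
have [gz|gnz] := eqVneq g 0.
  exists kh => // f phi eps df f1 f2 fh hoo tphi /andP[eps0 eps1].
  have D0 : (0 <= int_diffusion kA g f phi)%E.
    apply: integral_ge0 => x _; rewrite lee_fin.
    apply: le_trans (a0P f df f1 f2 fh hoo x _).
    by rewrite !mulr_ge0 ?edot_ge0 ?powR_ge0// ltW.
  rewrite gz mul0r powRr0 mulr1 -gz.
  have [L [M [L0 phiL phiM]]] := test_functionP tphi.
  have mphi2 : measurable_fun setT (fun x => phi x ^+ 2).
    by apply: measurable_funX; exact: measurable_lipschitz_rV L0 phiL.
  have -> : int_reaction kh g f phi =
      (kh%:E * \int[mu]_v (phi v ^+ 2 * bracket v `^ g)%:E)%E.
    rewrite /int_reaction rE -ge0_integralZl//; last 3 first.
    - by apply/measurable_EFinP; rewrite gz; under eq_fun do rewrite powRr0 mulr1.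
    - by move=> x _; rewrite lee_fin mulr_ge0 ?sqr_ge0 ?powR_ge0.
    - by rewrite lee_fin ltW.
    apply: eq_integral => x _; rewrite gz powRr0 mulr1 (_ : potential 0 f x = 1%E); last first.
      by rewrite -f1; apply: eq_integral => w _; rewrite powRr0 mul1r.
    by rewrite mule1 muleC.
  by rewrite leeDr// mule_ge0// lee_fin ltW.
have g02' : -2 < g < 0 by rewrite g2 lt_neqAle gnz.
have g0' : g < 0 by rewrite lt_neqAle gnz.
pose s := - (2 / g).
have s1 : 1 < s by rewrite /s -mulrN -invrN ltr_pdivlMr; lra.
have B10 : 0 < B1 by rewrite ltr_pwDl// mulr_ge0.
have C30 := reg_potential_cst_gt0 d2.
pose CA := soft_A2_cst kh g a0.
have CA0 : 0 < CA.
  by rewrite powR_gt0// !mulr_gt0 ?powR_gt0 ?exprn_gt0 ?mulr_gt0.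
have W0 := @weighted_poincare_cst_gt0 R d s s1.
set W := weighted_poincare_cst s in W0.
pose Dd := d%:R * (2 * (2 * W * CA) ^+ 2).
have Dd0 : 0 <= Dd by apply: mulr_ge0 => //; apply: mulr_ge0 => //; exact: sqr_ge0.
(* [kap] makes [Dd * kap <= 1], which gives the coefficient [eps], and [kap <= 1], which keeps the
   radius below 1; its power enters [K] through [r^g]. *)
pose kap := (1 + Dd)^-1.
have kap0 : 0 < kap by rewrite invr_gt0 ltr_pwDl.
have kap1 : kap <= 1 by rewrite invf_le1 ?lerDl// ltr_pwDl.
have Dk : Dd * kap <= 1 by rewrite ler_pdivrMr ?mul1r ?lerDr// ltr_pwDl.
pose K := 2 * kh * (1 + B1 * C3) * B1 `^ (- (g / 2)) * kap `^ (g / (2 + g)).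
have BC0 : 0 < 1 + B1 * C3 by rewrite ltr_pwDl// mulr_ge0// ltW.
have K0 : 0 < K.
  apply: mulr_gt0; last exact: powR_gt0.
  by apply: mulr_gt0; [rewrite !mulr_gt0|exact: powR_gt0].
exists K => // f phi eps df f1 f2 fh hoo tphi /andP[eps0 eps1].
have [mf f0] := df.
have [L [M [L0 phiL phiM]]] := test_functionP tphi.
have gg0 : 0 < 2 + g by lra.
(* Solves [r^(2 + g) = kap * eps], where [r^(2 + g)] is the square of the smallness [r^(1 + g / 2)];
   then [r^g] is the announced power of [eps]. *)
pose r := (kap * eps) `^ (2 + g)^-1.
have ke0 : 0 < kap * eps by exact: mulr_gt0.
have ke1 : kap * eps <= 1 by apply: le_trans (ltW eps1); rewrite ler_piMl// ltW.
have r0 : 0 < r by exact: powR_gt0.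
have r1 : r <= 1.
  have : r <= 1 `^ (2 + g)^-1.
    by rewrite ge0_ler_powR ?nnegrE ?(ltW ke0)// invr_ge0 ltW.
  by rewrite powR1.
have rp p : r `^ p = (kap * eps) `^ (p / (2 + g)) by rewrite -powRrM; congr (_ `^ _); exact: mulrC.
pose e := CA * r `^ (1 + g / 2).
have e0 : 0 < e by apply: mulr_gt0 => //; exact: powR_gt0.
pose b x := a0 * bracket x `^ g.
have b0 x : 0 < b x by rewrite mulr_gt0// powR_gt0// bracket_gt0.
have mbg : measurable_fun setT (fun x : 'rV[R]_d => bracket x `^ g).
  exact: (measurableT_comp (measurable_powR g) measurable_bracket).
have mb : measurable_fun setT b by exact: measurable_funM.
have mH : measurable_fun setT (reaction kh g f) := measurable_reaction kh g df.
have H0 x : (0 <= reaction kh g f x)%E by apply: reaction_ge0 => //; exact: ltW.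
have Ke0 : 0 <= K * eps `^ (g / (2 + g)) by rewrite mulr_ge0 ?powR_ge0// ltW.
apply: (@local_to_global R d phi f (fun x => Num.max 0 (b x)) (fun x => bracket x `^ g)
  (reaction kh g f) L M kA g r (2 * (2 * W * e) ^+ 2)) => //.
- exact: measurable_maxr.
- by move=> x; rewrite le_max lexx.
- by move=> x; exact: powR_ge0.
- by apply: mulr_ge0 => //; exact: sqr_ge0.
- rewrite (_ : _ * d%:R = Dd * kap * eps); first by rewrite ler_piMl// ltW.
  have ->: Dd * kap * eps = Dd * (r `^ (1 + g / 2)) ^+ 2; last by rewrite /e /Dd; ring.
  rewrite -[LHS]mulrA; congr (_ * _).
  rewrite -powR_mulrn ?powR_ge0// -powRrM rp (_ : _ / _ = 1) ?powRr1 ?(ltW ke0)//.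
  by field; rewrite gt_eqF.
- apply: nearW => x e'; rewrite max_r ?(ltW (b0 x))//; exact: a0P.
move=> v.
pose Mv := kh * (r ^+ d * (r * bracket v) `^ g * (1 + B1 * C3)).
have Mv0 : 0 <= Mv.
  by rewrite !mulr_ge0 ?powR_ge0 ?(ltW kh0) ?exprn_ge0 ?(ltW r0) ?(ltW BC0).
apply: (le_trans (@cube_step R d (reaction kh g f) b phi L s r e Mv v
  d0 mH H0 mb _ L0 phiL s1 r0 e0 Mv0 _ _)).
- by apply: nearW => x; exact: ltW.
- by rewrite rE; apply: soft_mass => //; rewrite r0.
- move=> v' l /andP[l0 lr]; rewrite rE.
  apply: (le_trans (soft_A2 v' (erefl s) d2 kh0 a00 g02' df f1 f2 _)).
    by rewrite l0 (le_trans lr).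
  rewrite lee_fin ler_pM2l// ge0_ler_powR ?nnegrE ?(ltW l0) ?(ltW r0)//; lra.
have mphi2 : measurable_fun setT (fun x => phi x ^+ 2).
  by apply: measurable_funX; exact: measurable_lipschitz_rV L0 phiL.
have mc := @measurable_hcube R d v r.
have rd : 0 < r ^+ d by rewrite exprn_gt0.
rewrite leeD2l// -!ge0_integralZl ?lee_fin//; last 5 first.
- by apply/measurable_EFinP; apply: measurable_funTS; exact: measurable_funM.
- by move=> x _; rewrite lee_fin mulr_ge0 ?sqr_ge0 ?powR_ge0.
- by apply/measurable_EFinP; exact: measurable_funTS.
- by move=> x _; rewrite lee_fin sqr_ge0.
- by rewrite mulr_ge0// divr_ge0// ltW.
apply: ge0_le_integral => //.
- move=> x _; rewrite -EFinM lee_fin mulr_ge0 ?sqr_ge0// mulr_ge0// divr_ge0// ltW//.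
- apply: measurable_funeM; apply/measurable_EFinP; exact: measurable_funTS.
- apply: measurable_funeM; apply/measurable_EFinP; apply: measurable_funTS.
  exact: measurable_funM.
move=> x vx; rewrite -!EFinM lee_fin.
have xv : `|x - v| <= 1.
  by apply: (le_trans (cube_norm_le (ltW r0) (hcube_subset_cube vx))).
have cl := bracket_powR_close g0 xv.
have -> : 2 * (Mv / r ^+ d) = 2 * kh * (1 + B1 * C3) * r `^ g * bracket v `^ g.
  rewrite /Mv powRM ?(ltW r0) ?(ltW (bracket_gt0 _))//; field.
  by rewrite gt_eqF.
have -> : K * eps `^ (g / (2 + g)) = 2 * kh * (1 + B1 * C3) * r `^ g * B1 `^ (- (g / 2)).
  rewrite rp powRM ?(ltW kap0) ?(ltW eps0)// /K; ring.
set q := 2 * kh * (1 + B1 * C3) * r `^ g.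
have q0 : 0 <= q.
  by apply: mulr_ge0; [rewrite mulr_ge0 ?(ltW BC0)// mulr_ge0// ltW|exact: powR_ge0].
rewrite [leLHS](_ : _ = (q * phi x ^+ 2) * bracket v `^ g); last by ring.
rewrite [leRHS](_ : _ = (q * phi x ^+ 2) * (B1 `^ (- (g / 2)) * bracket x `^ g)); last by ring.
by apply: ler_wpM2l => //; apply: mulr_ge0 => //; exact: sqr_ge0.
Qed.

End soft_estimate.

Theorem theorem2p7 (R : realType) (C c : nat -> R -> R)
    (hC : diffusion_constant C) (hc : reaction_constant c)
    (d : nat) (hd : (3 <= d)%N) :
  (exists2 K : R -> \bar R -> \bar R -> \bar R -> R,
    (forall gamma m e h, 0 < K gamma m e h) &
    forall (gamma : R) (fin f : 'rV[R]_d -> R),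
      -2 < gamma <= 0 ->
      normalized_datum fin ->
      density f -> same_moments f fin ->
      forall (phi : 'rV[R]_d -> R) (eps : R),
        test_function phi -> 0 < eps < 1 ->
        (int_reaction (c d gamma) gamma f phi <=
         eps%:E * int_diffusion (C d gamma) gamma f phi +
         (K gamma (mass fin) (second_moment fin) (entropy fin) *
            eps `^ (gamma / (2 + gamma)))%:E *
         \int[lebesgue_rV R d]_v (phi v ^+ 2 * bracket v `^ gamma)%:E)%E) /\
  (exists (K : R -> \bar R -> \bar R -> \bar R -> R)
          (etat : R -> (R -> R) -> R -> R),
    [/\ forall gamma m e h, 0 < K gamma m e h,
        forall (s : R) (eta : R -> R), 1 < s -> modulus eta ->
          (forall x y, 0 < x -> x < y -> y < 1 ->
             etat s eta y < etat s eta x) /\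
          etat s eta x @[x --> 0^'+] --> +oo &
        forall (gamma : R) (fin f : 'rV[R]_d -> R) (CD s : R) (eta : R -> R),
          - d%:R <= gamma <= -2 ->
          normalized_datum fin ->
          density f -> same_moments f fin ->
          1 < CD -> locally_doubling f CD ->
          1 < s -> modulus eta ->
          local_A2_smallness (C d gamma) (c d gamma) gamma s eta f ->
          forall (phi : 'rV[R]_d -> R) (eps : R),
            test_function phi -> 0 < eps < 1 ->
            (int_reaction (c d gamma) gamma f phi <=
             eps%:E * int_diffusion (C d gamma) gamma f phi +
             (K gamma (mass fin) (second_moment fin) (entropy fin) *
                etat s eta eps)%:E *
             \int[lebesgue_rV R d]_v (phi v ^+ 2)%:E)%E]).
Proof.
have d0 : (0 < d)%N by rewrite (ltn_trans _ hd).
have d3 : 3 <= d%:R :> R by rewrite ler_nat.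
have C0 gamma : - d%:R <= gamma <= 0 -> 0 < C d gamma by move=> /(hC d gamma hd)[].
have c0 gamma : - d%:R < gamma <= 0 -> 0 < c d gamma by move=> /(hc d gamma hd)[].
split.
  (* The constant must be a function of [gamma] and the entropy, fixed before [f]. It is chosen for
     every pair, with the value 1 where [gamma] is out of range, so that it is positive
     everywhere. *)
  have soft (p : R * \bar R) : exists2 K : R, 0 < K & -2 < p.1 <= 0 -> (p.2 < +oo)%E ->
      forall (f phi : 'rV[R]_d -> R) (eps : R), density f -> mass f = 1%E ->
      second_moment f = d%:R%:E -> entropy f = p.2 -> test_function phi -> 0 < eps < 1 ->
      (int_reaction (c d p.1) p.1 f phi <= eps%:E * int_diffusion (C d p.1) p.1 f phi +
        (K * eps `^ (p.1 / (2 + p.1)))%:E *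
        \int[lebesgue_rV R d]_v (phi v ^+ 2 * bracket v `^ p.1)%:E)%E.
    have [g02|g02] := boolP (-2 < p.1 <= 0); last by exists 1.
    have [g2 g0] := andP g02.
    have kA : 0 < C d p.1 by apply: C0; apply/andP; split => //; lra.
    have kh : 0 < c d p.1 by apply: c0; apply/andP; split => //; lra.
    have [K K0 KP] := reaction_le_diffusion_soft p.2 hd kA kh g02.
    by exists K => // _ hoo f phi eps df f1 f2 fh; exact: KP.
  pose K p := s2val (cid2 (soft p)).
  exists (fun gamma _ _ h => K (gamma, h)) => [gamma _ _ h|]; first exact: (s2valP (cid2 (soft (gamma, h)))).
  move=> gamma fin f g02 [_ fin1 _ fin2 finh] df [f1 f2 fh] phi eps tphi eps01.
  apply: (s2valP' (cid2 (soft (gamma, entropy fin))) g02 finh) => //.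
    by rewrite f1.
  by rewrite f2.
exists (fun gamma _ _ _ => singular_cst (d := d) (c d gamma) gamma),
  (inverse_modulus (d := d)); split.
- by move=> gamma _ _ _; rewrite mulr_gt0// ltr_pwDl// mulr_ge0.
- move=> s eta _ _; split; last exact: inverse_modulus_cvg.
  by move=> x y x0 xy _; exact: inverse_modulus_decr.
move=> gamma fin f CD s eta /andP[dg g2] [_ fin1 _ fin2 finh] df [f1 f2 fh] _ _ s1 etam A2.
move=> phi eps tphi /andP[eps0 eps1].
apply: (reaction_le_diffusion (s := s)) => //.
- exact: ltn_trans hd.
- by apply: C0; rewrite dg; lra.
- by move=> g'; apply/ltW/c0; rewrite g'; lra.
- by rewrite dg.
- by rewrite f1.
- by rewrite f2 fin2 ltry.
Qed.
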